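(* Let $H$ be a semisimple quasitriangular Hopf algebra over an algebraically closed field $k$ of characteristic $0$. Then $H$ is probabilistically nilpotent, that is, $$\mathrm{Prob}(\gamma_m=1)\longrightarrow 1\quad\text{as}\quad m\to\infty,$$ where $\gamma_0=\Lambda$ and $\gamma_m=\{\gamma_{m-1},\Lambda\}$ for $m\ge1$.
   Context: Notation: $\Delta(h)=\sum h_1\otimes h_2$, $\varepsilon$, $S$ are the comultiplication, counit and antipode of $H$; $d=\dim H$; $Z(H)$ is the center of $H$; $\Lambda$ is the idempotent integral of $H$. The character algebra $R(H)\subseteq H^*$ is the span of the irreducible characters $\chi_0=\varepsilon,\dots,\chi_{n-1}$ of $H$; it is commutative (and semisimple) when $H$ is quasitriangular. Let $\lambda=\sum_i d_i\chi_i$ with $d_i=\langle\chi_i,1\rangle$, an integral of $H^*$ with $\langle\lambda,\Lambda\rangle=1$. For $h\in H$, $p\in H^*$, $h\leftharpoonup p=\sum\langle p,h_1\rangle h_2$. For $a,b\in H$, $\{a,b\}=\sum a_1b_1S(a_2)S(b_2)$; the map $z\mapsto\{z,\Lambda\}$ sends $Z(H)$ to $Z(H)$. Let $F_0=\frac1d\lambda,F_1,\dots,F_{n-1}$ be the primitive idempotents of $R(H)$. The conjugacy classes are $\mathfrak C_i=\Lambda\leftharpoonup F_iH^*$, the class sums are $C_i=\Lambda\leftharpoonup dF_i$, and the normalized class sums are $\eta_i=C_i/\dim\mathfrak C_i$. One has $\eta_0=1$, $\langle\varepsilon,\eta_i\rangle=1$, and $\{\eta_i\}$ is a basis of $Z(H)$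 dual to the basis $\{F_i\}$ of $R(H)$. A central distribution element is $z=\sum_i\alpha_i\eta_i\in Z(H)$ with all $\alpha_i$ non-negative real and $\sum_i\alpha_i=1$; it defines a distribution $X_z$ by $\mathrm{Prob}(X_z=C_i)=\alpha_i$, and $\mathrm{Prob}(z=1)$ denotes $\mathrm{Prob}(X_z=C_0)=\alpha_0$, the coefficient of $\eta_0=1$. For quasitriangular $H$ every $\gamma_m$ is a central distribution element, its coefficients with respect to $\{\eta_i\}$ being non-negative rational numbers in $\mathbb Q\subseteq k$, so the limit in question is a limit of rational numbers in $\mathbb R$. A semisimple Hopf algebra is called probabilistically nilpotent if $\mathrm{Prob}(\gamma_m=1)\to1$ as $m\to\infty$. *)

(* Defs.v *)
From HB Require Import structures.
From mathcomp Require Import all_boot all_order all_algebra all_field.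
From mathcomp Require Import all_classical all_reals topology normedtype.

Set Implicit Arguments.
Unset Strict Implicit.
Unset Printing Implicit Defensive.

Import Order.TTheory GRing.Theory Num.Theory.
Import VectorInternalTheory numFieldNormedType.Exports.

Local Open Scope ring_scope.

(* Tensor product of finite-dimensional spaces.  An element of V (x) W is     *)
(* stored as its coordinate matrix over the products of the bases underlying  *)
(* the vectType structures of V and W; the universal property is given by     *)
(* tliftE, together with tens_ext for uniqueness.                             *)

Definition tensor (K : fieldType) (V W : vectType K) : Type :=
  'M[K]_(dim V, dim W).

Arguments tensor {K} (V W)%_type.

HB.instance Definition _ (K : fieldType) (V W : vectType K) :=
  Vector.on (tensor V W).

Section Tensor.
Variable K : fieldType.
Implicit Types V W U : vectType K.

Definition tens V W (v : V) (w : W) : tensor V W := (v2r v)^T *m v2r w.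

Definition tbase V (i : 'I_(dim V)) : V := r2v (delta_mx 0 i).

(* The linear map V (x) W -> U induced by a bilinear map f.                   *)
Definition tlift V W U (f : V -> W -> U) (t : tensor V W) : U :=
  \sum_i \sum_j (t : 'M_(_, _)) i j *: f (tbase i) (tbase j).

Lemma tbaseE V (v : V) : v = \sum_i v2r v 0 i *: tbase i.
Proof.
apply: v2r_inj; rewrite linear_sum /= {1}[v2r v]row_sum_delta.
by apply: eq_bigr => i _; rewrite linearZ /= r2vK.
Qed.

Lemma tlift_is_linear V W U (f : V -> W -> U) : linear (tlift f).
Proof.
move=> a s t; rewrite /tlift scaler_sumr -big_split /=; apply: eq_bigr => i _.
rewrite scaler_sumr -big_split /=; apply: eq_bigr => j _.
by rewrite !mxE scalerDl scalerA.
Qed.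

HB.instance Definition _ V W U (f : V -> W -> U) :=
  GRing.isLinear.Build K (tensor V W) U *:%R (tlift f) (tlift_is_linear f).

Lemma tensDl V W (w : W) : linear (fun v : V => tens v w).
Proof. by move=> a u v; rewrite /tens !linearP /= mulmxDl -scalemxAl. Qed.

Lemma tensDr V W (v : V) : linear (tens v : W -> _).
Proof. by move=> a u w; rewrite /tens !linearP. Qed.

Lemma tensE V W (v : V) (w : W) i j :
  (tens v w : 'M_(_, _)) i j = v2r v 0 i * v2r w 0 j.
Proof. by rewrite mxE big_ord1 mxE. Qed.

Lemma tens_sum V W (t : tensor V W) :
  t = \sum_i \sum_j (t : 'M_(_, _)) i j *: tens (tbase i) (tbase j).
Proof.
rewrite {1}[t]matrix_sum_delta; apply: eq_bigr => i _; apply: eq_bigr => j _.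
congr (_ *: _); apply/matrixP=> a b.
by rewrite tensE !r2vK !mxE eqxx /= -natrM mulnb.
Qed.

Lemma tliftE V W U (f : V -> W -> U) :
    (forall v, linear (f v)) -> (forall w, linear (f^~ w)) ->
  forall v w, tlift f (tens v w) = f v w.
Proof.
move=> fr fl v w.
pose g v' : {linear W -> U} := HB.pack (f v') (GRing.isLinear.Build _ _ _ _ _ (fr v')).
pose h w' : {linear V -> U} :=
  HB.pack (f^~ w') (GRing.isLinear.Build _ _ _ _ _ (fl w')).
rewrite -[RHS]/(h w v) {2}[v]tbaseE linear_sum; apply: eq_bigr => i _.
rewrite linearZ /= -[f _ w]/(g (tbase i) w) {2}[w]tbaseE linear_sum scaler_sumr.
by apply: eq_bigr => j _; rewrite linearZ tensE scalerA.
Qed.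

Lemma tens_ext V W U (f g : tensor V W -> U) :
    linear f -> linear g -> (forall v w, f (tens v w) = g (tens v w)) ->
  f =1 g.
Proof.
move=> lf lg fg t.
pose f' : {linear tensor V W -> U} := HB.pack f (GRing.isLinear.Build _ _ _ _ _ lf).
pose g' : {linear tensor V W -> U} := HB.pack g (GRing.isLinear.Build _ _ _ _ _ lg).
rewrite -[f t]/(f' t) -[g t]/(g' t) [t]tens_sum !linear_sum.
apply: eq_bigr => i _; rewrite !linear_sum; apply: eq_bigr => j _.
by rewrite !linearZ /= fg.
Qed.

Lemma tlift_lin V W U (f g h : V -> W -> U) a t :
    (forall v w, f v w = a *: g v w + h v w) ->
  tlift f t = a *: tlift g t + tlift h t.
Proof.
move=> fgh; rewrite /tlift scaler_sumr -big_split; apply: eq_bigr => i _ /=.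
rewrite scaler_sumr -big_split; apply: eq_bigr => j _ /=.
by rewrite fgh scalerDr !scalerA mulrC.
Qed.

End Tensor.

Notation "V ⊗ W" := (tensor V W) (at level 40, left associativity) : type_scope.
Notation "v ⊗ w" := (tens v w) (at level 40, left associativity) : ring_scope.

Section TensorAlgebra.
Variables (K : fieldType) (A B : falgType K).

Definition tmul (s t : tensor A B) : tensor A B :=
  tlift (fun a b => tlift (fun c d => (a * c) ⊗ (b * d)) t) s.

Lemma tmul_lin_r s : linear (tmul s).
Proof. by move=> a t u; apply: tlift_lin => x y; rewrite linearP. Qed.

Lemma tmul_lin_l t : linear (tmul^~ t).
Proof. by move=> a s u; rewrite /tmul linearP. Qed.

Lemma tmulE a b c d : tmul (a ⊗ b) (c ⊗ d) = (a * c) ⊗ (b * d).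
Proof.
have Ha x y z w : tlift (fun c d : _ => (x * c) ⊗ (y * d)) (z ⊗ w)
    = (x * z) ⊗ (y * w) :> tensor A B.
  apply: (@tliftE _ A B _ (fun c d => (x * c) ⊗ (y * d))) => [v|v] e u1 u2.
    by rewrite mulrDr -scalerAr tensDr.
  by rewrite mulrDr -scalerAr tensDl.
rewrite /tmul -[RHS]Ha.
apply: (@tliftE _ A B _
  (fun a b => tlift (fun c d => (a * c) ⊗ (b * d)) (c ⊗ d))) => [x|y] e u1 u2.
  by rewrite !Ha mulrDl -scalerAl tensDr.
by rewrite !Ha mulrDl -scalerAl tensDl.
Qed.

Lemma tmul1r : left_id (1 ⊗ 1) tmul.
Proof.
move=> t; apply: (tens_ext (g := id)) t => // [|v w]; first exact: tmul_lin_r.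
by rewrite tmulE !mul1r.
Qed.

Lemma tmulr1 : right_id (1 ⊗ 1) tmul.
Proof.
move=> t; apply: (tens_ext (f := tmul^~ _) (g := id)) t => // [|v w].
  exact: tmul_lin_l.
by rewrite tmulE !mulr1.
Qed.

Lemma tmulA : associative tmul.
Proof.
move=> s t u.
apply: (tens_ext (f := fun s => tmul s (tmul t u))
  (g := fun s => tmul (tmul s t) u)) s => [||a b].
- exact: tmul_lin_l.
- by move=> e x y; rewrite !tmul_lin_l.
apply: (tens_ext (f := fun t => tmul (a ⊗ b) (tmul t u))
  (g := fun t => tmul (tmul (a ⊗ b) t) u)) t => [||c d].
- by move=> e x y; rewrite tmul_lin_l tmul_lin_r.
- by move=> e x y; rewrite tmul_lin_r tmul_lin_l.
apply: (tens_ext (f := fun u => tmul (a ⊗ b) (tmul (c ⊗ d) u))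
  (g := fun u => tmul (tmul (a ⊗ b) (c ⊗ d)) u)) u => [||x y].
- by move=> e x y; rewrite !tmul_lin_r.
- exact: tmul_lin_r.
by rewrite !tmulE !mulrA.
Qed.

Lemma tmulDl : left_distributive tmul +%R.
Proof. by move=> s t u; have := tmul_lin_l u 1 s t; rewrite !scale1r. Qed.

Lemma tmulDr : right_distributive tmul +%R.
Proof. by move=> s t u; have := tmul_lin_r s 1 t u; rewrite !scale1r. Qed.

Lemma tone_neq0 : (1 : A) ⊗ (1 : B) != 0.
Proof.
have nz (V : falgType K) : exists i, v2r (1 : V) 0 i != 0.
  apply/existsP; rewrite -negb_forall; apply/forallP=> /= v0.
  have /eqP[] := oner_neq0 V; apply: v2r_inj; rewrite linear0.
  by apply/rowP=> i; rewrite mxE; apply/eqP.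
have [[i Ai] [j Bj]] := (nz A, nz B).
apply/eqP=> /matrixP/(_ i j); rewrite tensE mxE => /eqP.
by rewrite mulf_eq0 (negPf Ai) (negPf Bj).
Qed.

HB.instance Definition _ := GRing.Zmodule_isNzRing.Build (tensor A B)
  tmulA tmul1r tmulr1 tmulDl tmulDr tone_neq0.

Lemma tscalerAl (a : K) (s t : tensor A B) : a *: (s * t) = (a *: s) * t.
Proof. by rewrite -[s * t]/(tmul s t) /tmul -linearZ. Qed.

HB.instance Definition _ :=
  GRing.Lmodule_isLalgebra.Build K (tensor A B) tscalerAl.

Lemma tscalerAr (a : K) (s t : tensor A B) : a *: (s * t) = s * (a *: t).
Proof. by have := tmul_lin_r s a t 0; rewrite -[tmul s 0]/(s * 0) mulr0 !addr0. Qed.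

HB.instance Definition _ :=
  GRing.Lalgebra_isAlgebra.Build K (tensor A B) tscalerAr.

HB.instance Definition _ := Algebra_isFalgebra.Build K (tensor A B).

End TensorAlgebra.

Section TensorMaps.
Variable K : fieldType.
Implicit Types V W X : vectType K.

Definition tmap V W V' W' (f : V -> V') (g : W -> W') : V ⊗ W -> V' ⊗ W' :=
  tlift (fun v w => f v ⊗ g w).

Definition tswap V W : V ⊗ W -> W ⊗ V := tlift (fun v w => w ⊗ v).

Definition tassoc V W X : V ⊗ (W ⊗ X) -> V ⊗ W ⊗ X :=
  tlift (fun v => tlift (fun w x => v ⊗ w ⊗ x)).

End TensorMaps.

HB.mixin Record isHopf (K : fieldType) H of Falgebra K H := {
  comul : 'AHom(H, (H ⊗ H)%type);
  counit : 'AHom(H, (K^o)%type);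
  antipode : 'End(H);
  comulA : forall h : H,
    tmap comul id (comul h) = tassoc (tmap id comul (comul h));
  counit_l : forall h : H, tlift (fun h1 h2 => counit h1 *: h2) (comul h) = h;
  counit_r : forall h : H, tlift (fun h1 h2 => counit h2 *: h1) (comul h) = h;
  antipode_l : forall h : H,
    tlift (fun h1 h2 => antipode h1 * h2) (comul h) = (counit h)%:A;
  antipode_r : forall h : H,
    tlift (fun h1 h2 => h1 * antipode h2) (comul h) = (counit h)%:A
}.

#[short(type="hopfType")]
HB.structure Definition Hopf (K : fieldType) :=
  { H of Falgebra K H & isHopf K H }.

Section Semisimple.
Variables (K : fieldType) (A : falgType K).

Definition left_ideal (V : {vspace A}) : bool := (fullv * V <= V)%VS.

Definition simple_left_ideal (V : {vspace A}) : Prop :=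
  [/\ V != 0%VS, left_ideal V
    & forall W, left_ideal W -> (W <= V)%VS -> W = 0%VS \/ W = V].

Definition semisimple : Prop :=
  exists n (V : 'I_n -> {vspace A}),
    [/\ forall i, simple_left_ideal (V i),
        directv (\sum_i V i) & (\sum_i V i)%VS = fullv].

Definition irreducible n (rho : 'AHom(A, 'M[K]_n.+1)) : Prop :=
  forall W : {vspace 'cV[K]_n.+1},
    (forall a w, w \in W -> rho a *m w \in W) -> W = 0%VS \/ W = fullv.

Definition irr_character (chi : 'Hom(A, (K^o)%type)) : Prop :=
  exists n (rho : 'AHom(A, 'M[K]_n.+1)),
    irreducible rho /\ forall a, chi a = \tr (rho a).

End Semisimple.

Section HopfTheory.
Variables (K : fieldType) (H : hopfType K).
Local Notation dual := 'Hom(H, (K^o)%type).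
Local Notation Delta := (comul : H -> H ⊗ H).

(* The product of the dual algebra:  <p q, h> = \sum <p, h_1> <q, h_2>.       *)
Definition conv (p q : dual) : dual :=
  linfun (fun h => tlift (fun h1 h2 => p h1 * q h2) (Delta h)).

Lemma convE p q h : conv p q h = tlift (fun h1 h2 => p h1 * q h2) (Delta h).
Proof.
pose f x := tlift (fun h1 h2 => p h1 * q h2) (Delta x).
have lf : linear f by move=> a x y; rewrite /f !linearP.
pose f' : {linear H -> K^o} := HB.pack f (GRing.isLinear.Build _ _ _ _ _ lf).
exact: (lfunE f').
Qed.

(* hit h p is  h <- p = \sum <p, h_1> h_2.                                    *)
Definition hit (h : H) (p : dual) : H :=
  tlift (fun h1 h2 => (p h1 : K) *: h2) (Delta h).

(* brace a b is  {a, b} = \sum a_1 b_1 S(a_2) S(b_2).                         *)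
Definition brace (a b : H) : H :=
  tlift (fun a1 a2 =>
    tlift (fun b1 b2 => a1 * b1 * antipode a2 * antipode b2) (Delta b))
  (Delta a).

Definition idempotent_integral (L : H) : Prop :=
  [/\ forall h, h * L = (counit h : K) *: L,
      forall h, L * h = (counit h : K) *: L, L != 0 & L * L = L].

Definition leg12 (r : H ⊗ H) : H ⊗ H ⊗ H := r ⊗ 1.
Definition leg13 : H ⊗ H -> H ⊗ H ⊗ H := tlift (fun a b => a ⊗ 1 ⊗ b).
Definition leg23 : H ⊗ H -> H ⊗ H ⊗ H := tlift (fun a b => 1 ⊗ a ⊗ b).

Definition universal_R_matrix (r : H ⊗ H) : Prop :=
  [/\ r \is a GRing.unit,
      forall h, tswap (Delta h) = r * Delta h * r^-1,
      tmap Delta id r = leg13 r * leg23 r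
    & tassoc (tmap id Delta r) = leg13 r * leg12 r].

Definition quasitriangular : Prop := exists r, universal_R_matrix r.

Definition irr_enum n (chi : 'I_n.+1 -> dual) : Prop :=
  [/\ injective chi, forall p, irr_character p <-> exists i, p = chi i
    & chi ord0 = counit].

Definition character_algebra n (chi : 'I_n.+1 -> dual) : {vspace dual} :=
  <<codom chi>>%VS.

Definition dual_integral n (chi : 'I_n.+1 -> dual) : dual :=
  \sum_i (chi i 1 : K) *: chi i.

Definition primitive_idempotent (R : {vspace dual}) (e : dual) : Prop :=
  [/\ e \in R, e != 0, conv e e = e
    & forall f g, f \in R -> g \in R -> conv f f = f -> conv g g = g ->
        conv f g = 0 -> conv g f = 0 -> e = f + g -> f = 0 \/ g = 0].

Definition primitive_idempotent_enum n (chi F : 'I_n.+1 -> dual) : Prop :=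
  [/\ injective F,
      forall e, primitive_idempotent (character_algebra chi) e
                <-> exists i, e = F i
    & F ord0 = (\dim {:H})%:R^-1 *: dual_integral chi].

(* conjugacy_class L p is  L <- p H^*.                                        *)
Definition conjugacy_class (L : H) (p : dual) : {vspace H} :=
  limg (linfun (fun q : dual => hit L (conv p q))).

Definition class_sum (L : H) (p : dual) : H := hit L ((\dim {:H})%:R *: p).

Definition normalized_class_sum (L : H) (p : dual) : H :=
  (\dim (conjugacy_class L p))%:R^-1 *: class_sum L p.

Lemma conjugacy_classP L p h :
  reflect (exists q, h = hit L (conv p q)) (h \in conjugacy_class L p).
Proof.
pose f q := hit L (conv p q).
have lf : linear f.
  move=> a q1 q2; apply: tlift_lin => v w; rewrite !convE scalerA -scalerDl.
  congr (_ *: _); apply: (@tlift_lin _ _ _ K^o) => x y.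
  by rewrite add_lfunE scale_lfunE mulrDr; congr (_ + _); exact: mulrCA.
pose f' : {linear dual -> H} := HB.pack f (GRing.isLinear.Build _ _ _ _ _ lf).
apply: (iffP memv_imgP) => [[q _ ->]|[q ->]]; exists q; rewrite ?memvf //.
  exact: (lfunE f').
exact/esym/(lfunE f').
Qed.

(* alpha is the distribution of the central distribution element z, i.e.      *)
(* alpha i = Prob (X_z = C_i).  The weights are taken in rat, which embeds    *)
(* both in K and in the reals.                                                *)
Definition central_distribution n (eta : 'I_n.+1 -> H) (z : H)
    (alpha : 'I_n.+1 -> rat) : Prop :=
  [/\ z \in 'Z({:H})%VS, forall i, 0 <= alpha i, \sum_i alpha i = 1
    & z = \sum_i ratr (alpha i) *: eta i].

Fixpoint gamma (L : H) (m : nat) : H :=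
  if m is m'.+1 then brace (gamma L m') L else L.

(* Prob (gamma_m = 1) is the weight of eta_0.                                 *)
Definition probabilistically_nilpotent (R : realType) (L : H) n
    (F : 'I_n.+1 -> dual) : Prop :=
  let eta i := normalized_class_sum L (F i) in
  (forall m, exists alpha, central_distribution eta (gamma L m) alpha) /\
  (forall alpha : nat -> 'I_n.+1 -> rat,
     (forall m, central_distribution eta (gamma L m) (alpha m)) ->
   (ratr (alpha m ord0) @[m --> \oo] --> (1 : R))%classic).

End HopfTheory.

(* Main.v *)
Require Import Defs.
From HB Require Import structures.
From mathcomp Require Import all_boot all_order all_algebra all_field.
From mathcomp Require Import cyclic ring zify.
From mathcomp Require Import all_classical all_reals topology normedtype.
From mathcomp Require Import sequences.

Set Implicit Arguments.
Unset Strict Implicit.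
Unset Printing Implicit Defensive.

Import Order.TTheory GRing.Theory Num.Theory.
Import VectorInternalTheory numFieldNormedType.Exports.

Local Open Scope ring_scope.

(** The elements γ_m describe a Markov chain on the set of conjugacy classes.
    A central element is z = Σ F_i(z) η_i, and a commutator step is linear in
    z, with matrix P(l, i) = F_i({η_l, Λ}).  The counit is the sum of the F_i,
    so the rows of P add up to 1.  Two facts remain: the entries of P are
    non-negative rational numbers, and from each class the chain jumps to the
    class of 1 with probability at least 1/d, where d = dim H.  The class of 1
    is thus absorbing, and the mass outside it shrinks by the factor 1 - 1/d
    at every step (absorbing_walk_converges).

    The entries of P.  The map x ↦ Σ Λ_1 x S(Λ_2) projects H onto its centre
    without changing the value of a tracelike functional; expanding it in class
    sums gives {η_l, Λ} = η_l S(η_l) (brace_eta).  As F_0 is the integral of H*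
    divided by d, P(l, 0) = 1 / dim C_l (brace_eta0), which is at least 1/d.
    For the other entries the point is that d^2 p((Λ ↼ e)(Λ ↼ f)) is a natural
    number for all tracelike idempotents p, e, f (class_product_integral): it
    is the trace of an idempotent operator on H ⊗ H.  An R-matrix lets a
    functional q act on any module with a compatible coaction by
    m ↦ Σ q(R^1 m_(-1)) R^2 m_0; on tracelike functionals this turns
    convolution into composition (theta_conv), and on H with the adjoint action
    it is the translation h ↦ Σ h_1 q(h_2) (theta_adj_rop).  On H ⊗ H the
    operator of p commutes with the translations by e and f in the two factors,
    and the composite of the three is idempotent.  Tracing out the first
    factor leaves the central element d (Λ ↼ e), which reduces the trace to a
    translation of H (tr_theta2, part_tr_hit, tr_rop).

    All this rests on S^2 = id, which is reached through traces.  The trace of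
    x ↦ S^2(x) h is an integral lam of H* (lam_int); it yields a grouplike
    element g with S^4(a) g = g a (anti4), and g has finite order.  The
    Drinfeld element u satisfies S^2(h) = u h u^-1 (anti2), so some power of u
    is central and u acts on each irreducible module as a scalar times a matrix
    of finite order.  Hence Tr S^2 = Σ χ(u) χ(u^-1) is a sum of products of
    a sum of roots of unity with the sum of their inverses.  For complex roots
    of unity these are squared absolute values, and the term of the trivial
    character is 1, so the sum does not vanish (lam1_neq0).  This forces g = 1
    and S^4 = id.  Finally
    Tr(S^2 ∘ translation by F_0) = Tr(S^2) / d is an integer, as S^2 is an
    involution commuting with an idempotent, so the non-zero integer Tr S^2 is
    d or -d and, S^2 fixing 1, it is d (anti2_id).

    Semisimplicity enters through matrix units built from Λ (mat_unitE), which
    show that the tracelike functionals are the linear combinations of the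
    irreducible characters (tracelike_span): R(H) is the algebra of tracelike
    functionals.  The R-matrix makes it commutative (convC), so its primitive
    idempotents are orthogonal (primitive_orth). *)

(** * Sweedler calculus *)

(** Sweedler notation: the tensor t is fed, as a sum of pure tensors a ⊗ b,
    into an expression that is bilinear in a and b.  Lemmas prefixed by sw_
    state identities of the form Σ F(t) = Σ F'(t'), for an arbitrary F, so that
    they apply under any number of further sums. *)
Notation "Σ[ a , b <- t ] E" := (tlift (fun a b => E) t)
  (at level 41, a name, b name, E at level 41, right associativity,
   format "'[' Σ[ a ,  b  <-  t ] '/  '  E ']'") : ring_scope.

Section Linearity.
Variable K : fieldType.
Implicit Types U V W X Y : vectType K.

(** Side conditions of Sweedler identities all say that some expression is
    linear in one of its variables.  The lemmas below have one clause for each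
    way of building expressions, and the tactic lin picks them by the shape
    of the expression. *)
Lemma lin_id V : linear (fun x : V => x).
Proof. by []. Qed.

Lemma lin_lfun V W X (g : 'Hom(W, X)) (f : V -> W) :
  linear f -> linear (fun x => g (f x)).
Proof. by move=> lf a u v; rewrite lf linearP. Qed.

Lemma lin_tlift V W X U (F : W -> X -> U) (f : V -> W ⊗ X) :
  linear f -> linear (fun x => tlift F (f x)).
Proof. by move=> lf a u v; rewrite lf linearP. Qed.

Lemma lin_tlift_body V W X U (F : V -> W -> X -> U) (t : W ⊗ X) :
  (forall a b, linear (fun x => F x a b)) -> linear (fun x => tlift (F x) t).
Proof. by move=> lF a u v; apply: tlift_lin => x y; rewrite lF. Qed.

Lemma lin_tensl V W X (f : V -> W) (y : X) :
  linear f -> linear (fun x => f x ⊗ y).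
Proof. by move=> lf a u v; rewrite lf tensDl. Qed.

Lemma lin_tensr V W X (f : V -> W) (y : X) :
  linear f -> linear (fun x => y ⊗ f x).
Proof. by move=> lf a u v; rewrite lf tensDr. Qed.

Lemma lin_mull V (A : falgType K) (f : V -> A) (y : A) :
  linear f -> linear (fun x => f x * y).
Proof. by move=> lf a u v; rewrite lf mulrDl scalerAl. Qed.

Lemma lin_mulr V (A : falgType K) (f : V -> A) (y : A) :
  linear f -> linear (fun x => y * f x).
Proof. by move=> lf a u v; rewrite lf mulrDr scalerAr. Qed.

Lemma lin_mulKl V (f : V -> K^o) (y : K) :
  linear f -> linear (fun x => ((f x : K) * y : K^o)).
Proof. by move=> lf a u v; rewrite lf mulrDl scalerAl. Qed.

Lemma lin_mulKr V (f : V -> K^o) (y : K) :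
  linear f -> linear (fun x => (y * (f x : K) : K^o)).
Proof. by move=> lf a u v; rewrite lf mulrDr scalerAr. Qed.

Lemma lin_scalel V W (f : V -> K^o) (y : W) :
  linear f -> linear (fun x => (f x : K) *: y).
Proof. by move=> lf a u v; rewrite lf scalerDl scalerA. Qed.

Lemma lin_scaler V W (f : V -> W) (c : K) :
  linear f -> linear (fun x => c *: f x).
Proof. by move=> lf a u v; rewrite lf scalerDr !scalerA mulrC. Qed.

Lemma lin_add V W (f g : V -> W) :
  linear f -> linear g -> linear (fun x => f x + g x).
Proof.
by move=> lf lg a u v; rewrite lf lg scalerDr -!addrA; congr (_ + _); rewrite addrCA.
Qed.

Lemma lin_opp V W (f : V -> W) : linear f -> linear (fun x => - f x).
Proof. by move=> lf a u v; rewrite lf opprD scalerN. Qed.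

Lemma lin_sum V W (I : Type) (r : seq I) (P : pred I) (f : I -> V -> W) :
  (forall i, linear (f i)) -> linear (fun x => \sum_(i <- r | P i) f i x).
Proof.
move=> lf a u v; rewrite scaler_sumr -big_split; apply: eq_bigr => i _.
by rewrite lf.
Qed.

Lemma lin_mulmxl V m n p (f : V -> 'M[K]_(m, n)) (B : 'M_(n, p)) :
  linear f -> linear (fun x => f x *m B).
Proof. by move=> lf a u v; rewrite lf mulmxDl scalemxAl. Qed.

Lemma lin_mulmxr V m n p (f : V -> 'M[K]_(n, p)) (B : 'M_(m, n)) :
  linear f -> linear (fun x => B *m f x).
Proof. by move=> lf a u v; rewrite lf linearP. Qed.

Lemma lin_entry V m n (f : V -> 'M[K]_(m, n)) i j :
  linear f -> linear (fun x => (f x i j : K^o)).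
Proof. by move=> lf a u v; rewrite lf !mxE. Qed.

Lemma lin_mxtrace V n (f : V -> 'M[K]_n) :
  linear f -> linear (fun x => (\tr (f x) : K^o)).
Proof. by move=> lf a u v; rewrite lf linearP. Qed.

Lemma lin_comp V W X (g : W -> X) (f : V -> W) :
  linear g -> linear f -> linear (fun x => g (f x)).
Proof. by move=> lg lf a u v; rewrite lf lg. Qed.

Definition bilin V W X (F : V -> W -> X) : Prop :=
  (forall y, linear (fun x => F x y)) /\ (forall x, linear (fun y => F x y)).

Definition trilin V W X U (F : V -> W -> X -> U) : Prop :=
  (forall y, bilin (fun x z => F x y z)) /\ (forall x z, linear (fun y => F x y z)).

Lemma bilinl V W X (F : V -> W -> X) y : bilin F -> linear (fun x => F x y).
Proof. by case. Qed.

Lemma bilinr V W X (F : V -> W -> X) x : bilin F -> linear (F x).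
Proof. by case. Qed.

Lemma trilin1 V W X U (F : V -> W -> X -> U) y z :
  trilin F -> linear (fun x => F x y z).
Proof. by case=> /(_ y)[]. Qed.

Lemma trilin2 V W X U (F : V -> W -> X -> U) x z :
  trilin F -> linear (fun y => F x y z).
Proof. by case. Qed.

Lemma trilin3 V W X U (F : V -> W -> X -> U) x y : trilin F -> linear (F x y).
Proof. by case=> /(_ y)[]. Qed.

(** The generic lemmas on linear maps expect the linearity to be part of the
    map; this carries it there from a side condition. *)
Definition lin_pack V W (f : V -> W) (lf : linear f) : {linear V -> W} :=
  HB.pack f (GRing.isLinear.Build _ _ _ _ _ lf).

Lemma lin0 V W (f : V -> W) : linear f -> f 0 = 0.
Proof. by move=> lf; exact: (linear0 (lin_pack lf)). Qed.

Lemma linD V W (f : V -> W) : linear f -> {morph f : x y / x + y}.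
Proof. by move=> lf; exact: (linearD (lin_pack lf)). Qed.

Lemma linZ V W (f : V -> W) c x : linear f -> f (c *: x) = c *: f x.
Proof. by move=> lf; exact: (linearZ_LR (lin_pack lf)). Qed.

Lemma linS V W (f : V -> W) (I : Type) (r : seq I) (P : pred I) (F : I -> V) :
  linear f -> f (\sum_(i <- r | P i) F i) = \sum_(i <- r | P i) f (F i).
Proof. by move=> lf; exact: (linear_sum (lin_pack lf)). Qed.

Lemma lfunE_lin V W (f : V -> W) : linear f -> linfun f =1 f.
Proof. by move=> lf x; exact: (lfunE (lin_pack lf)). Qed.

End Linearity.

(** Linearity facts about maps given by formulas; they are the leaves of the
    recursion performed by lin. *)
Create HintDb sweedler.

Ltac lin_atom :=
  cbv beta;
  first [ solve [auto 3 with sweedler nocore]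
        | apply: bilinl; solve [auto 2 with sweedler nocore]
        | apply: bilinr; solve [auto 2 with sweedler nocore]
        | apply: trilin1; solve [auto 2 with sweedler nocore]
        | apply: trilin2; solve [auto 2 with sweedler nocore]
        | apply: trilin3; solve [auto 2 with sweedler nocore] ].

Ltac lin :=
  cbv beta;
  lazymatch goal with
  | |- trilin _ => split; [intro; split|]; lin
  | |- bilin _ => split; lin
  | |- forall _, _ => intro; lin
  | |- @GRing.linear_for _ _ _ _ ?F =>
    lazymatch F with
    | (fun x => x) => exact: lin_id
    | (fun x => fun_of_lfun _ _) => apply: lin_lfun; lin
    | (fun x => tlift _ _) =>
        first [apply: lin_tlift | apply: lin_tlift_body]; lin
    | (fun x => tens _ _) => first [apply: lin_tensr | apply: lin_tensl]; lin
    | (fun x => _ * _) =>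
        first [ apply: lin_mull | apply: lin_mulr
              | apply: lin_mulKl | apply: lin_mulKr]; lin
    | (fun x => _ *: _) => first [apply: lin_scaler | apply: lin_scalel]; lin
    | (fun x => _ *m _) => first [apply: lin_mulmxr | apply: lin_mulmxl]; lin
    | (fun x => fun_of_matrix _ _ _) => apply: lin_entry; lin
    | (fun x => mxtrace _) => apply: lin_mxtrace; lin
    | (fun x => - _) => apply: lin_opp; lin
    | (fun x => _ + _) => apply: lin_add; lin
    | (fun x => \sum_(i <- _ | _) _) => apply: lin_sum; lin
    | _ =>
        first
        [ lin_atom
        | match F with
          | (fun x => ?g (@?f x)) =>
            apply: (@lin_comp _ _ _ _ g f); [by lin_atom | lin]
          | (fun x => ?g (@?f x) ?b) =>
            apply: (@lin_comp _ _ _ _ (fun z => g z b) f); [by lin_atom | lin]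
          | (fun x => ?g (@?f x) ?b ?c) =>
            apply: (@lin_comp _ _ _ _ (fun z => g z b c) f); [by lin_atom | lin]
          | (fun x => ?g (@?f x) ?b ?c ?d) =>
            apply: (@lin_comp _ _ _ _ (fun z => g z b c d) f); [by lin_atom | lin]
          end
        | lazymatch F with
          | (fun x => _) => fail
          | _ => change (linear (fun x => F x)); lin end ]
    end
  end.

#[global] Hint Extern 0 (@GRing.linear_for _ _ _ _ _) => solve [lin] : core.
#[global] Hint Extern 0 (bilin _) => solve [lin] : core.
#[global] Hint Extern 0 (trilin _) => solve [lin] : core.

Section TensorCalculus.
Variable K : fieldType.
Implicit Types U V W X Y : vectType K.

Lemma eq_tlift V W X (F G : V -> W -> X) t :
  (forall a b, F a b = G a b) -> tlift F t = tlift G t.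
Proof.
by move=> FG; apply: eq_bigr => i _; apply: eq_bigr => j _; rewrite FG.
Qed.

Lemma tlift_out V W X U (g : X -> U) (F : V -> W -> X) t :
  linear g -> g (tlift F t) = Σ[a, b <- t] g (F a b).
Proof.
move=> lg; rewrite /tlift linS //; apply: eq_bigr => i _.
by rewrite linS //; apply: eq_bigr => j _; rewrite linZ.
Qed.

Lemma mul_tlift V W (A : falgType K) (x : A) (F : V -> W -> A) t :
  x * tlift F t = Σ[a, b <- t] (x * F a b).
Proof. by rewrite (tlift_out (g := fun y => x * y)). Qed.

Lemma tlift_mul V W (A : falgType K) (x : A) (F : V -> W -> A) t :
  tlift F t * x = Σ[a, b <- t] (F a b * x).
Proof. by rewrite (tlift_out (g := fun y => y * x)). Qed.

Lemma lfun_tlift V W X U (g : 'Hom(X, U)) (F : V -> W -> X) t :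
  g (tlift F t) = Σ[a, b <- t] g (F a b).
Proof. by rewrite tlift_out. Qed.

Lemma scale_tlift V W X (c : K) (F : V -> W -> X) t :
  c *: tlift F t = Σ[a, b <- t] c *: F a b.
Proof. by rewrite (tlift_out (g := fun y => c *: y)). Qed.

Lemma tlift_scale V W X (F : V -> W -> K^o) (x : X) t :
  (tlift F t : K) *: x = Σ[a, b <- t] ((F a b : K) *: x).
Proof. by rewrite (tlift_out (g := fun y : K^o => (y : K) *: x)). Qed.

Lemma tlift_tlift V W X U Y (F : X -> U -> Y) (G : V -> W -> X ⊗ U)
    (t : V ⊗ W) :
  tlift F (tlift G t) = Σ[a, b <- t] tlift F (G a b).
Proof. by rewrite tlift_out. Qed.

Lemma tlift_tens V W X (F : V -> W -> X) v w :
  bilin F -> tlift F (v ⊗ w) = F v w.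
Proof. by move=> [Fl Fr]; rewrite tliftE. Qed.

Lemma tlift_tmap V W (V' W' X : vectType K) (f : V -> V') (g : W -> W') (F : V' -> W' -> X) t :
  bilin F -> tlift F (tmap f g t) = Σ[a, b <- t] F (f a) (g b).
Proof.
move=> bF; rewrite /tmap tlift_out //.
by apply: eq_tlift => a b; rewrite tlift_tens.
Qed.

Lemma tlift_tswap V W X (F : W -> V -> X) t :
  bilin F -> tlift F (tswap t) = Σ[a, b <- t] F b a.
Proof.
move=> bF; rewrite /tswap tlift_out //.
by apply: eq_tlift => a b; rewrite tlift_tens.
Qed.

Lemma tlift_mulE (A B : falgType K) X (F : A -> B -> X) (s t : A ⊗ B) :
  bilin F ->
  tlift F (s * t) = Σ[a, b <- s] Σ[c, d <- t] F (a * c) (b * d).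
Proof.
move=> bF; rewrite -[s * t]/(tmul s t) /tmul tlift_out //.
apply: eq_tlift => a b; rewrite tlift_out //.
by apply: eq_tlift => c d; rewrite tlift_tens.
Qed.

Lemma tlift_oneE (A B : falgType K) X (F : A -> B -> X) :
  bilin F -> tlift F (1 : A ⊗ B) = F 1 1.
Proof. by move=> bF; rewrite -[1]/(1 ⊗ 1) tlift_tens. Qed.

Lemma tens_tlift V W (t : V ⊗ W) : t = Σ[a, b <- t] (a ⊗ b).
Proof. by rewrite {1}[t]tens_sum. Qed.

Lemma tlift_sum V W X (I : Type) (r : seq I) (P : pred I) (F : I -> V -> W -> X) t :
  (Σ[a, b <- t] \sum_(i <- r | P i) F i a b)
  = \sum_(i <- r | P i) Σ[a, b <- t] F i a b.
Proof.
rewrite /tlift [RHS]exchange_big; apply: eq_bigr => i _ /=.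
rewrite [RHS]exchange_big; apply: eq_bigr => j _ /=.
by rewrite scaler_sumr.
Qed.

Lemma tlift0 V W X (F : V -> W -> X) t :
  (forall a b, F a b = 0) -> tlift F t = 0.
Proof.
move=> F0; rewrite /tlift big1 // => i _; rewrite big1 // => j _.
by rewrite F0 scaler0.
Qed.

Lemma tliftB V W X (F G : V -> W -> X) t :
  (Σ[a, b <- t] (F a b - G a b)) = tlift F t - tlift G t.
Proof.
rewrite (tlift_lin (f := fun a b => F a b - G a b) (g := fun a b => - G a b)
  (h := F) (a := 1)); last by move=> v w; rewrite scale1r addrC.
rewrite scale1r addrC (tlift_lin (f := fun a b => - G a b) (g := G)
  (h := fun _ _ => 0) (a := -1)).
  by rewrite scaleN1r [tlift (fun _ _ => 0) t]tlift0 // addr0.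
by move=> v w; rewrite scaleN1r addr0.
Qed.

Lemma tlift_exchange V W (V' W' X : vectType K)
    (F : V -> W -> V' -> W' -> X) (s : V ⊗ W) (t : V' ⊗ W') :
  (Σ[a, b <- s] Σ[c, d <- t] F a b c d)
  = Σ[c, d <- t] Σ[a, b <- s] F a b c d.
Proof.
have E (G : V -> W -> X) : tlift G s = \sum_i \sum_j (s : 'M_(_, _)) i j *: G (tbase i) (tbase j) by [].
rewrite E; under eq_bigr do under eq_bigr do rewrite scale_tlift.
by under eq_bigr do rewrite -tlift_sum; rewrite -tlift_sum.
Qed.

End TensorCalculus.

(** * The axioms of a Hopf algebra in Sweedler form *)

(** The structure maps as plain linear maps, which gives linearity lemmas a
    single shape to match; multiplicativity is recovered in coprodM, coprod1,
    counM and coun1. *)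
Definition coprod (K : fieldType) (H : hopfType K) : 'Hom(H, (H ⊗ H)%type) :=
  comul.
Definition coun (K : fieldType) (H : hopfType K) : 'Hom(H, (K^o)%type) := counit.
Definition anti (K : fieldType) (H : hopfType K) : 'End(H) := antipode.
Arguments coprod {K H}.
Arguments coun {K H}.
Arguments anti {K H}.
Notation Δ := coprod.
Notation ε := coun.
Notation S := anti.

(** For a semisimple algebra these functionals are the combinations of
    characters; the arguments below use only this symmetry. *)
Definition tracelike (K : fieldType) (H : hopfType K) (p : 'Hom(H, (K^o)%type)) :=
  forall x y : H, p (x * y) = p (y * x).

Section HopfCalculus.
Variables (K : fieldType) (H : hopfType K).
Implicit Types (x y h : H) (V : vectType K).

Lemma coprodM x y : Δ (x * y) = Δ x * Δ y.
Proof. exact: rmorphM. Qed.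

Lemma coprod1 : Δ (1 : H) = 1.
Proof. exact: rmorph1. Qed.

Lemma counM x y : ε (x * y) = ε x * ε y.
Proof. exact: rmorphM. Qed.

Lemma coun1 : ε (1 : H) = 1.
Proof. exact: rmorph1. Qed.

Lemma sw_assoc V (F : H -> H -> H -> V) h : trilin F ->
  (Σ[t, c <- Δ h] Σ[a, b <- Δ t] F a b c)
  = Σ[a, t <- Δ h] Σ[b, c <- Δ t] F a b c.
Proof.
move=> tF.
pose G (t : H ⊗ H) (c : H) := Σ[a, b <- t] F a b c.
have bG : bilin G.
  by rewrite /G; lin.
have := congr1 (tlift G) (comulA h : tmap Δ id (Δ h) = tassoc (tmap id Δ (Δ h))).
rewrite tlift_tmap // => ->.
rewrite /tassoc tlift_tlift /tmap tlift_tlift; apply: eq_tlift => a t.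
rewrite tlift_tens // tlift_tlift; apply: eq_tlift => b c.
by rewrite tlift_tens // /G tlift_tens.
Qed.

Lemma coun_l h : (Σ[a, b <- Δ h] (ε a : K) *: b) = h.
Proof. exact: counit_l. Qed.

Lemma coun_r h : (Σ[a, b <- Δ h] (ε b : K) *: a) = h.
Proof. exact: counit_r. Qed.

Lemma sw_counitl V (G : H -> V) h : linear G ->
  (Σ[a, b <- Δ h] (ε a : K) *: G b) = G h.
Proof.
move=> lG; rewrite -{2}[h](coun_l h) tlift_out //.
by apply: eq_tlift => a b; rewrite linZ.
Qed.

Lemma sw_counitr V (G : H -> V) h : linear G ->
  (Σ[a, b <- Δ h] (ε b : K) *: G a) = G h.
Proof.
move=> lG; rewrite -{2}[h](coun_r h) tlift_out //.
by apply: eq_tlift => a b; rewrite linZ.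
Qed.

Lemma sw_antil V (G : H -> V) h : linear G ->
  (Σ[a, b <- Δ h] G (S a * b)) = (ε h : K) *: G 1.
Proof.
by move=> lG; rewrite -(tlift_out (fun a b => S a * b)) // -(linZ _ _ lG) -antipode_l.
Qed.

Lemma sw_antir V (G : H -> V) h : linear G ->
  (Σ[a, b <- Δ h] G (a * S b)) = (ε h : K) *: G 1.
Proof.
by move=> lG; rewrite -(tlift_out (fun a b => a * S b)) // -(linZ _ _ lG) -antipode_r.
Qed.

Lemma sw_mul V (F : H -> H -> V) x y : bilin F ->
  tlift F (Δ (x * y)) = Σ[a, b <- Δ x] Σ[c, d <- Δ y] F (a * c) (b * d).
Proof. by move=> bF; rewrite coprodM tlift_mulE. Qed.

Lemma sw_one V (F : H -> H -> V) : bilin F -> tlift F (Δ 1) = F 1 1.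
Proof. by move=> bF; rewrite coprod1 tlift_oneE. Qed.

(** Associativity of convolution makes a left and a right inverse of the same
    map coincide.  Properties of the coproduct of S h follow, as both sides
    invert the coproduct. *)
Lemma conv_inv_uniq (A : falgType K) (f g k : H -> A) :
  linear f -> linear g -> linear k ->
  (forall h, (Σ[a, b <- Δ h] f a * g b) = (ε h : K) *: 1) ->
  (forall h, (Σ[a, b <- Δ h] g a * k b) = (ε h : K) *: 1) ->
  f =1 k.
Proof.
move=> lf lg lk fg gk h.
have -> : f h = Σ[a, t <- Δ h] Σ[b, c <- Δ t] f a * (g b * k c).
  under eq_tlift => a t do rewrite -mul_tlift gk -scalerAr mulr1.
  by rewrite sw_counitr.
rewrite -sw_assoc //.
under eq_tlift => t c.
  under eq_tlift => a b do rewrite mulrA.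
  rewrite -tlift_mul fg -scalerAl mul1r.
  over.
by rewrite sw_counitl.
Qed.

Lemma anti1 : S (1 : H) = 1.
Proof.
have := sw_antil (G := id) 1; rewrite sw_one // mulr1 coun1 scale1r => -> //.
Qed.

Lemma coun_anti h : ε (S h) = ε h.
Proof.
transitivity (Σ[a, b <- Δ h] ε (S a * b)).
  rewrite -(sw_counitr (G := fun x => ε (S x))) //.
  by apply: eq_tlift => a b; rewrite counM [RHS]mulrC.
by rewrite (sw_antil (G := fun x => ε x)) // coun1 /GRing.scale /= mulr1.
Qed.

(** Both sides invert the product map for convolution on H ⊗ H; the proof
    inserts the missing factors x_2 y_2 S(y_3) S(x_3) and contracts them the
    other way round. *)
Lemma antiM x y : S (x * y) = S y * S x.
Proof.
transitivity (Σ[x1, s <- Δ x] Σ[x2, x3 <- Δ s] Σ[y1, t <- Δ y] Σ[y2, y3 <- Δ t]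
    S (x1 * y1) * (x2 * y2 * (S y3 * S x3))).
  under eq_tlift => x1 s.
    under eq_tlift => x2 x3.
      under eq_tlift => y1 t.
        under eq_tlift => y2 y3 do rewrite (mulrA (x2 * y2)) -(mulrA x2).
        rewrite (sw_antir (G := fun z => S (x1 * y1) * (x2 * z * S x3))) //.
        rewrite mulr1; over.
      rewrite (sw_counitr (G := fun z => S (x1 * z) * (x2 * S x3))) //.
      over.
    rewrite (sw_antir (G := fun z => S (x1 * y) * z)) // mulr1.
    over.
  by rewrite (sw_counitr (G := fun z => S (z * y))).
rewrite -sw_assoc //; under eq_tlift => s x3.
  under eq_tlift => x1 x2 do rewrite -sw_assoc //.
  rewrite tlift_exchange /=.
  under eq_tlift => t y3.
    under eq_tlift => x1 x2.
      under eq_tlift => y1 y2 do rewrite mulrA.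
      over.
    rewrite -(sw_mul (F := fun a b => S a * b * (S y3 * S x3))) //.
    rewrite (sw_antil (G := fun z => z * (S y3 * S x3))) //.
    rewrite counM mul1r -scalerA; over.
  rewrite -scale_tlift (sw_counitl (G := fun z => S z * S x3)) //; over.
by rewrite (sw_counitl (G := fun z => S y * S z)).
Qed.

Lemma sw_anti V (F : H -> H -> V) h : bilin F ->
  tlift F (Δ (S h)) = Σ[a, b <- Δ h] F (S b) (S a).
Proof.
move=> bF.
have E : Δ (S h) = Σ[a, b <- Δ h] S b ⊗ S a.
  apply: (conv_inv_uniq (f := fun h => Δ (S h)) (g := Δ)
            (k := fun h => Σ[a, b <- Δ h] S b ⊗ S a)) h => // h.
    under eq_tlift => a b do rewrite -coprodM.
    by rewrite (sw_antil (G := fun x => Δ x)) // coprod1.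
  under eq_tlift => a b.
    rewrite [Δ a]tens_tlift mul_tlift.
    under eq_tlift => c d.
      rewrite tlift_mul.
      under eq_tlift => x y do rewrite -[_ * _]/(tmul _ _) tmulE.
      over.
    rewrite tlift_exchange; over.
  rewrite sw_assoc; last by lin.
  under eq_tlift => x t.
    rewrite -sw_assoc; last by lin.
    under eq_tlift => u d do
      rewrite (sw_antir (G := fun z => (x * S d) ⊗ z)) //.
    rewrite (sw_counitl (G := fun z => (x * S z) ⊗ 1)) //; over.
  by rewrite (sw_antir (G := fun z => z ⊗ 1)).
by rewrite E tlift_tlift; apply: eq_tlift => a b; rewrite tlift_tens.
Qed.

End HopfCalculus.

(** * Traces of linear operators *)

Section Trace.
Variable K : fieldType.
Implicit Types U V W : vectType K.

(** The trace of an arbitrary function, read off on a basis, so that operators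
    can be given by Sweedler expressions without packaging their linearity. *)
Definition tr V (f : V -> V) : K := \sum_i v2r (f (tbase i)) 0 i.

Lemma v2rS V (I : Type) (r : seq I) (P : pred I) (F : I -> V) j :
  v2r (\sum_(i <- r | P i) F i) 0 j = \sum_(i <- r | P i) v2r (F i) 0 j.
Proof. by rewrite linear_sum summxE. Qed.

Lemma v2rZ V c (x : V) j : v2r (c *: x) 0 j = c * v2r x 0 j.
Proof. by rewrite linearZ mxE. Qed.

Lemma eq_tr V (f g : V -> V) : f =1 g -> tr f = tr g.
Proof. by move=> fg; apply: eq_bigr => i _; rewrite fg. Qed.

Lemma trD V (f g : V -> V) : tr (fun x => f x + g x) = tr f + tr g.
Proof.
by rewrite -big_split; apply: eq_bigr => i _; rewrite linearD mxE.
Qed.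

Lemma trZ V c (f : V -> V) : tr (fun x => c *: f x) = c * tr f.
Proof. by rewrite mulr_sumr; apply: eq_bigr => i _; rewrite linearZ mxE. Qed.

Lemma tr_sum V (I : Type) (r : seq I) (P : pred I) (F : I -> V -> V) :
  tr (fun x => \sum_(i <- r | P i) F i x) = \sum_(i <- r | P i) tr (F i).
Proof.
rewrite exchange_big; apply: eq_bigr => i _.
by rewrite linear_sum summxE.
Qed.

Lemma tr_tlift V U W (F : U -> W -> V -> V) t :
  tr (fun x => Σ[a, b <- t] F a b x) = Σ[a, b <- t] (tr (F a b) : K^o).
Proof.
rewrite /tlift tr_sum; apply: eq_bigr => i _.
by rewrite tr_sum; apply: eq_bigr => j _; rewrite trZ.
Qed.

Lemma lin_tr V W (F : W -> V -> V) :
  (forall x, linear (fun w => F w x)) -> linear (fun w => tr (F w) : K^o).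
Proof.
move=> lF a u v; rewrite /tr scaler_sumr -big_split; apply: eq_bigr => i _ /=.
by rewrite lF linearP mxE [X in X + _]mxE.
Qed.

Lemma trC V W (f : V -> W) (g : W -> V) : linear f -> linear g ->
  tr (fun x => g (f x)) = tr (fun y => f (g y)).
Proof.
move=> lf lg.
transitivity (\sum_i \sum_j v2r (f (tbase i)) 0 j * v2r (g (tbase j)) 0 i).
  apply: eq_bigr => i _; rewrite {1}[f _]tbaseE linS // linear_sum summxE.
  by apply: eq_bigr => j _; rewrite linZ // linearZ mxE.
rewrite exchange_big; apply: eq_bigr => j _ /=.
rewrite [g (tbase j) in RHS]tbaseE linS // linear_sum summxE.
by apply: eq_bigr => i _; rewrite linZ // linearZ mxE mulrC.
Qed.

Lemma tr_rank1 V (p : V -> K^o) v : linear p ->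
  tr (fun x => (p x : K) *: v) = p v.
Proof.
move=> lp; rewrite {2}[v]tbaseE linS //; apply: eq_bigr => i _.
by rewrite linearZ mxE linZ // mulrC.
Qed.

Lemma tr_res V (I : Type) (r : seq I) (P : pred I) (p : I -> V -> K^o)
    (v : I -> V) (f : V -> V) :
  linear f -> (forall i, linear (p i)) ->
  (forall x, x = \sum_(i <- r | P i) (p i x : K) *: v i) ->
  tr f = \sum_(i <- r | P i) (p i (f (v i)) : K).
Proof.
move=> lf lp res.
rewrite -(eq_bigr _ (fun i _ => tr_rank1 (f (v i)) (lp i))) -tr_sum.
apply: eq_tr => x; rewrite {1}[x]res linS //.
by apply: eq_bigr => i _; rewrite linZ.
Qed.

Lemma tr_id V : tr (fun x : V => x) = (\dim {:V})%:R.
Proof.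
rewrite dimvf /tr.
transitivity (\sum_(i < dim V) (1 : K)); last by rewrite sumr_const card_ord.
by apply: eq_bigr => i _; rewrite /tbase r2vK mxE !eqxx.
Qed.

(** An idempotent is the identity on its image; in coordinates of the image
    its trace counts a basis. *)
Lemma tr_idem V (f : V -> V) : linear f -> (forall x, f (f x) = f x) ->
  tr f = (\dim (limg (linfun f)))%:R.
Proof.
move=> lf ff; set W := limg _; pose X := vbasis W.
have fX x : f x = \sum_i coord X i (f x) *: X`_i.
  by apply: coord_vbasis; rewrite -(lfunE_lin lf) memv_img ?memvf.
rewrite (eq_tr fX) tr_sum -[in RHS](card_ord (\dim W)) -sumr_const.
apply: eq_bigr => i _.
rewrite (tr_rank1 _ (p := fun x => coord X i (f x))); last first.
  by move=> a u v; rewrite lf linearP.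
have /memv_imgP[y _ Ey] : X`_i \in W by rewrite vbasis_mem // mem_nth ?size_tuple.
have -> : f X`_i = X`_i by rewrite Ey !(lfunE_lin lf) ff.
by rewrite coord_free ?eqxx //; case/andP: (vbasisP W).
Qed.

Lemma tr_tens V W (F : V ⊗ W -> V ⊗ W) : linear F ->
  tr F = \sum_i \sum_j (F (tbase i ⊗ tbase j) : 'M_(_, _)) i j.
Proof.
move=> lF.
have coordM i j : linear (fun t : V ⊗ W => ((t : 'M[K]_(_, _)) i j : K^o)).
  by move=> a u v; rewrite !mxE.
rewrite pair_bigA (tr_res (r := index_enum _) (P := xpredT)
    (p := fun ij (t : V ⊗ W) => ((t : 'M[K]_(_, _)) ij.1 ij.2 : K^o))
    (v := fun ij => tbase ij.1 ⊗ tbase ij.2)) //.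
by move=> t; rewrite {1}[t]tens_sum pair_bigA.
Qed.

Lemma tr_tmap V W (f : V -> V) (g : W -> W) : linear f -> linear g ->
  tr (tmap f g) = tr f * tr g.
Proof.
move=> lf lg; rewrite tr_tens; last first.
  by rewrite /tmap.
rewrite mulr_suml; apply: eq_bigr => i _.
rewrite mulr_sumr; apply: eq_bigr => j _.
by rewrite /tmap tlift_tens // tensE.
Qed.

End Trace.

(** * Integrals *)

Section TraceLoop.
Variable K : fieldType.

(** Cyclicity of the trace with a side output: a loop that first splits off a
    component along delta and then applies T may be cut open between them.
    Slicing delta along a basis of W reduces this to trC. *)
Lemma tr_loop (V W U : vectType K) (delta : V -> V ⊗ W) (T : V -> V ⊗ U)
    (p : W -> U -> K^o) :
  linear delta -> linear T -> bilin p ->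
  tr (fun x => Σ[x1, x2 <- delta x] Σ[z1, z2 <- T x1] (p x2 z2 : K) *: z1)
  = tr (fun w => Σ[z1, z2 <- T w] Σ[a, b <- delta z1] (p b z2 : K) *: a).
Proof.
move=> ld lT bp.
pose l i (z : V) := Σ[a, b <- delta z] (v2r b 0 i *: a).
have ll i : linear (l i) by rewrite /l; lin.
have slice (X : vectType K) (G : V -> W -> X) z : bilin G ->
    tlift G (delta z) = \sum_i G (l i z) (tbase i).
  move=> bG; under [RHS]eq_bigr => i _ do
    rewrite /l (tlift_out (g := fun y => G y (tbase i))) //.
  rewrite -tlift_sum; apply: eq_tlift => a b.
  rewrite {1}[b]tbaseE linS; last by lin.
  apply: eq_bigr => i _; rewrite linZ; last by lin.
  by rewrite (linZ (f := fun y => G y (tbase i))).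
under eq_tr => x do rewrite slice //.
rewrite tr_sum.
transitivity (\sum_i tr (fun w => l i (Σ[z1, z2 <- T w] (p (tbase i) z2 : K) *: z1))).
  apply: eq_bigr => i _.
  by rewrite (trC (f := l i) (g := fun y => Σ[z1, z2 <- T y] (p (tbase i) z2 : K) *: z1)).
rewrite -tr_sum; apply: eq_tr => w.
under eq_bigr => i _ do rewrite tlift_out //.
rewrite -tlift_sum; apply: eq_tlift => z1 z2.
rewrite (slice _ (fun a b => (p b z2 : K) *: a)) //.
by apply: eq_bigr => i _; rewrite linZ.
Qed.

(** In coordinates the hypothesis is a one-sided inverse of the matrix of beta,
    and one-sided inverses of square matrices are two-sided. *)
Lemma dual_tensor_sym (V : vectType K) (beta : V -> V -> K^o) (t : V ⊗ V) :
  bilin beta -> (forall x, (Σ[a, b <- t] (beta x a : K) *: b) = x) ->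
  forall y, (Σ[a, b <- t] (beta b y : K) *: a) = y.
Proof.
move=> bb res y.
pose B : 'M[K]_(dim V) := \matrix_(i, j) beta (tbase i) (tbase j).
have ebase i j : v2r (tbase i : V) 0 j = (j == i)%:R.
  by rewrite /tbase r2vK mxE eqxx.
have BT : B *m (t : 'M_(_, _)) = 1%:M.
  apply/matrixP => i j; rewrite [RHS]mxE eq_sym -ebase -{1}(res (tbase i)).
  rewrite /tlift v2rS mxE; apply: eq_bigr => a _; rewrite mxE.
  rewrite [RHS]v2rS (bigD1 j) //= big1 => [|b nbj].
    by rewrite !v2rZ ebase eqxx mulr1 addr0 mulrC.
  by rewrite !v2rZ ebase eq_sym (negPf nbj) !mulr0.
have TB := mulmx1C BT.
apply: v2r_inj; apply/rowP => i.
have E a : v2r (\sum_b (t : 'M_(_, _)) a b *: ((beta (tbase b) y : K) *: tbase a)) 0 i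
    = (i == a)%:R * \sum_b (t : 'M_(_, _)) a b * (beta (tbase b) y : K).
  rewrite [LHS]v2rS mulr_sumr; apply: eq_bigr => b _.
  by rewrite !v2rZ ebase mulrA mulrC.
rewrite /tlift [LHS]v2rS (eq_bigr _ (fun a _ => E a)) (bigD1 i) //= eqxx mul1r.
rewrite [X in _ + X]big1 ?addr0 => [|a]; last by rewrite eq_sym => /negPf->; rewrite mul0r.
have yE b : beta (tbase b) y = \sum_k (v2r y 0 k * B b k : K).
  rewrite {1}[y]tbaseE (linS _ _ _ (bilinr _ bb)); apply: eq_bigr => k _.
  by rewrite (linZ _ _ (bilinr _ bb)) mxE.
under eq_bigr => b _ do rewrite yE mulr_sumr.
rewrite exchange_big /=.
have TBE k : \sum_b (t : 'M_(_, _)) i b * (v2r y 0 k * B b k)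
    = v2r y 0 k * (i == k)%:R.
  have := congr1 (fun M : 'M_(_, _) => M i k) TB; rewrite [RHS]mxE => <-.
  by rewrite mxE mulr_sumr; apply: eq_bigr => b _; rewrite mulrCA.
rewrite (eq_bigr _ (fun k _ => TBE k)) (bigD1 i) //= eqxx mulr1.
by rewrite big1 ?addr0 // => k; rewrite eq_sym => /negPf->; rewrite mulr0.
Qed.

End TraceLoop.

Section Integral.
Variables (K : fieldType) (H : hopfType K) (L : H).
Hypothesis hL : idempotent_integral L.
Implicit Types (x y h : H) (V : vectType K).

Lemma intL h : h * L = (ε h : K) *: L.
Proof. by have [lL _ _ _] := hL; apply: lL. Qed.

Lemma intR h : L * h = (ε h : K) *: L.
Proof. by have [_ rL _ _] := hL; apply: rL. Qed.

Lemma coun_int : ε L = 1.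
Proof.
have [_ _ nzL LL] := hL.
have E : ((1 : K) - (ε L : K)) *: L = 0.
  by rewrite scalerBl scale1r -intL LL subrr.
apply/eqP; move/eqP: E; rewrite scaler_eq0 (negPf nzL) orbF subr_eq0.
by rewrite eq_sym.
Qed.

(** Expand h as Σ S(h_1) h_2 ⊗ h_3 in front of the coproduct of L, and absorb
    h_2 ⊗ h_3 into L. *)
Lemma sw_int_shift V (F : H -> H -> V) h : bilin F ->
  (Σ[a, b <- Δ L] F a (h * b)) = Σ[a, b <- Δ L] F (S h * a) b.
Proof.
move=> bF; symmetry.
transitivity (Σ[h1, t <- Δ h] Σ[h2, h3 <- Δ t] Σ[a, b <- Δ L]
    F (S h1 * (h2 * a)) (h3 * b)).
  under [RHS]eq_tlift => h1 t.
    rewrite -(sw_mul (F := fun a b => F (S h1 * a) b)) // intL.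
    rewrite (linZ (f := fun x => Σ[a, b <- Δ x] F (S h1 * a) b)) //; over.
  by rewrite (sw_counitr (G := fun h1 => Σ[a, b <- Δ L] F (S h1 * a) b)).
rewrite -sw_assoc //; under eq_tlift => t h3.
  under eq_tlift => h1 h2.
    under eq_tlift => a b do rewrite mulrA.
    over.
  rewrite (sw_antil (G := fun z => Σ[a, b <- Δ L] F (z * a) (h3 * b))) //.
  under [X in _ *: X]eq_tlift => a b do rewrite mul1r.
  over.
by rewrite (sw_counitl (G := fun z => Σ[a, b <- Δ L] F a (z * b))).
Qed.

Lemma sw_int_shiftr V (F : H -> H -> V) h : bilin F ->
  (Σ[a, b <- Δ L] F (a * h) b) = Σ[a, b <- Δ L] F a (b * S h).
Proof.
move=> bF; symmetry.
transitivity (Σ[t, h3 <- Δ h] Σ[h1, h2 <- Δ t] Σ[a, b <- Δ L]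
    F (a * h1) (b * h2 * S h3)).
  under [RHS]eq_tlift => t h3.
    rewrite tlift_exchange -(sw_mul (F := fun a b => F a (b * S h3))) // intR.
    rewrite (linZ (f := fun x => Σ[a, b <- Δ x] F a (b * S h3))) //; over.
  by rewrite (sw_counitl (G := fun h1 => Σ[a, b <- Δ L] F a (b * S h1))).
rewrite sw_assoc //; under eq_tlift => h1 t.
  under eq_tlift => h2 h3.
    under eq_tlift => a b do rewrite -mulrA.
    over.
  rewrite (sw_antir (G := fun z => Σ[a, b <- Δ L] F (a * h1) (b * z))) //.
  under [X in _ *: X]eq_tlift => a b do rewrite mulr1.
  over.
by rewrite (sw_counitr (G := fun z => Σ[a, b <- Δ L] F (a * z) b)).
Qed.

(** The trace formula for an integral of the dual algebra (lam_int), with the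
    normalization lam_L. *)
Definition lam : 'Hom(H, (K^o)%type) :=
  linfun (fun h => (tr (fun x => S (S x) * h) : K^o)).

Lemma lamE h : lam h = tr (fun x => S (S x) * h).
Proof. by rewrite lfunE_lin //; apply: lin_tr => x. Qed.

Lemma dual_ext (V : vectType K) (x y : V) :
  (forall q : 'Hom(V, (K^o)%type), q x = q y) -> x = y.
Proof.
move=> qE; apply: v2r_inj; apply/rowP => i.
have l : linear (fun z : V => (v2r z 0 i : K^o)).
  by move=> a u v; rewrite linearP !mxE.
by have := qE (linfun (fun z : V => (v2r z 0 i : K^o))); rewrite !lfunE_lin.
Qed.

(** Tested against q, the left side is a trace of x ↦ S^2(x) h_1 weighted by
    q(h_2).  Inserting S(x_2) S^2(x_3) exhibits it as a loop that splits x and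
    then multiplies by h; opened at the other end, the antipode cancels the
    second component and q(1) remains. *)
Lemma lam_int h : (Σ[a, b <- Δ h] (lam a : K) *: b) = (lam h : K) *: 1.
Proof.
apply: dual_ext => q; rewrite lfun_tlift linearZ /=.
transitivity (tr (fun x => Σ[a, b <- Δ h] (q b : K) *: (S (S x) * a)) : K^o).
  rewrite tr_tlift; apply: eq_tlift => a b.
  by rewrite linearZ /= lamE trZ [LHS]mulrC.
have split_loop x : (Σ[a, b <- Δ h] (q b : K) *: (S (S x) * a))
    = Σ[x1, x2 <- Δ x] Σ[z1, z2 <- Δ (S (S x1) * h)] (q (S x2 * z2) : K) *: z1.
  symmetry; under eq_tlift => x1 x2.
    rewrite (sw_mul (F := fun z1 z2 => (q (S x2 * z2) : K) *: z1)) //.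
    rewrite !sw_anti //; over.
  rewrite sw_assoc //; under eq_tlift => x1 t.
    under eq_tlift => x2 x3.
      under eq_tlift => a b do rewrite mulrA -antiM.
      over.
    rewrite (sw_antil
      (G := fun z => Σ[a, b <- Δ h] (q (S z * b) : K) *: (S (S x1) * a))) //.
    under [X in _ *: X]eq_tlift => a b do rewrite anti1 mul1r.
    over.
  by rewrite (sw_counitr
       (G := fun z => Σ[a, b <- Δ h] (q b : K) *: (S (S z) * a))).
rewrite (eq_tr split_loop) (tr_loop (delta := Δ) (T := fun w => Δ (S (S w) * h))
  (p := fun a b => q (S a * b))) //.
transitivity (tr (fun x => (q 1 : K) *: (S (S x) * h)) : K^o); last first.
  by rewrite trZ lamE [LHS]mulrC.
congr (_ : K^o); apply: eq_tr => x; rewrite sw_assoc //.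
under eq_tlift => a t do
  rewrite (sw_antil (G := fun z => (q z : K) *: a)) //.
by rewrite (sw_counitr (G := fun a => (q 1 : K) *: a)).
Qed.

Lemma lam_L : lam L = 1.
Proof.
rewrite lamE -[RHS]coun_int -(tr_rank1 L (p := ε)) //.
by apply: eq_tr => x; rewrite intL !coun_anti.
Qed.

(** L and lam are dual to each other: the components of the coproduct of L
    recover every element of H. *)
Lemma lam_recl x : (Σ[a, b <- Δ L] (lam (S x * a) : K) *: b) = x.
Proof.
rewrite -(sw_int_shift x (F := fun a b => (lam a : K) *: b)) //.
under eq_tlift => a b do rewrite scalerAr.
by rewrite -mul_tlift lam_int lam_L scale1r mulr1.
Qed.

Lemma lam_recr x : (Σ[a, b <- Δ L] (lam (a * x) : K) *: b) = S x.
Proof.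
rewrite (sw_int_shiftr x (F := fun a b => (lam a : K) *: b)) //.
under eq_tlift => a b do rewrite scalerAl.
by rewrite -tlift_mul lam_int lam_L scale1r mul1r.
Qed.

(** Each x can be computed from S x by lam_recl. *)
Lemma anti_inj : injective (S : H -> H).
Proof.
move=> x y e; rewrite -(lam_recl x) -(lam_recl y).
by apply: eq_tlift => a b; rewrite e.
Qed.

Definition Sinv : 'End(H) := (anti^-1)%VF.

Lemma antiK : cancel S Sinv.
Proof. by apply: lker0_lfunK; apply/lker0P; apply: anti_inj. Qed.

Lemma SinvK : cancel Sinv S.
Proof. by apply: lker0_lfunVK; apply/lker0P; apply: anti_inj. Qed.

Lemma lam_recl' y : (Σ[a, b <- Δ L] (lam (S b * y) : K) *: a) = y.
Proof.
by apply: (dual_tensor_sym (beta := fun x y => lam (S x * y))) => //; apply: lam_recl.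
Qed.

Lemma lam_nondeg w : (forall y, lam (w * y) = 0) -> w = 0.
Proof.
move=> w0; apply: (can_inj SinvK); rewrite linear0 -[LHS]lam_recl SinvK.
by apply: tlift0 => a b; rewrite w0 scale0r.
Qed.

(** The components of the comultiplication of an integral span H, in either
    tensor factor, so a functional killing the first one vanishes. *)
Lemma int_sep (phi : 'Hom(H, (K^o)%type)) :
  (Σ[a, b <- Δ L] (phi a : K) *: b) = 0 -> phi = 0.
Proof.
move=> p0; apply/lfunP => y; rewrite zero_lfunE -[y]lam_recl' lfun_tlift.
transitivity (lam (S (Σ[a, b <- Δ L] (phi a : K) *: b) * y)).
  rewrite lfun_tlift tlift_mul lfun_tlift; apply: eq_tlift => a b.
  by rewrite !linearZ /= -scalerAl linearZ [LHS]mulrC.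
by rewrite p0 linear0 mul0r linear0.
Qed.

(** Both sides, as functionals of y, have the same sum against the coproduct of
    L, by lam_recl for S x and lam_recr; then int_sep applies. *)
Lemma lam_twist x y : lam (y * x) = lam (S (S x) * y).
Proof.
pose phi := linfun (fun y => lam (S (S x) * y) - lam (y * x)).
have phiE z : phi z = lam (S (S x) * z) - lam (z * x) by rewrite /phi lfunE_lin.
have : phi = 0.
  apply: int_sep; under eq_tlift => a b do rewrite phiE scalerBl.
  by rewrite tliftB lam_recl lam_recr subrr.
by move/lfunP/(_ y); rewrite phiE zero_lfunE => /eqP; rewrite subr_eq0 => /eqP ->.
Qed.

Lemma rint_uniq (mu : 'Hom(H, (K^o)%type)) :
  (forall h, (Σ[a, b <- Δ h] (mu a : K) *: b) = (mu h : K) *: 1) ->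
  forall h, mu h = (mu L : K) * (lam h : K).
Proof.
move=> muI h; pose phi := mu - (mu L : K) *: lam.
have : phi = 0.
  apply: int_sep; under eq_tlift => a b do
    rewrite add_lfunE opp_lfunE scale_lfunE scalerBl -scalerA.
  by rewrite tliftB muI -scale_tlift lam_int lam_L scale1r subrr.
move/lfunP/(_ h); rewrite add_lfunE opp_lfunE scale_lfunE zero_lfunE.
by move/eqP; rewrite subr_eq0 => /eqP.
Qed.

(** The distinguished grouplike element, which measures the failure of lam to
    be an integral on the other side. *)
Definition modg : H := Σ[a, b <- Δ L] (lam b : K) *: a.

(** Composing the left side with a functional p gives another integral of the
    dual algebra, so it is proportional to lam; L fixes the ratio. *)
Lemma lam_mod h : (Σ[a, b <- Δ h] (lam b : K) *: a) = (lam h : K) *: modg.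
Proof.
apply: dual_ext => p; rewrite lfun_tlift linearZ /=.
pose mu := linfun (fun h => Σ[a, b <- Δ h] p ((lam b : K) *: a)).
have muE z : mu z = Σ[a, b <- Δ z] p ((lam b : K) *: a) by rewrite /mu lfunE_lin.
rewrite -muE (rint_uniq (mu := mu)) => [|z].
  by rewrite muE /modg lfun_tlift [LHS]mulrC.
rewrite (eq_tlift (G := fun x b => Σ[c, d <- Δ x] (p ((lam d : K) *: c) : K) *: b)); last first.
  by move=> a b; rewrite muE tlift_scale.
rewrite sw_assoc //; under eq_tlift => a t.
  under eq_tlift => b c do rewrite linearZ /= -scalerA scalerA mulrC -scalerA.
  rewrite -scale_tlift lam_int; over.
rewrite muE tlift_scale; apply: eq_tlift => a b.
by rewrite scalerA linearZ; congr (_ *: _); apply: mulrC.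
Qed.

Lemma mod_grouplike : Δ modg = modg ⊗ modg.
Proof.
rewrite {1}/modg lfun_tlift.
transitivity (Σ[a, t <- Δ L] Σ[b, c <- Δ t] ((lam c : K) *: (a ⊗ b))).
  rewrite -sw_assoc //; apply: eq_tlift => a b.
  by rewrite linearZ /= {1}[Δ a]tens_tlift scale_tlift.
under eq_tlift => a t.
  rewrite (eq_tlift (G := fun b c => a ⊗ ((lam c : K) *: b))); last first.
    by move=> b c; rewrite (linZ (f := fun z => a ⊗ z)).
  rewrite -(tlift_out (fun b c => (lam c : K) *: b) (g := fun z => a ⊗ z)) //.
  rewrite lam_mod (linZ (f := fun z => a ⊗ z)) //; over.
rewrite {1}/modg (tlift_out (g := fun z => z ⊗ modg)) //.
by apply: eq_tlift => a b; rewrite (linZ (f := fun z => z ⊗ modg)).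
Qed.

(** The sum Σ lam(L_2 S(a)) L_1 is g a by sw_int_shiftr.  After lam_twist the
    factor stands on the left of L_2, and sw_int_shift gives S^4(a) g. *)
Lemma anti4 a : S (S (S (S a))) * modg = modg * a.
Proof.
transitivity (Σ[x, b <- Δ L] (lam (b * S a) : K) *: x); last first.
  rewrite -(sw_int_shiftr a (F := fun x b => (lam b : K) *: x)) //.
  by rewrite tlift_mul; apply: eq_tlift => x b; rewrite scalerAl.
under eq_tlift => x b do rewrite lam_twist.
rewrite (sw_int_shift _ (F := fun x b => (lam b : K) *: x)) //.
by rewrite mul_tlift; apply: eq_tlift => x b; rewrite scalerAr.
Qed.

End Integral.

(** * Grouplike elements, R-matrices and the Drinfeld element *)

Section Grouplike.
Variables (K : fieldType) (H : hopfType K) (g : H).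
Hypotheses (gg : Δ g = g ⊗ g) (eg : ε g = 1).

Lemma grouplike_exp n : Δ (g ^+ n) = g ^+ n ⊗ g ^+ n.
Proof.
elim: n => [|n IHn]; first by rewrite !expr0 coprod1.
by rewrite !exprS coprodM IHn gg -[LHS]/(tmul _ _) tmulE.
Qed.

Lemma grouplike_unit : g \is a GRing.unit.
Proof.
apply/unitrP; exists (S g); split.
  have := sw_antil (G := fun x : H => x) g (@lin_id _ _).
  by rewrite gg tlift_tens // eg scale1r.
have := sw_antir (G := fun x : H => x) g (@lin_id _ _).
by rewrite gg tlift_tens // eg scale1r.
Qed.

Fixpoint powers m : seq H := if m is m'.+1 then g ^+ m' :: powers m' else [::].

Lemma size_powers m : size (powers m) = m.
Proof. by elim: m => //= m ->. Qed.

Lemma nth_powers m i : (i < m)%N -> (powers m)`_i = g ^+ (m - i.+1).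
Proof.
by elim: m i => [|m IHm] [|i] //= im; rewrite ?subn1 // IHm.
Qed.

(** Grouplike elements are linearly independent unless they coincide, so in
    finite dimension the first linear relation between powers of g is an
    equality of two of them. *)
Lemma grouplike_order : exists2 N, (0 < N)%N & g ^+ N = 1.
Proof.
have gU := grouplike_unit.
have exm : exists m, ~~ free (powers m).
  exists (\dim {:H}).+1; apply/negP => fr.
  have := dimvS (subvf <<powers (\dim {:H}).+1>>%VS).
  by rewrite (eqP fr) size_powers ltnn.
have [[|m]] := ex_minnP exm; first by rewrite nil_free.
move=> /= nfr minm.
have frm : free (powers m).
  by apply/negPn/negP => /minm; rewrite ltnn.
move: nfr; rewrite free_cons frm andbT negbK => gm.
pose X := in_tuple (powers m).
pose c i := coord X i (g ^+ m).
have gmE : g ^+ m = \sum_i c i *: X`_i by apply: coord_span.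
have sX : size (powers m) = m by apply: size_powers.
have im (i : 'I_(size (powers m))) : (i < m)%N by rewrite -[X in (_ < X)%N]sX.
have DX (i : 'I_(size (powers m))) : Δ X`_i = X`_i ⊗ X`_i.
  by rewrite nth_powers ?im // grouplike_exp.
have cc i j : c i * c j = (i == j)%:R * c i.
  have F : bilin (fun a b : H => (coord X i a * coord X j b : K^o)).
    have lc k : linear (fun a : H => (coord X k a : K^o)).
      by move=> a u v; rewrite linearP.
    by split=> y; [apply: lin_mulKl | apply: lin_mulKr].
  have := congr1 (tlift (fun a b => (coord X i a * coord X j b : K^o)))
    (grouplike_exp m).
  rewrite tlift_tens // => <-; rewrite gmE linear_sum linear_sum /=.
  rewrite (bigD1 i) //= big1 => [|k nki].
    by rewrite addr0 !linearZ /= DX tlift_tens // !coord_free // eqxx mul1r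
      [RHS]mulrC.
  rewrite !linearZ /= DX tlift_tens // !coord_free //.
  by rewrite (negPf nki) mul0r scaler0.
have [i ci] : exists i, c i != 0.
  apply/existsP; rewrite -negb_forall; apply/negP => /forallP c0.
  have /eqP := unitrX m gU; rewrite gmE big1 ?unitr0 // => i _.
  by have /eqP-> := c0 i; rewrite scale0r.
have ci1 : c i = 1.
  by apply: (mulfI ci); rewrite cc eqxx mul1r mulr1.
have cj j : j != i -> c j = 0.
  by move=> nji; apply: (mulfI ci); rewrite cc eq_sym (negPf nji) mul0r mulr0.
have E : g ^+ m = g ^+ (m - i.+1).
  rewrite {1}gmE (bigD1 i) //= big1 => [|j /cj->]; last by rewrite scale0r.
  by rewrite ci1 scale1r addr0 nth_powers ?im.
exists i.+1 => //; apply: (mulIr (unitrX (m - i.+1) gU)).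
by rewrite mul1r -exprD subnKC ?im.
Qed.

End Grouplike.

Section Drinfeld.
Variables (K : fieldType) (A : falgType K).

(** Left multiplication by y is injective, hence bijective in finite
    dimension. *)
Lemma falg_unit_r (x y : A) : x * y = 1 -> x \is a GRing.unit.
Proof.
move=> xy.
have l : linear (fun z => y * z) by lin.
have k0 : lker (linfun (fun z => y * z)) == 0%VS.
  apply/lker0P => z1 z2; rewrite !lfunE_lin // => /(congr1 (fun z => x * z)).
  by rewrite !mulrA xy !mul1r.
pose z := ((linfun (fun z => y * z))^-1)%VF 1.
have yz : y * z = 1 by rewrite -[LHS](lfunE_lin l) lker0_lfunVK.
have e : x = z by rewrite -[x]mulr1 -yz mulrA xy mul1r.
by apply/unitrP; exists y; rewrite {1}e.
Qed.

End Drinfeld.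

Section Rmatrix.
Variables (K : fieldType) (H : hopfType K) (r : H ⊗ H).
Hypothesis hr : universal_R_matrix r.
Implicit Types (x y h : H) (V : vectType K).

Lemma sw_R_comm V (F : H -> H -> V) h : bilin F ->
  (Σ[a, b <- r] Σ[x, y <- Δ h] F (a * x) (b * y))
  = Σ[a, b <- r] Σ[x, y <- Δ h] F (y * a) (x * b).
Proof.
move=> bF; have [ru rD _ _] := hr.
have E : tswap (Δ h) * r = r * Δ h.
  by have := rD h; rewrite -[comul h]/(Δ h) => ->; rewrite mulrVK.
have := congr1 (tlift F) E; rewrite !tlift_mulE // => <-.
rewrite tlift_tswap; last by lin.
by rewrite tlift_exchange.
Qed.

Lemma sw_R_l V (F : H -> H -> H -> V) : trilin F ->
  (Σ[a, b <- r] Σ[x, y <- Δ a] F x y b)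
  = Σ[a, b <- r] Σ[c, d <- r] F a c (b * d).
Proof.
move=> tF; have [_ _ rl _] := hr.
pose G (t : H ⊗ H) (c : H) := Σ[a, b <- t] F a b c.
have bG : bilin G by rewrite /G; lin.
have := congr1 (tlift G) (rl : tmap Δ id r = _).
rewrite tlift_tmap // => ->; rewrite tlift_mulE //.
rewrite /leg13 tlift_tlift; apply: eq_tlift => a b.
rewrite tlift_tens; last by lin.
rewrite /leg23 tlift_tlift; apply: eq_tlift => c d.
rewrite tlift_tens; last by lin.
by rewrite -[_ * _]/(tmul _ _) tmulE /G tlift_tens // mulr1 mul1r.
Qed.

Lemma sw_R_r V (F : H -> H -> H -> V) : trilin F ->
  (Σ[a, b <- r] Σ[x, y <- Δ b] F a x y)
  = Σ[a, b <- r] Σ[c, d <- r] F (a * c) d b.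
Proof.
move=> tF; have [_ _ _ rr] := hr.
pose G (t : H ⊗ H) (c : H) := Σ[a, b <- t] F a b c.
have bG : bilin G by rewrite /G; lin.
have := congr1 (tlift G) (rr : tassoc (tmap id Δ r) = _).
rewrite /tassoc tlift_tlift {1}/tmap tlift_tlift.
rewrite (eq_tlift (G := fun a b => Σ[x, y <- Δ b] F a x y)) => [->|a b].
  rewrite tlift_mulE // /leg13 tlift_tlift; apply: eq_tlift => a b.
  rewrite tlift_tens; last by lin.
  rewrite /leg12 tlift_tens; last by lin.
  rewrite /G tlift_mulE // tlift_tens; last by lin.
  by apply: eq_tlift => c d; rewrite mulr1 mul1r.
rewrite tlift_tens; last by lin.
rewrite tlift_tlift; apply: eq_tlift => x y.
by rewrite tlift_tens // /G tlift_tens.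
Qed.

(** Applying the counit to the last leg of the hexagon for Δ(R^2) gives y r = r
    with y the left side, and r is invertible. *)
Lemma sw_R_counit : (Σ[a, b <- r] (ε b : K) *: a) = 1.
Proof.
have [ru _ _ _] := hr.
set y := LHS.
have yr : (y ⊗ 1) * r = r.
  transitivity (Σ[a, b <- r] Σ[c, d <- r] (ε b : K) *: ((a * c) ⊗ d)).
    rewrite [r in LHS]tens_tlift mul_tlift tlift_exchange.
    apply: eq_tlift => c d; rewrite -[LHS]/(tmul _ _) tmulE mul1r.
    rewrite /y (tlift_out (g := fun z => (z * c) ⊗ d)) //.
    by apply: eq_tlift => a b; rewrite -scalerAl (linZ (f := fun z => z ⊗ d)).
  rewrite -(sw_R_r (F := fun a d b => (ε b : K) *: (a ⊗ d))) //.
  rewrite [RHS]tens_tlift; apply: eq_tlift => a b.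
  by rewrite (sw_counitr (G := fun d => a ⊗ d)).
have y1 : y ⊗ 1 = 1 :> H ⊗ H.
  by apply: (mulIr ru); rewrite yr mul1r.
have := congr1 (tlift (fun a b => (ε b : K) *: a)) y1.
by rewrite tlift_tens // tlift_oneE // coun1 !scale1r.
Qed.

Definition drinfeld : H := Σ[a, b <- r] (S b * a).

(** The expression Σ S^2(h_3) S(R^2 h_2) R^1 h_1 collapses to u h as it stands,
    and to S^2(h) u after the coproduct of h has been commuted past R. *)
Lemma drinfeldE h : S (S h) * drinfeld = drinfeld * h.
Proof.
transitivity (Σ[t, h3 <- Δ h] Σ[a, b <- r] Σ[h1, h2 <- Δ t]
    S (S h3) * (S (b * h2) * (a * h1))).
  under [RHS]eq_tlift => t h3.
    rewrite (sw_R_comm _ (F := fun x y => S (S h3) * (S y * x))) //.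
    under eq_tlift => a b.
      under eq_tlift => h1 h2 do rewrite antiM -!mulrA (mulrA (S h1)).
      rewrite (sw_antil (G := fun z => S (S h3) * (S b * (z * a)))) // mul1r.
      over.
    over.
  rewrite tlift_exchange.
  under [RHS]eq_tlift => a b do
    rewrite (sw_counitl (G := fun z => S (S z) * (S b * a))) //.
  by rewrite /drinfeld mul_tlift.
rewrite tlift_exchange /drinfeld tlift_mul; apply: eq_tlift => a b.
rewrite sw_assoc; last by lin.
under eq_tlift => h1 t.
  under eq_tlift => h2 h3 do rewrite antiM !mulrA -antiM -!mulrA.
  rewrite (sw_antir (G := fun z => S z * (S b * (a * h1)))) // anti1 mul1r.
  over.
by rewrite (sw_counitr (G := fun z => S b * (a * z))) // mulrA.
Qed.

End Rmatrix.

Section AntipodeInner.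
Variables (K : fieldType) (H : hopfType K) (L : H) (r : H ⊗ H).
Hypotheses (hL : idempotent_integral L) (hr : universal_R_matrix r).

(** The inverse of R, twisted by the inverse of S, provides a right inverse of
    u. *)
Lemma drinfeld_unit : drinfeld r \is a GRing.unit.
Proof.
have [ru _ _ _] := hr.
apply: (falg_unit_r (y := Σ[c, d <- r^-1] (Sinv H d * c))).
rewrite mul_tlift.
under eq_tlift => c d.
  rewrite mulrA -(drinfeldE hr) (SinvK hL) /drinfeld mul_tlift tlift_mul.
  under eq_tlift => a b do rewrite mulrA -antiM -mulrA.
  over.
rewrite tlift_exchange -(tlift_mulE (F := fun x y => S y * x)) //.
by rewrite mulrV // tlift_oneE // anti1 mul1r.
Qed.

Lemma anti2 h : S (S h) = drinfeld r * h / drinfeld r.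
Proof. by rewrite -(drinfeldE hr) mulrK // drinfeld_unit. Qed.

End AntipodeInner.

(** * Irreducible representations *)

Section Schur.
Variables (K : closedFieldType) (A : falgType K).

Lemma repM m (rho : 'AHom(A, 'M[K]_m.+1)) a b : rho (a * b) = rho a *m rho b.
Proof. exact: rmorphM. Qed.

Lemma rep1 m (rho : 'AHom(A, 'M[K]_m.+1)) : rho 1 = 1%:M.
Proof. exact: rmorph1. Qed.

(** The kernel and the image of an intertwiner are invariant subspaces. *)
Lemma schur_inv m n (rho : 'AHom(A, 'M[K]_m.+1)) (sigma : 'AHom(A, 'M[K]_n.+1))
    (X : 'M_(m.+1, n.+1)) :
  irreducible rho -> irreducible sigma ->
  (forall a, rho a *m X = X *m sigma a) -> X != 0 ->
  exists2 Y, X *m Y = 1%:M & Y *m X = 1%:M.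
Proof.
move=> irho isig XE nzX.
have lX : linear (mulmx X : 'cV_n.+1 -> 'cV_m.+1) by lin.
pose f : 'Hom('cV[K]_n.+1, 'cV[K]_m.+1) := linfun (mulmx X).
have fE w : f w = X *m w by rewrite lfunE_lin.
have imf : limg f = fullv.
  case: (irho (limg f)) => // [a w /memv_imgP[v _ ->]|f0].
    by rewrite fE mulmxA XE -mulmxA -fE memv_img ?memvf.
  case/eqP: nzX; apply/matrixP => i j; rewrite mxE.
  have : f (delta_mx j 0) \in limg f by rewrite memv_img ?memvf.
  by rewrite f0 memv0 fE => /eqP/matrixP/(_ i 0); rewrite -colE !mxE.
have kerf : lker f = 0%VS.
  case: (isig (lker f)) => // [a w|f1].
    by rewrite !memv_ker !fE mulmxA -XE -mulmxA => /eqP->; rewrite mulmx0.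
  case/eqP: nzX; apply/matrixP => i j; rewrite mxE.
  have : delta_mx j 0 \in lker f by rewrite f1 memvf.
  by rewrite memv_ker fE => /eqP/matrixP/(_ i 0); rewrite -colE !mxE.
pose Y : 'M_(n.+1, m.+1) := \matrix_(i, j) (f^-1%VF (delta_mx j 0) : 'cV_n.+1) i 0.
have XY : X *m Y = 1%:M.
  apply/matrixP => i j.
  have := @limg_lfunVK _ _ _ f (delta_mx j 0); rewrite imf memvf fE => /(_ isT).
  move/matrixP/(_ i 0); rewrite !mxE eqxx andbT => <-.
  by apply: eq_bigr => l _; rewrite !mxE.
exists Y => //; apply/eqP; rewrite -subr_eq0; apply/eqP/matrixP => i j.
rewrite [RHS]mxE.
have : col j (Y *m X - 1%:M) \in lker f.
  by rewrite memv_ker fE colE mulmxA mulmxBr mulmx1 mulmxA XY mul1mx subrr mul0mx.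
by rewrite kerf memv0 => /eqP/matrixP/(_ i 0); rewrite !mxE.
Qed.

Lemma schur_tr m n (rho : 'AHom(A, 'M[K]_m.+1)) (sigma : 'AHom(A, 'M[K]_n.+1))
    (X : 'M_(m.+1, n.+1)) :
  irreducible rho -> irreducible sigma ->
  (forall a, rho a *m X = X *m sigma a) -> X != 0 ->
  forall a, \tr (rho a) = \tr (sigma a).
Proof.
move=> ir is_ XE nzX a; have [Y XY YX] := schur_inv ir is_ XE nzX.
by rewrite -[rho a]mulmx1 -XY mulmxA XE mxtrace_mulC mulmxA YX mul1mx.
Qed.

(** Over an algebraically closed field C has an eigenvalue c, and C - c is an
    intertwiner with a kernel. *)
Lemma schur_scalar m (rho : 'AHom(A, 'M[K]_m.+1)) (C : 'M_m.+1) :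
  irreducible rho -> (forall a, rho a *m C = C *m rho a) ->
  exists c, C = c%:M.
Proof.
move=> irho CE.
have /closed_rootP[c rc] : size (char_poly C) != 1 by rewrite size_char_poly.
have /eigenvalueP[v vC nzv] : eigenvalue C c by rewrite eigenvalue_root_char.
exists c; apply/eqP; rewrite -subr_eq0; apply/negP => /negP nzD.
have [|Y DY _] := schur_inv irho irho _ nzD.
  by move=> a; rewrite mulmxBr mulmxBl CE scalar_mxC.
case/eqP: nzv; rewrite -[v]mulmx1 -DY mulmxA mulmxBr vC mul_mx_scalar subrr.
by rewrite mul0mx.
Qed.

End Schur.

Lemma mxtrace_delta (F : fieldType) m n (M : 'M[F]_(m, n)) i j :
  \tr (delta_mx i j *m M) = M j i.
Proof.
rewrite -(mul_delta_mx (0 : 'I_1)) -mulmxA mxtrace_mulC -rowE -colE.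
by rewrite /mxtrace big_ord1 !mxE.
Qed.

Lemma mul_delta_entry (F : fieldType) m n p (M : 'M[F]_(m, n)) (i : 'I_p) j r q :
  (delta_mx i j *m M) r q = (r == i)%:R * M j q.
Proof.
rewrite -(mul_delta_mx (0 : 'I_1)) -mulmxA -rowE mxE big_ord1 !mxE.
by rewrite andbT.
Qed.

Section MatrixUnits.
Variables (K : closedFieldType) (H : hopfType K) (L u : H).
Hypotheses (hL : idempotent_integral L) (uU : u \is a GRing.unit).
Hypothesis S2u : forall h, S (S h) = u * h / u.

(** Averaging a matrix over the integral turns it into an intertwiner. *)
Definition avg m n (rho : 'AHom(H, 'M[K]_m.+1)) (sigma : 'AHom(H, 'M[K]_n.+1))
    (X : 'M[K]_(m.+1, n.+1)) : 'M[K]_(m.+1, n.+1) :=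
  Σ[a, b <- Δ L] (rho a *m X *m sigma (S b)).

Lemma avg_intertwines m n (rho : 'AHom(H, 'M[K]_m.+1))
    (sigma : 'AHom(H, 'M[K]_n.+1)) X h :
  rho h *m avg rho sigma X = avg rho sigma X *m sigma h.
Proof.
rewrite -[h](SinvK hL) /avg (tlift_out (g := fun Z => rho (S (Sinv H h)) *m Z)) //.
rewrite (tlift_out (g := fun Z => Z *m sigma (S (Sinv H h)))) //.
under eq_tlift => a b do rewrite !mulmxA -repM.
rewrite -(sw_int_shift hL (Sinv H h) (F := fun a b => rho a *m X *m sigma (S b))) //.
by apply: eq_tlift => a b; rewrite antiM repM mulmxA.
Qed.

Lemma avg_entry m n (rho : 'AHom(H, 'M[K]_m.+1)) (sigma : 'AHom(H, 'M[K]_n.+1))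
    b c i d :
  (avg rho sigma (delta_mx b c) i d : K^o)
  = Σ[x, y <- Δ L] ((rho x i b * sigma (S y) c d) : K^o).
Proof.
rewrite /avg (tlift_out (g := fun M : 'M_(_, _) => (M i d : K^o))) //.
apply: eq_tlift => x y; rewrite !mxE (bigD1 c) //= big1 => [|j nj].
  rewrite addr0 !mxE (bigD1 b) //= big1 => [|l nl]; last first.
    by rewrite !mxE (negPf nl) mulr0.
  by rewrite !mxE !eqxx mulr1 addr0.
rewrite !mxE big1 ?mul0r // => l _; rewrite !mxE (negPf nj) andbF mulr0 //.
Qed.

Lemma Sinv_anti a b : Sinv H b * a = Sinv H (S a * b).
Proof.
by apply: (anti_inj hL); rewrite antiM !(SinvK hL).
Qed.

Section Irr.
Variables (m : nat) (rho : 'AHom(H, 'M[K]_m.+1)).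
Hypothesis irho : irreducible rho.

(** The twist by u compensates for S^2: conjugating by it replaces S by its
    inverse, and then Σ S^-1(b) a, over the coproduct of L, collapses. *)
Lemma avg_mulU X : \tr (avg rho rho X *m rho u) = \tr (X *m rho u).
Proof.
apply: (etrans (y := (Σ[a, b <- Δ L] (\tr (X *m rho u *m rho (Sinv H b * a)) : K^o)))).
  rewrite /avg (tlift_out (g := fun Z => (\tr (Z *m rho u) : K^o))) //.
  apply: eq_tlift => a b; rewrite -!mulmxA mxtrace_mulC -!mulmxA.
  congr (\tr (_ *m _)); rewrite -!repM; congr (rho _).
  by rewrite !mulrA -{1}[b](SinvK hL) S2u mulrVK.
rewrite (eq_tlift (G := fun a b => (\tr (X *m rho u *m rho (Sinv H (S a * b))) : K^o))).
  rewrite (sw_antil (G := fun z => (\tr (X *m rho u *m rho (Sinv H z)) : K^o))) //.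
  rewrite (coun_int hL) scale1r -[X in Sinv H X]anti1 (antiK hL).
  by rewrite rep1 mulmx1.
by move=> a b; rewrite Sinv_anti.
Qed.

(** Averages are scalar, so by avg_mulU a vanishing trace of u would make
    tr(X u) vanish for all X; take X = e_00 u^-1. *)
Lemma trU_neq0 : \tr (rho u) != 0.
Proof.
pose X : 'M_m.+1 := delta_mx 0 0 *m rho u^-1.
have [c Ec] := schur_scalar irho (avg_intertwines rho rho X).
have := avg_mulU X; rewrite Ec mul_scalar_mx mxtraceZ /X -mulmxA -repM.
rewrite mulVr // rep1 mulmx1 => e; apply/eqP => t0; move/eqP: e.
rewrite t0 mulr0 /mxtrace (bigD1 0) //= big1 => [|i ni]; rewrite mxE.
  by rewrite addr0 eq_sym oner_eq0.
by rewrite (negPf ni).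
Qed.

Lemma avg_scalar X : avg rho rho X = (\tr (X *m rho u) / \tr (rho u))%:M.
Proof.
have [c Ec] := schur_scalar irho (avg_intertwines rho rho X).
have := avg_mulU X; rewrite Ec mul_scalar_mx mxtraceZ => <-.
by rewrite mulfK // trU_neq0.
Qed.

(** The preimage of an elementary matrix, by inverting the orthogonality
    relation avg_scalar for matrix coefficients. *)
Definition mat_unit (i j : 'I_m.+1) : H :=
  \tr (rho u) *: ((Σ[a, b <- Δ L] (rho (S b) j i : K) *: a) / u).

Lemma mat_unitE i j : rho (mat_unit i j) = delta_mx i j.
Proof.
rewrite /mat_unit linearZ /= repM.
suff -> : rho (Σ[a, b <- Δ L] (rho (S b) j i : K) *: a)
    = (\tr (rho u))^-1 *: (delta_mx i j *m rho u).
  rewrite -scalemxAl scalerA mulfV ?trU_neq0 // scale1r -mulmxA.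
  by rewrite -repM mulrV // rep1 mulmx1.
apply/matrixP => p q.
rewrite (tlift_out (g := fun z => (rho z p q : K^o))) //.
rewrite (eq_tlift (G := fun a b => ((rho a p q * rho (S b) j i) : K^o))); last first.
  by move=> a b; rewrite linearZ mxE mulrC.
rewrite -avg_entry avg_scalar mxtrace_delta [LHS]mxE [RHS]mxE mul_delta_entry.
by rewrite mulrCA mulr_natl mulrC.
Qed.

Lemma mat_unit_other n (sigma : 'AHom(H, 'M[K]_n.+1)) i j :
  irreducible sigma -> ~ (forall h, \tr (sigma h) = \tr (rho h)) ->
  sigma (mat_unit i j) = 0.
Proof.
move=> isig ne; rewrite /mat_unit linearZ /= repM.
suff -> : sigma (Σ[a, b <- Δ L] (rho (S b) j i : K) *: a) = 0.
  by rewrite mul0mx scaler0.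
apply/matrixP => p q.
rewrite (tlift_out (g := fun z => (sigma z p q : K^o))) //.
rewrite (eq_tlift (G := fun a b => ((sigma a p q * rho (S b) j i) : K^o))); last first.
  by move=> a b; rewrite linearZ mxE mulrC.
rewrite -avg_entry !mxE.
case: (eqVneq (avg sigma rho (delta_mx q j)) 0) => [->|nz]; first by rewrite mxE.
by case: ne; apply: (schur_tr isig irho (avg_intertwines _ _ _) nz).
Qed.

End Irr.

Lemma char_orth m n (rho : 'AHom(H, 'M[K]_m.+1)) (sigma : 'AHom(H, 'M[K]_n.+1)) :
  irreducible rho -> irreducible sigma ->
  ~ (forall h, \tr (rho h) = \tr (sigma h)) ->
  (Σ[a, b <- Δ L] ((\tr (rho a) : K) * (\tr (sigma (S b)) : K) : K^o)) = 0.
Proof.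
move=> irho isig ne.
transitivity (\sum_i \sum_j (avg rho sigma (delta_mx i j) i j : K^o)).
  under [RHS]eq_bigr => i _ do (under eq_bigr => j _ do rewrite avg_entry;
    rewrite -tlift_sum).
  rewrite -tlift_sum; apply: eq_tlift => a b.
  by rewrite mulr_suml; apply: eq_bigr => i _; rewrite mulr_sumr.
rewrite big1 // => i _; rewrite big1 // => j _.
case: (eqVneq (avg rho sigma (delta_mx i j)) 0) => [->|nz]; first by rewrite mxE.
by case: ne; apply: (schur_tr irho isig (avg_intertwines _ _ _) nz).
Qed.

End MatrixUnits.

Section IdealRep.
Variables (K : closedFieldType) (A : falgType K).

(** A simple left ideal, in coordinates, is an irreducible matrix
    representation whose kernel annihilates the ideal. *)
Lemma ideal_rep (V : {vspace A}) : simple_left_ideal V ->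
  exists m (sigma : 'AHom(A, 'M[K]_m.+1)),
    irreducible sigma /\ forall h, sigma h = 0 -> forall v, v \in V -> h * v = 0.
Proof.
move=> [nzV lV minV].
have mulV h v : v \in V -> h * v \in V.
  by move=> vV; apply: (subvP lV); rewrite memv_mul ?memvf.
case E : (\dim V) (vbasis V) (vbasisP V) => [|m] X bX.
  by move/eqP: E; rewrite dimv_eq0 (negPf nzV).
have XV i : (i < m.+1)%N -> X`_i \in V.
  by move=> im; rewrite (basis_mem bX) // mem_nth // size_tuple.
have frX : free X := basis_free bX.
pose phi (w : 'cV[K]_m.+1) : A := \sum_i w i 0 *: X`_i.
have lphi : linear phi.
  move=> a x y; rewrite /phi scaler_sumr -big_split; apply: eq_bigr => i _ /=.
  by rewrite !mxE scalerDl scalerA.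
have phiV w : phi w \in V by rewrite memv_suml // => i _; rewrite memvZ // XV.
have phi_inj : injective phi.
  move=> x y e; apply/matrixP => i j; rewrite ord1.
  have c w : coord X i (phi w) = w i 0 by rewrite coord_sum_free.
  by rewrite -!c e.
pose M (h : A) : 'M[K]_m.+1 := \matrix_(i, j) coord X i (h * X`_j).
have phiM h w : phi (M h *m w) = h * phi w.
  have -> : h * phi w = \sum_j \sum_i (w j 0 * M h i j) *: X`_i.
    rewrite mulr_sumr; apply: eq_bigr => j _.
    rewrite -scalerAr [h * _](coord_basis bX) ?mulV ?XV // scaler_sumr.
    by apply: eq_bigr => i _; rewrite mxE scalerA.
  rewrite exchange_big; apply: eq_bigr => i _ /=.
  by rewrite -scaler_suml mxE; congr (_ *: _); apply: eq_bigr => j _; rewrite mulrC.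
have lM : linear M.
  by move=> a x y; apply/matrixP => i j; rewrite !mxE mulrDl -scalerAl linearP.
have M_mx h C : (forall w, phi (C *m w) = h * phi w) -> M h = C.
  move=> CE; apply/matrixP => i j.
  have := phi_inj _ _ (etrans (phiM h (delta_mx j 0)) (esym (CE (delta_mx j 0)))).
  by rewrite -!colE => /matrixP/(_ i 0); rewrite !mxE.
have M1 : M 1 = 1 by apply: M_mx => w; rewrite mul1mx mul1r.
have MM h h' : M (h * h') = M h * M h'.
  by apply: M_mx => w; rewrite -mulmxA !phiM mulrA.
pose f : 'Hom(A, 'M[K]_m.+1) := linfun M.
have fE h : f h = M h by rewrite lfunE_lin.
have fA : ahom_in fullv f.
  by apply/ahom_inP; split=> [x y _ _|]; rewrite !fE ?MM ?M1.
exists m, (AHom fA); split=> [W stW|h].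
  pose g : 'Hom('cV[K]_m.+1, A) := linfun phi.
  have gE w : g w = phi w by rewrite lfunE_lin.
  have lW : left_ideal (g @: W)%VS.
    apply/prodvP => h v _ /memv_imgP[w wW ->].
    by rewrite gE -phiM -gE memv_img // -fE; apply: stW.
  have sW : (g @: W <= V)%VS.
    by apply/subvP => v /memv_imgP[w _ ->]; rewrite gE.
  case: (minV _ lW sW) => gW; [left | right].
    apply/eqP; rewrite -subv0; apply/subvP => w wW; rewrite memv0.
    have : g w \in (g @: W)%VS by rewrite memv_img.
    rewrite gW memv0 gE => /eqP e; apply/eqP/phi_inj.
    by rewrite e lin0.
  apply/eqP; rewrite eqEsubv subvf; apply/subvP => w _.
  have : phi w \in (g @: W)%VS by rewrite gW.
  by case/memv_imgP => w' w'W; rewrite gE => /phi_inj->.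
move=> h0 v vV; rewrite (coord_basis bX vV).
have := phiM h (\col_i coord X i v); rewrite -fE [f h]h0 mul0mx lin0 // => e.
rewrite [RHS]e; congr (_ * _); apply: eq_bigr => i _.
by rewrite mxE.
Qed.

End IdealRep.

(** * Coordinates on a semisimple Hopf algebra *)

Section Wedderburn.
Variables (K : closedFieldType) (H : hopfType K) (L u : H).
Hypotheses (hL : idempotent_integral L) (uU : u \is a GRing.unit).
Hypothesis S2u : forall h, S (S h) = u * h / u.
Hypothesis ssH : semisimple H.
Variables (n : nat) (dm : 'I_n.+1 -> nat).
Variable rho : forall i, 'AHom(H, 'M[K]_((dm i).+1)).
Hypothesis irho : forall i, irreducible (rho i).
Hypothesis rho_neq : forall i j, i != j ->
  ~ (forall h, \tr (rho i h) = \tr (rho j h)).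
Hypothesis rho_all : forall m (sigma : 'AHom(H, 'M[K]_m.+1)),
  irreducible sigma -> exists i, forall h, \tr (sigma h) = \tr (rho i h).

(** H is a sum of simple left ideals, and h kills each of them. *)
Lemma rep_inj (h : H) : (forall i, rho i h = 0) -> h = 0.
Proof.
move=> h0.
have kill (V : {vspace H}) : simple_left_ideal V -> forall v, v \in V -> h * v = 0.
  move=> /ideal_rep[m [sigma [isig ks]]]; apply: ks.
  have [i E] := rho_all isig.
  apply/matrixP => p q; rewrite -mxtrace_delta -(mat_unitE hL uU S2u isig) -repM.
  by rewrite E repM h0 mulmx0 mxtrace0 mxE.
have [N [V [sV _ sumV]]] := ssH.
have : (1 : H) \in (\sum_i V i)%VS by rewrite sumV memvf.
case/memv_sumP => v vV e1; rewrite -[h]mulr1 e1 mulr_sumr big1 // => i _.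
exact: kill (sV i) _ (vV i isT).
Qed.

Lemma rep_eq (x y : H) : (forall i, rho i x = rho i y) -> x = y.
Proof.
move=> e; apply/eqP; rewrite -subr_eq0; apply/eqP/rep_inj => i.
by rewrite linearB /= e subrr.
Qed.

Definition munit i (a b : 'I_((dm i).+1)) : H := mat_unit L u (rho i) a b.

Lemma munitE i a b : rho i (munit a b) = delta_mx a b.
Proof. exact: mat_unitE. Qed.

Lemma munit_other i j a b : j != i -> rho j (@munit i a b) = 0.
Proof.
by move=> ji; apply: mat_unit_other => //; apply: rho_neq.
Qed.

Lemma munit_res (x : H) : x = \sum_i \sum_a \sum_b rho i x a b *: munit a b.
Proof.
apply: rep_eq => j; rewrite linear_sum (bigD1 j) //= [X in _ + X]big1 => [|i nij].
  rewrite addr0 {1}[rho j x]matrix_sum_delta linear_sum; apply: eq_bigr => a _.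
  by rewrite linear_sum; apply: eq_bigr => b _; rewrite linearZ /= munitE.
rewrite linear_sum big1 // => a _; rewrite linear_sum big1 // => b _.
by rewrite linearZ /= munit_other ?scaler0 // eq_sym.
Qed.

Lemma munitM i (a b c d : 'I_((dm i).+1)) :
  munit a b * munit c d = (b == c)%:R *: munit a d.
Proof.
apply: rep_eq => j; rewrite repM [in RHS]linearZ /=.
have [->|ji] := eqVneq j i.
  by rewrite !munitE mul_delta_mx_cond scaler_nat.
by rewrite !munit_other // mul0mx scaler0.
Qed.

(** H is a product of matrix algebras, and on matrices of one size the map
    x ↦ a x b has trace tr(a) tr(b). *)
Lemma tr_mul_lr (a b : H) :
  tr (fun x : H => a * x * b) = \sum_i \tr (rho i a) * \tr (rho i b).
Proof.
rewrite (eq_tr (g := fun x => \sum_i \sum_p \sum_q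
   (rho i x p q *: (a * munit p q * b)))); last first.
  move=> x; rewrite {1}[x]munit_res mulr_sumr mulr_suml; apply: eq_bigr => i _.
  rewrite mulr_sumr mulr_suml; apply: eq_bigr => p _.
  rewrite mulr_sumr mulr_suml; apply: eq_bigr => q _.
  by rewrite -scalerAr -scalerAl.
rewrite tr_sum; apply: eq_bigr => i _; rewrite tr_sum /mxtrace mulr_suml.
apply: eq_bigr => p _; rewrite tr_sum mulr_sumr; apply: eq_bigr => q _.
rewrite (tr_rank1 _ (p := fun x => (rho i x p q : K^o))) // !repM munitE.
rewrite -(mul_delta_mx (0 : 'I_1)) mulmxA -mulmxA -colE -rowE.
by rewrite mxE big_ord1 !mxE.
Qed.

Lemma rep_tracelike i : forall x y : H, \tr (rho i (x * y)) = \tr (rho i (y * x)).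
Proof. by move=> x y; rewrite !repM mxtrace_mulC. Qed.

(** A tracelike functional vanishes on off-diagonal matrix units and takes the
    same value on all diagonal ones of a block. *)
Lemma tracelike_span (p : 'Hom(H, (K^o)%type)) : tracelike p ->
  forall x, p x = \sum_i p (munit (ord0 : 'I_((dm i).+1)) ord0) * \tr (rho i x).
Proof.
move=> tp x; rewrite {1}[x]munit_res linear_sum; apply: eq_bigr => i _.
rewrite linear_sum mulr_sumr; apply: eq_bigr => a _.
rewrite linear_sum (bigD1 a) //= [X in _ + X]big1 ?addr0 => [|b nba].
  rewrite linearZ /=.
  have -> : munit a a = munit a ord0 * munit ord0 a.
    by rewrite munitM eqxx scale1r.
  by rewrite tp munitM eqxx scale1r [LHS]mulrC.
rewrite linearZ /=.
have -> : munit a b = munit a a * munit a b by rewrite munitM eqxx scale1r.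
by rewrite tp munitM (negPf nba) scale0r linear0 scaler0.
Qed.

Lemma central_rep (z : H) i : (forall x, z * x = x * z) -> exists c, rho i z = c%:M.
Proof.
move=> cz; have [|c Ec] := @schur_scalar _ _ _ _ (rho i z) (@irho i).
  by move=> a; rewrite -!repM cz.
by exists c.
Qed.

End Wedderburn.

(** * Sums of roots of unity in a field of characteristic 0 *)

Section RatChar0.
Variable K : fieldType.
Hypothesis ch0 : [pchar K] =i pred0.

Lemma natr0_eq0 n : (n%:R == 0 :> K) = (n == 0%N).
Proof. exact: ((pcharf0P K).1 ch0). Qed.

Lemma intr0_eq0 (z : int) : (z%:~R == 0 :> K) = (z == 0).
Proof.
case: z => n; first exact: natr0_eq0.
by rewrite NegzE mulrNz oppr_eq0 natr0_eq0.
Qed.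

(** The embedding of the rationals is defined on reduced fractions; clearing
    denominators shows that it may be computed on any fraction. *)
Lemma ratr_char0E (x : rat) (a b : int) :
  x * b%:~R = a%:~R -> ratr x * b%:~R = a%:~R :> K.
Proof.
move=> xb.
have E : numq x * b = a * denq x.
  apply: (@intr_inj rat); rewrite !rmorphM /= -xb numqE.
  by rewrite -!mulrA (mulrC b%:~R).
have nzd : (denq x)%:~R != 0 :> K by rewrite intr0_eq0 denq_eq0.
by rewrite /ratr mulrAC -rmorphM /= E rmorphM /= mulfK.
Qed.

Lemma ratr_char0_zmod : zmod_morphism (@ratr K).
Proof.
move=> x y.
have nz (z : rat) : (denq z)%:~R != 0 :> K by rewrite intr0_eq0 denq_eq0.
have eK (z : rat) : ratr z * (denq z)%:~R = (numq z)%:~R :> K.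
  by apply: ratr_char0E; rewrite numqE.
apply: (mulIf (mulf_neq0 (nz x) (nz y))); rewrite -rmorphM /=.
rewrite (ratr_char0E (a := numq x * denq y - numq y * denq x)).
  by rewrite !rmorphB !rmorphM /= -!eK; ring.
by rewrite !rmorphB !rmorphM /= !numqE; ring.
Qed.

Lemma ratr_char0_monoid : monoid_morphism (@ratr K).
Proof.
split=> [|x y]; first by rewrite /ratr divr1.
have nz (z : rat) : (denq z)%:~R != 0 :> K by rewrite intr0_eq0 denq_eq0.
have eK (z : rat) : ratr z * (denq z)%:~R = (numq z)%:~R :> K.
  by apply: ratr_char0E; rewrite numqE.
apply: (mulIf (mulf_neq0 (nz x) (nz y))); rewrite -rmorphM /=.
rewrite (ratr_char0E (a := numq x * numq y)).
  by rewrite !rmorphM /= -!eK; ring.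
by rewrite !rmorphM /= !numqE; ring.
Qed.

Definition ratK : {rmorphism rat -> K} :=
  HB.pack (@ratr K) (GRing.isZmodMorphism.Build rat K _ ratr_char0_zmod)
    (GRing.isMonoidMorphism.Build rat K _ ratr_char0_monoid).

(** A rational polynomial vanishing at an M-th root of unity of K shares a
    factor with X^M - 1, hence vanishes at some complex M-th root of unity. *)
Lemma unity_root_algC (P : {poly rat}) M (z : K) :
  (0 < M)%N -> z ^+ M = 1 -> (map_poly ratK P).[z] = 0 ->
  exists2 w : algC, w ^+ M = 1 & (map_poly ratr P).[w] = 0.
Proof.
move=> M0 zM Pz; pose Q : {poly rat} := 'X^M - 1.
have nzQ : Q != 0 by rewrite -size_poly_eq0 size_XnsubC.
have mapQ (R : fieldType) (f : {rmorphism rat -> R}) : map_poly f Q = 'X^M - 1.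
  by rewrite rmorphB /= map_polyXn rmorph1.
have ncp : ~~ coprimep P Q.
  apply/negP => /Bezout_coprimepP[[a b] /= /eqpP[[c1 c2] /= /andP[nc1 nc2] E]].
  pose ev (p : {poly rat}) := (map_poly ratK p).[z].
  have evM p q : ev (p * q) = ev p * ev q by rewrite /ev rmorphM hornerM.
  have evD p q : ev (p + q) = ev p + ev q by rewrite /ev rmorphD hornerD.
  have evZ c p : ev (c *: p) = ratK c * ev p by rewrite /ev map_polyZ hornerZ.
  have ev1 : ev 1 = 1 by rewrite /ev rmorph1 hornerC.
  have evP : ev P = 0 by [].
  have evQ : ev Q = 0 by rewrite /ev mapQ !hornerE zM subrr.
  have := congr1 ev E; rewrite !evZ evD !evM ev1 evP evQ !mulr0 addr0 mulr0 mulr1.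
  by move/esym/eqP; rewrite fmorph_eq0 (negPf nc2).
have /closed_rootP[w] : size (map_poly (ratr : rat -> algC) (gcdp P Q)) != 1%N.
  by rewrite size_map_poly; exact: ncp.
have dv R : gcdp P Q %| R -> root (map_poly (ratr : rat -> algC) (gcdp P Q)) w ->
    root (map_poly ratr R) w.
  by move=> /dvdpP[q ->] /eqP g0; rewrite rootE rmorphM hornerM g0 mulr0.
move=> rw; exists w.
  have := dv _ (dvdp_gcdr P Q) rw; rewrite mapQ rootE !hornerE subr_eq0.
  by move/eqP.
by have := dv _ (dvdp_gcdl P Q) rw; rewrite rootE => /eqP.
Qed.

(** The sum is a rational polynomial in z.  At a complex root of unity w,
    where w^(M-1) is the conjugate of w, it is a sum of squared absolute
    values, and the term i0 equals 1; so it cannot vanish at z either. *)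
Lemma unity_norm_sum (I : finType) (s : I -> seq nat) (i0 : I) M (z : K) :
  (0 < M)%N -> z ^+ M = 1 -> size (s i0) = 1%N ->
  \sum_i (\sum_(k <- s i) z ^+ k) * (\sum_(k <- s i) z ^+ (k * M.-1)) != 0.
Proof.
move=> M0 zM s1; apply/eqP => S0.
pose P : {poly rat} :=
  \sum_i (\sum_(k <- s i) 'X^k) * (\sum_(k <- s i) 'X^(k * M.-1)).
have PE (R : fieldType) (f : {rmorphism rat -> R}) (x : R) : (map_poly f P).[x]
    = \sum_i (\sum_(k <- s i) x ^+ k) * (\sum_(k <- s i) x ^+ (k * M.-1)).
  rewrite rmorph_sum horner_sum; apply: eq_bigr => i _.
  rewrite rmorphM hornerM !rmorph_sum !horner_sum; congr (_ * _).
    by apply: eq_bigr => k _; rewrite /= map_polyXn hornerXn.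
  by apply: eq_bigr => k _; rewrite /= map_polyXn hornerXn.
have [|w wM Pw] := unity_root_algC (P := P) M0 zM; first by rewrite PE.
have cw k : w ^+ (k * M.-1) = (w ^+ k)^*.
  have nw : `|w| = 1.
    by apply/eqP; rewrite -(pexpr_eq1 (n := M)) // -normrX wM normr1.
  have wV : w ^+ M.-1 = w^*.
    have nzw : w != 0 by rewrite -normr_eq0 nw oner_eq0.
    apply: (mulfI nzw); rewrite -exprS prednK // wM -normCK nw expr1n //.
  by rewrite mulnC exprM wV rmorphXn.
move: Pw; rewrite PE => /eqP; apply/negP.
under eq_bigr => i _.
  under [X in _ * X]eq_bigr => k _ do rewrite cw.
  rewrite -rmorph_sum -normCK; over.
rewrite gt_eqF // (bigD1 i0) //= ltr_wpDr //.
  by rewrite sumr_ge0 // => i _; rewrite exprn_ge0.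
case: (s i0) s1 => [|k []] //= _; rewrite big_seq1 normrX.
have nw : `|w| = 1.
  by apply/eqP; rewrite -(pexpr_eq1 (n := M)) // -normrX wM normr1.
by rewrite nw !expr1n.
Qed.

End RatChar0.

Section UnityTraces.
Variable K : closedFieldType.
Hypothesis ch0 : [pchar K] =i pred0.

Lemma prim_root_char0 M : (0 < M)%N -> exists z : K, M.-primitive_root z.
Proof.
move=> M0; have [r Dp] := closed_field_poly_normal ('X^M - 1 : {poly K}).
rewrite (monicP _) ?monicXnsubC // scale1r in Dp.
have rn1 : all M.-unity_root r by apply/allP=> z; rewrite -root_prod_XsubC -Dp.
have sz_r : (M < (size r).+1)%N.
  by rewrite -(size_prod_XsubC r id) -Dp size_XnsubC.
have [|z _ pz] := hasP (has_prim_root M0 rn1 _ sz_r); last by exists z.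
by rewrite -separable_prod_XsubC -Dp separable_Xn_sub_1 // natr0_eq0 // -lt0n.
Qed.

(** V is diagonalizable, as X^M - 1 has simple roots, with eigenvalues among
    the powers of z. *)
Lemma unity_traces M (z : K) m (V : 'M[K]_m.+1) :
  M.-primitive_root z -> V ^+ M = 1 ->
  exists2 s : seq nat, size s = m.+1
    & forall t, \tr (V ^+ t) = \sum_(k <- s) z ^+ (k * t).
Proof.
move=> pz VM; have M0 := prim_order_gt0 pz.
have : diagonalizable V.
  apply/diagonalizableP.
  exists [seq z ^+ i | i <- index_iota 0 M].
    rewrite map_inj_in_uniq ?iota_uniq // => i j.
    rewrite !mem_index_iota /= => iM jM /eqP.
    by rewrite (eq_prim_root_expr pz) !modn_small // => /eqP.
  rewrite big_map (factor_Xn_sub_1 pz); apply: mxminpoly_min.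
  by rewrite rmorphB /= rmorphXn /= horner_mx_X VM rmorph1 subrr.
case=> P Pu /(diagonalizable_forLR Pu)[D VD].
have PVu : invmx P \in unitmx by rewrite unitmx_inv.
have VD' : V = invmx P *m diag_mx D *m P by rewrite VD mxpoly.conjumx // invmxK.
have VE t : V ^+ t = invmx P *m diag_mx D ^+ t *m P.
  elim: t => [|t IHt]; first by rewrite !expr0 mulmx1 mulVmx.
  rewrite !exprS IHt {1}VD' -!mulmxE !mulmxA.
  by rewrite -(mulmxA _ P) mulmxV // mulmx1.
have DE t : diag_mx D ^+ t = diag_mx (\row_i (D 0 i ^+ t)).
  elim: t => [|t IHt].
    rewrite expr0; apply/matrixP => i j; rewrite !mxE expr0.
    by [].
  rewrite exprS IHt -mulmxE mulmx_diag; congr diag_mx; apply/rowP => i.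
  by rewrite !mxE exprS.
have DM i : D 0 i ^+ M = 1.
  have : diag_mx D ^+ M = 1.
    have -> : diag_mx D ^+ M = P *m V ^+ M *m invmx P.
      by rewrite VE -!mulmxA mulmxV // mulmx1 mulmxA mulmxV // mul1mx.
    have -> : V ^+ M = 1%:M by [].
    by rewrite mulmx1 mulmxV.
  by rewrite DE => /matrixP/(_ i i); rewrite !mxE eqxx.
(* The exponents of the eigenvalues of V, as powers of z. *)
pose e i : nat := sval (prim_rootP pz (DM i)).
have eP i : D 0 i = z ^+ e i by rewrite /e; case: prim_rootP.
exists [seq e i | i <- enum 'I_m.+1]; first by rewrite size_map size_enum_ord.
move=> t; rewrite VE -mulmxA mxtrace_mulC -mulmxA mulmxV // mulmx1 DE mxtrace_diag.
rewrite big_map big_enum /=; apply: eq_bigr => i _.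
by rewrite mxE eP exprM.
Qed.

End UnityTraces.

(** * The square of the antipode *)

Section RightTranslation.
Variables (K : fieldType) (H : hopfType K).
Implicit Types (p q : 'Hom(H, (K^o)%type)) (x h : H).

Lemma conv_sw p q h : conv p q h = Σ[a, b <- Δ h] (p a * q b : K^o).
Proof. exact: convE. Qed.

(** Right translation by a functional.  It is the transpose of right
    convolution, so translations represent the dual algebra on H. *)
Definition rop q x : H := Σ[a, b <- Δ x] (q b : K) *: a.

Lemma rop_lin q : linear (rop q).
Proof. by rewrite /rop; lin. Qed.

Lemma rop_rop p q x : rop p (rop q x) = rop (conv p q) x.
Proof.
rewrite /rop {1}lfun_tlift tlift_tlift.
under eq_tlift => a b do rewrite linearZ /= linZ // scale_tlift.
rewrite (sw_assoc (F := fun a c b => (q b : K) *: ((p c : K) *: a))) //.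
apply: eq_tlift => a t; rewrite conv_sw tlift_scale; apply: eq_tlift => b c.
by rewrite scalerA mulrC.
Qed.

Lemma coun_rop q x : ε (rop q x) = q x.
Proof.
rewrite /rop lfun_tlift -(sw_counitl (G := fun x => q x)) //.
by apply: eq_tlift => a b; rewrite linearZ [LHS]mulrC.
Qed.

End RightTranslation.

Section TraceTranslation.
Variables (K : fieldType) (H : hopfType K) (L : H).
Hypothesis hL : idempotent_integral L.
Hypothesis anti4_id : forall a : H, S (S (S (S a))) = a.

(** For fixed q, h ↦ Tr(x ↦ S^2(x_1) q(h x_2)) is a multiple of the counit:
    a factor S^3(h_1) can be put in front and h_2 next to x, cyclicity of the
    trace brings them together as h_2 S^3(h_1), and this collapses because
    S^4 = id.  The identity is the case h = L. *)
Lemma tr_anti2_rop q :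
  tr (fun x => S (S (rop q x))) = tr (fun x : H => S (S x)) * q L.
Proof.
have lq := rop_lin q.
have trh h : tr (fun x => Σ[a, b <- Δ x] (q (h * b) : K) *: S (S a))
    = (ε h : K) * tr (fun x => S (S (rop q x))).
  have E x : (Σ[a, b <- Δ x] (q (h * b) : K) *: S (S a))
      = Σ[h1, t <- Δ h] S (S (S h1)) * S (S (rop q (t * x))).
    symmetry; under eq_tlift => h1 t.
      rewrite /rop (sw_mul (F := fun a b => (q b : K) *: a)) //.
      rewrite !lfun_tlift mul_tlift.
      under eq_tlift => t1 t2.
        rewrite !lfun_tlift mul_tlift.
        under eq_tlift => a b do rewrite !linearZ /= -scalerAr -!antiM mulrA.
        over.
      over.
    rewrite -sw_assoc //; under eq_tlift => v t2.
      rewrite (sw_antil (G := fun z =>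
        Σ[a, b <- Δ x] (q (t2 * b) : K) *: S (S (z * a)))) //.
      under [X in _ *: X]eq_tlift => a b do rewrite mul1r.
      over.
    by rewrite (sw_counitl (G := fun z =>
      Σ[a, b <- Δ x] (q (z * b) : K) *: S (S a))).
  rewrite (eq_tr E) tr_tlift.
  have cyc h1 t : tr (fun x => S (S (S h1)) * S (S (rop q (t * x))))
      = tr (fun y => t * S (S (S h1)) * S (S (rop q y))).
    rewrite (trC (f := fun x => t * x) (g := fun y => S (S (S h1)) * S (S (rop q y)))) //.
    by apply: eq_tr => y; rewrite mulrA.
  under eq_tlift => h1 t do rewrite cyc.
  rewrite -tr_tlift -trZ; apply: eq_tr => y; rewrite -tlift_mul.
  have -> : (Σ[a, b <- Δ h] (b * S (S (S a)))) = (ε h : K) *: 1.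
    apply: (anti_inj hL); rewrite lfun_tlift linearZ /= anti1.
    rewrite -(sw_antir (G := fun z => z)) //; apply: eq_tlift => a b.
    by rewrite antiM anti4_id.
  by rewrite -scalerAl mul1r.
have := trh L; rewrite (coun_int hL) mul1r => <-.
rewrite mulrC -trZ; apply: eq_tr => x.
rewrite -(sw_counitr (G := fun z => (q L : K) *: S (S z)) x) //.
by apply: eq_tlift => a b; rewrite (intR hL) linearZ scalerA.
Qed.

End TraceTranslation.

Section Involution.
Variable K : fieldType.
Hypothesis ch0 : [pchar K] =i pred0.

(** On the image of P, the involution T has eigenvalues 1 and -1; a and b are
    their multiplicities, the ranks of the idempotents (P + T P)/2 and
    (P - T P)/2. *)
Lemma tr_involution (V : vectType K) (T P : V -> V) :
  linear T -> linear P -> (forall x, T (T x) = x) -> (forall x, P (P x) = P x) ->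
  (forall x, T (P x) = P (T x)) ->
  exists a b : nat, [/\ tr (fun x => T (P x)) = a%:R - b%:R,
    tr P = (a + b)%:R, a = 0%N -> forall x, T (P x) = - P x
    & b = 0%N -> forall x, T (P x) = P x].
Proof.
move=> lT lP TT PP TP.
have n2 : (2 : K) != 0 by rewrite natr0_eq0.
pose e (s : K) x := 2^-1 *: (P x + s *: T (P x)).
have le s : linear (e s) by rewrite /e; lin.
have ee s : s * s = 1 -> forall x, e s (e s x) = e s x.
  move=> ss x; set y := e s x.
  have Py : P y = y.
    by rewrite /y /e (linZ _ _ lP) (linD lP) (linZ _ _ lP) -TP !PP.
  have Ty : T y = s *: y.
    rewrite /y /e (linZ _ _ lT) (linD lT) (linZ _ _ lT) TT.
    rewrite [RHS]scalerA mulrC -scalerA; congr (_ *: _).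
    by rewrite scalerDr scalerA ss scale1r addrC.
  by rewrite /e Py Ty scalerA ss scale1r -mulr2n -scaler_nat scalerA mulVf // scale1r.
have tre s : s * s = 1 -> exists2 a : nat,
    2^-1 * (tr P + s * tr (fun x => T (P x))) = a%:R & a = 0%N -> forall x, e s x = 0.
  move=> ss; exists (\dim (limg (linfun (e s)))) => [|a0 x].
    rewrite -(tr_idem (le s) (ee s ss)) trZ trD trZ //.
  have : linfun (e s) x \in limg (linfun (e s)) by rewrite memv_img ?memvf.
  have /eqP := a0; rewrite dimv_eq0 => /eqP->; rewrite memv0 lfunE_lin //.
  by move/eqP.
have [a Ea a0] := tre 1 (mulr1 1).
have [|b Eb b0] := tre (- 1); first by rewrite mulrNN mulr1.
have E2 y : 2^-1 * y + 2^-1 * y = y :> K.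
  by rewrite -mulrDl -[2^-1 + _]mulr2n -[2^-1 *+ 2]mulr_natl mulfV // mul1r.
exists a, b; split.
- rewrite -Ea -Eb -[LHS]E2 mul1r mulN1r !mulrDr mulrN; set u := tr P; set v := tr _.
  by rewrite opprD opprK addrACA subrr add0r.
- rewrite natrD -Ea -Eb -[LHS]E2 mul1r mulN1r !mulrDr mulrN.
  by rewrite addrACA subrr addr0.
- move=> /a0 e0 x; have /eqP := e0 x.
  rewrite /e scaler_eq0 invr_eq0 (negPf n2) /= scale1r addrC addr_eq0.
  by move/eqP.
move=> /b0 e0 x; have /eqP := e0 x.
rewrite /e scaler_eq0 invr_eq0 (negPf n2) /= scaleN1r subr_eq0 => /eqP e1.
by rewrite -e1.
Qed.

End Involution.

Section AntipodeSquare.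
Variables (K : closedFieldType) (H : hopfType K) (L : H) (r : H ⊗ H).
Hypothesis ch0 : [pchar K] =i pred0.
Hypotheses (hL : idempotent_integral L) (hr : universal_R_matrix r).
Hypothesis ssH : semisimple H.
Variables (n : nat) (dm : 'I_n.+1 -> nat).
Variable rho : forall i, 'AHom(H, 'M[K]_((dm i).+1)).
Hypothesis irho : forall i, irreducible (rho i).
Hypothesis rho_neq : forall i j, i != j ->
  ~ (forall h, \tr (rho i h) = \tr (rho j h)).
Hypothesis rho_all : forall m (sigma : 'AHom(H, 'M[K]_m.+1)),
  irreducible sigma -> exists i, forall h, \tr (sigma h) = \tr (rho i h).
Hypothesis rho0 : forall h, \tr (rho ord0 h) = ε h.

Local Notation u := (drinfeld r).
Let uU : u \is a GRing.unit := drinfeld_unit hL hr.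
Let S2u : forall h, S (S h) = u * h / u := anti2 hL hr.

Lemma lam1E : lam H 1 = \sum_i \tr (rho i u) * \tr (rho i u^-1).
Proof.
rewrite lamE -(tr_mul_lr hL uU S2u ssH irho rho_neq rho_all).
by apply: eq_tr => x; rewrite mulr1 S2u.
Qed.

Lemma coun_mod : ε (modg L) = 1.
Proof.
rewrite /modg lfun_tlift -[RHS](lam_L hL) -(sw_counitl (G := fun x => lam H x)) //.
by apply: eq_tlift => a b; rewrite linearZ [LHS]mulrC.
Qed.

(** S^4 is conjugation by u^2 and by the distinguished grouplike element g, so
    g^-1 u^2 is central, and g has finite order. *)
Lemma drinfeld_pow_central :
  exists2 M, (0 < M)%N & forall x, u ^+ M * x = x * u ^+ M.
Proof.
have [N N0 gN] := grouplike_order (mod_grouplike hL) coun_mod.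
have gU : modg L \is a GRing.unit := grouplike_unit (mod_grouplike hL) coun_mod.
set g := modg L in gN gU.
(* Conjugation by g and by u^2 are both S^4. *)
pose c := g^-1 * u ^+ 2.
have cC x : c * x = x * c.
  apply: (mulrI gU); rewrite /c !mulrA mulrV // mul1r.
  by rewrite -(anti4 hL) !S2u !mulrA (mulrK gU) !(mulrVK uU).
exists (2 * N)%N => [|x]; first by rewrite muln_gt0.
have -> : u ^+ (2 * N) = c ^+ N.
  rewrite exprM; have -> : u ^+ 2 = g * c by rewrite /c mulrA mulrV // mul1r.
  by rewrite exprMn_comm ?gN ?mul1r // /GRing.comm cC.
by apply/esym/commrX; rewrite /GRing.comm cC.
Qed.

Lemma rep0_dim : dm ord0 = 0%N.
Proof.
have := rho0 1; rewrite rep1 mxtrace1 coun1 => /eqP.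
by rewrite -subr_eq0 -natr1 addrK natr0_eq0 // => /eqP.
Qed.

(** A power of u is central, so u acts on an irreducible module as mu V with V
    of finite order.  The scalar mu cancels in χ(u) χ(u^-1), which is then
    the product of a sum of roots of unity with the sum of their inverses. *)
Lemma lam1_neq0 : lam H 1 != 0.
Proof.
have [M M0 uM] := drinfeld_pow_central.
have [z pz] := prim_root_char0 ch0 M0.
have tr_u i : exists s : seq nat, size s = (dm i).+1 /\
    \tr (rho i u) * \tr (rho i u^-1)
    = (\sum_(k <- s) z ^+ k) * (\sum_(k <- s) z ^+ (k * M.-1)).
  have [c Ec] := central_rep irho i uM.
  have rU : rho i u *m rho i u^-1 = 1%:M by rewrite -repM mulrV // rep1.
  (* An M-th root of the scalar by which u^M acts normalizes u. *)
  have [mu mM] : exists mu : K, mu ^+ M = c.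
    have /closed_rootP[mu] : size ('X^M - c%:P : {poly K}) != 1%N.
      by rewrite size_XnsubC // eqSS -lt0n.
    by rewrite rootE !hornerE subr_eq0 => /eqP <-; exists mu.
  have nzc : c != 0.
    apply/eqP => c0; have : rho i (u ^+ M) *m rho i (u ^- M) = 1%:M.
      by rewrite -repM mulrV ?unitrX // rep1.
    rewrite Ec c0 raddf0 mul0mx => /matrixP/(_ 0 0); rewrite !mxE => /eqP.
    by rewrite eq_sym oner_eq0.
  have nzmu : mu != 0.
    by apply: contraNneq nzc => m0; rewrite -mM m0 expr0n gtn_eqF.
  pose V : 'M_((dm i).+1) := mu^-1 *: rho i u.
  have VM : V ^+ M = 1.
    rewrite /V exprZn -rmorphXn /= Ec -mM exprVn scale_scalar_mx.
    by rewrite mulVf ?expf_neq0.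
  have [s sz sE] := unity_traces pz VM.
  exists s; split=> //.
  have uV : rho i u = mu *: V by rewrite /V scalerA mulfV // scale1r.
  have uVi : rho i u^-1 = mu^-1 *: V ^+ M.-1.
    rewrite -[LHS]mul1mx -[LHS](_ : (mu^-1 *: V ^+ M.-1) *m rho i u *m rho i u^-1 = _).
      by rewrite -mulmxA rU mulmx1.
    congr (_ *m _); rewrite uV -scalemxAl -scalemxAr scalerA mulVf // scale1r.
    by rewrite mulmxE -exprSr prednK.
  clearbody V; rewrite uVi {1}uV !mxtraceZ mulrACA mulfV // mul1r; congr (_ * _).
    by rewrite -[V in LHS]expr1 sE; apply: eq_bigr => k _; rewrite muln1.
  exact: sE.
have [s sP] := choice tr_u.
rewrite lam1E (eq_bigr _ (fun i _ => (sP i).2)).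
apply: (unity_norm_sum ch0 (i0 := ord0) M0 (prim_expr_order pz)).
by rewrite (sP ord0).1 rep0_dim.
Qed.

(** Evaluate lam_mod at 1, where lam does not vanish. *)
Lemma mod1 : modg L = 1.
Proof.
have := lam_mod hL 1; rewrite sw_one // => /eqP.
rewrite -subr_eq0 -scalerBr scaler_eq0 (negPf lam1_neq0) /= subr_eq0.
by move/eqP.
Qed.

Lemma anti4_id (a : H) : S (S (S (S a))) = a.
Proof. by have := anti4 hL a; rewrite mod1 mulr1 mul1r. Qed.

(** Let a and b be the multiplicities of the eigenvalues 1 and -1 of S^2.  The
    trace of S^2 on the image of the translation by f is an integer m, and by
    tr_anti2_rop it is (a - b) / (a + b).  Thus a - b = (a + b) m; here
    a - b is not 0 by lam1_neq0, and a is not 0 because S^2 fixes 1, which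
    leaves b = 0. *)
Lemma anti2_id (f : 'Hom(H, (K^o)%type)) :
  tracelike f -> conv f f = f ->
  f L * (\dim {:H})%:R = 1 -> forall x : H, S (S x) = x.
Proof.
move=> tf ff fL.
have lf := rop_lin f.
have lS2 : linear (fun x : H => S (S x)) by lin.
have PP x : rop f (rop f x) = rop f x by rewrite rop_rop ff.
have SP x : S (S (rop f x)) = rop f (S (S x)).
  rewrite /rop !lfun_tlift !sw_anti //; apply: eq_tlift => a b.
  by rewrite !linearZ /= S2u tf mulrA mulVr // mul1r.
have [a [b [E1 E2 a0 b0]]] := tr_involution ch0 lS2 (@lin_id _ H) anti4_id
  (fun x => erefl) (fun x => erefl).
have [a' [b' [E1' _ _ _]]] := tr_involution ch0 lS2 lf anti4_id PP SP.
rewrite tr_id in E2.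
have E : a%:R - b%:R = (a + b)%:R * (a'%:R - b'%:R) :> K.
  by rewrite -E1' (tr_anti2_rop hL anti4_id f) -E2 mulrCA (mulrC _ (f L)) fL mulr1 E1.
have ab : a%:R - b%:R != 0 :> K.
  apply: contraNneq lam1_neq0 => e0; rewrite lamE -[X in _ == X]e0 -E1.
  by apply/eqP/eq_tr => x; rewrite mulr1.
(* In characteristic 0 the relation can be read in the integers. *)
have Eint : a%:Z - b%:Z = (a%:Z + b%:Z) * (a'%:Z - b'%:Z).
  apply/eqP; rewrite -subr_eq0 -(intr0_eq0 ch0) rmorphB rmorphM !rmorphB rmorphD /=.
  by rewrite subr_eq0 E natrD.
have nab : a != b by apply: contraNneq ab => ->; rewrite subrr.
have na0 : a != 0%N.
  apply/eqP => /a0/(_ 1); rewrite !anti1 => /eqP.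
  by rewrite -addr_eq0 -mulr2n -scaler_nat scaler_eq0 natr0_eq0 // oner_eq0.
apply: b0; move: (a'%:Z - b'%:Z) Eint => m Em; clear -Em nab na0.
have [m0|m0|m0] := ltgtP m 0; last by move: Em; rewrite m0 mulr0; lia.
  have : (a%:Z + b%:Z) * m <= (a%:Z + b%:Z) * (- 1) by rewrite ler_wpM2l //; lia.
  by rewrite -Em; lia.
have : (a%:Z + b%:Z) * 1 <= (a%:Z + b%:Z) * m by rewrite ler_wpM2l //; lia.
by rewrite -Em; lia.
Qed.

End AntipodeSquare.

(** * Integrals of involutive Hopf algebras *)

Section Involutive.
Variables (K : fieldType) (H : hopfType K) (L : H).
Hypothesis ch0 : [pchar K] =i pred0.
Hypothesis hL : idempotent_integral L.
Hypothesis S2 : forall h : H, S (S h) = h.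
Implicit Types (p q : 'Hom(H, (K^o)%type)) (x h : H) (V : vectType K).

(** An involutive antipode also inverts the identity for the opposite
    product. *)
Lemma sw_antil_op V (G : H -> V) h : linear G ->
  (Σ[a, b <- Δ h] G (S b * a)) = (ε h : K) *: G 1.
Proof.
move=> lG; rewrite -[X in G X]anti1 -(sw_antil (G := fun x => G (S x))) //.
by apply: eq_tlift => a b; rewrite antiM S2.
Qed.

Lemma sw_antir_op V (G : H -> V) h : linear G ->
  (Σ[a, b <- Δ h] G (b * S a)) = (ε h : K) *: G 1.
Proof.
move=> lG; rewrite -[X in G X]anti1 -(sw_antir (G := fun x => G (S x))) //.
by apply: eq_tlift => a b; rewrite antiM S2.
Qed.

Lemma lam1_dim : lam H 1 = (\dim {:H})%:R.
Proof.
rewrite lamE -[RHS](tr_id H : _ = (_ : K^o)).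
by apply: eq_tr => x; rewrite S2 mulr1.
Qed.

Lemma dim_neq0 : (\dim {:H})%:R != 0 :> K.
Proof.
by rewrite natr0_eq0 // dimv_eq0; apply/eqP => /(congr1 (fun V : {vspace H} => (1 : H) \in V));
  rewrite memvf memv0 oner_eq0.
Qed.

Lemma modg1 : modg L = 1.
Proof.
have := lam_mod hL 1; rewrite sw_one // => /eqP.
rewrite -subr_eq0 -scalerBr scaler_eq0 lam1_dim (negPf dim_neq0) /= subr_eq0.
by move/eqP.
Qed.

Lemma lamC x y : lam H (x * y) = lam H (y * x).
Proof. by rewrite (lam_twist hL) S2. Qed.

Lemma lam_intl h : (Σ[a, b <- Δ h] (lam H b : K) *: a) = (lam H h : K) *: 1.
Proof. by rewrite (lam_mod hL) modg1. Qed.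

(** As lam is now an integral on both sides, Σ lam(S(x) L_2) L_1 = x as well as
    Σ lam(S(x) L_1) L_2 = x; substituting one into the other exchanges the
    components. *)
Lemma int_cocomm V (F : H -> H -> V) : bilin F ->
  (Σ[a, b <- Δ L] F a b) = Σ[a, b <- Δ L] F b a.
Proof.
move=> bF.
have recr x : (Σ[a, b <- Δ L] (lam H (S x * b) : K) *: a) = x.
  rewrite (sw_int_shift hL _ (F := fun a b => (lam H b : K) *: a)) //.
  under eq_tlift => a b do rewrite S2 scalerAr.
  by rewrite -mul_tlift lam_intl (lam_L hL) scale1r mulr1.
transitivity (Σ[a, b <- Δ L] Σ[c, d <- Δ L] (lam H (S b * d) : K) *: F a c).
  apply: eq_tlift => a b; rewrite -{1}[b]recr tlift_out //.
  by apply: eq_tlift => c d; rewrite linZ.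
rewrite tlift_exchange; apply: eq_tlift => c d.
rewrite -[in RHS](lam_recl' hL d) (tlift_out (g := fun z => F z c)) //.
by apply: eq_tlift => a b; rewrite (linZ (f := fun z => F z c)).
Qed.

Lemma anti_L : S L = L.
Proof.
have lSL : L * S L = S L.
  by rewrite -{1}[L]S2 -antiM (intR hL) coun_anti (coun_int hL) scale1r.
by rewrite -lSL (intR hL) coun_anti (coun_int hL) scale1r.
Qed.

Lemma hitE q : hit L q = Σ[a, b <- Δ L] (q a : K) *: b.
Proof. by []. Qed.

Lemma hitE' q : hit L q = Σ[a, b <- Δ L] (q b : K) *: a.
Proof. by rewrite hitE int_cocomm. Qed.

Lemma hit_lam x : hit L (linfun (fun y => lam H (S x * y))) = x.
Proof.
rewrite hitE -[RHS](lam_recl hL); apply: eq_tlift => a b.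
by rewrite lfunE_lin.
Qed.

Lemma rop_hit p q : rop q (hit L p) = hit L (conv q p).
Proof.
rewrite !hitE' /rop lfun_tlift tlift_tlift.
under eq_tlift => a b do rewrite linearZ /= linZ // scale_tlift.
rewrite (sw_assoc (F := fun a c b => (p b : K) *: ((q c : K) *: a))) //.
apply: eq_tlift => a t; rewrite conv_sw tlift_scale; apply: eq_tlift => b c.
by rewrite scalerA mulrC.
Qed.

(** Moving x across the coproduct of L by the antipode, from the right and from
    the left, leaves q(a S(x)) and q(S(x) a) respectively. *)
Lemma hit_central q x : tracelike q ->
  hit L q * x = x * hit L q.
Proof.
move=> tq; rewrite hitE mul_tlift tlift_mul.
rewrite -[x in LHS]S2.
under eq_tlift => a b do rewrite -scalerAl.
rewrite -(sw_int_shiftr hL (S x) (F := fun a b => (q a : K) *: b)) //.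
under [RHS]eq_tlift => a b do rewrite -scalerAr.
rewrite (sw_int_shift hL x (F := fun a b => (q a : K) *: b)) //.
by apply: eq_tlift => a b; rewrite tq.
Qed.

Lemma anti_hit q : S (hit L q) = hit L (linfun (fun x => q (S x))).
Proof.
rewrite hitE lfun_tlift hitE' -{2}anti_L sw_anti; last by lin.
by apply: eq_tlift => a b; rewrite linearZ lfunE_lin // S2.
Qed.

Lemma tr_rop q : tr (rop q) = (\dim {:H})%:R * q L :> K.
Proof.
have S4 (a : H) : S (S (S (S a))) = a by rewrite !S2.
have := tr_anti2_rop hL S4 q.
rewrite (eq_tr (g := rop q)) => [->|x]; last by rewrite S2.
by rewrite -(tr_id H); congr (_ * _); apply: eq_tr => x; rewrite S2.
Qed.

(** The conjugacy class is the image of the translation by p, an idempotent,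
    so its dimension is the trace given by tr_rop. *)
Lemma dim_conjugacy_class p : conv p p = p ->
  (\dim (conjugacy_class L p))%:R = (\dim {:H})%:R * p L :> K.
Proof.
move=> pp; rewrite -tr_rop.
have PP x : rop p (rop p x) = rop p x by rewrite rop_rop pp.
rewrite (tr_idem (rop_lin p) PP); congr (\dim _)%:R.
apply/eqP; rewrite eqEsubv; apply/andP; split; apply/subvP => h.
  case/conjugacy_classP => q ->; rewrite -rop_hit -(lfunE_lin (rop_lin p)).
  by rewrite memv_img ?memvf.
case/memv_imgP => x _ ->; apply/conjugacy_classP.
exists (linfun (fun y => lam H (S x * y))).
by rewrite -rop_hit hit_lam lfunE_lin //; apply: rop_lin.
Qed.

End Involutive.

(** * Operators attached to an R-matrix *)

Section YetterDrinfeld.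
Variables (K : fieldType) (H : hopfType K) (r : H ⊗ H).
Hypothesis hr : universal_R_matrix r.
Hypothesis S2 : forall h : H, S (S h) = h.
Implicit Types (p q : 'Hom(H, (K^o)%type)) (x h : H) (V : vectType K).

Variables (M : vectType K) (act : H -> M -> M) (delta : M -> H ⊗ M).
Hypotheses (lact : bilin act) (ldelta : linear delta).
Hypothesis actM : forall x y m, act (x * y) m = act x (act y m).
Hypothesis deltaA : forall V (F : H -> H -> M -> V) m, trilin F ->
  (Σ[x, m1 <- delta m] Σ[a, b <- Δ x] F a b m1)
  = Σ[a, m1 <- delta m] Σ[b, m2 <- delta m1] F a b m2.
Hypothesis delta_act : forall V (F : H -> M -> V) h m, bilin F ->
  tlift F (delta (act h m)) = Σ[h1, t <- Δ h] Σ[h2, h3 <- Δ t]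
    Σ[x, m1 <- delta m] F (h1 * x * S h3) (act h2 m1).

(** The functional q acts through the R-matrix on a module M with a coaction
    delta.  The compatibility delta_act is that of Yetter-Drinfeld modules. *)
Definition theta q m : M :=
  Σ[a, b <- r] Σ[x, m1 <- delta m] (q (a * x) : K) *: act b m1.

Lemma theta_lin q : linear (theta q).
Proof. by rewrite /theta; lin. Qed.

(** The coproduct of h is commuted past R, which leaves only a conjugation
    inside q. *)
Lemma theta_act q h m :
  theta q (act h m) = Σ[h1, t <- Δ h] Σ[h2, h3 <- Δ t]
    act h1 (theta (linfun (fun y => q (h2 * y * S h3))) m).
Proof.
have lq h2 h3 : linear (fun y => q (h2 * y * S h3)) by lin.
transitivity (Σ[t, h3 <- Δ h] Σ[a, b <- r] Σ[h1, h2 <- Δ t] Σ[x, m1 <- delta m]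
    (q (a * h1 * x * S h3) : K) *: act (b * h2) m1).
  rewrite tlift_exchange /theta; apply: eq_tlift => a b.
  rewrite delta_act // sw_assoc //; apply: eq_tlift => h1 t.
  apply: eq_tlift => h2 h3; apply: eq_tlift => x m1.
  by rewrite actM !mulrA.
under eq_tlift => t h3 do rewrite (sw_R_comm hr _ (F := fun a b =>
  Σ[x, m1 <- delta m] (q (a * x * S h3) : K) *: act b m1)) //.
under eq_tlift => t h3 do rewrite tlift_exchange.
rewrite sw_assoc //; apply: eq_tlift => h1 t; apply: eq_tlift => h2 h3.
rewrite /theta (tlift_out (g := act h1)) //; apply: eq_tlift => a b.
rewrite (tlift_out (g := act h1)) //; apply: eq_tlift => x m1.
by rewrite lfunE_lin // linZ // actM !mulrA.
Qed.

(** For tracelike q the conjugation in theta_act disappears. *)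
Lemma theta_comm q h m : tracelike q ->
  theta q (act h m) = act h (theta q m).
Proof.
move=> tq; rewrite theta_act.
have lq h2 h3 : linear (fun y => q (h2 * y * S h3)) by lin.
rewrite -(sw_counitr (G := fun z => act z (theta q m)) h); last first.
  by move=> a u v; rewrite (bilinl _ lact).
apply: eq_tlift => h1 t.
under eq_tlift => h2 h3.
  rewrite (_ : theta _ m = Σ[a, b <- r] Σ[x, m1 <- delta m]
    (q (S h3 * h2 * (a * x)) : K) *: act b m1); last first.
    apply: eq_tlift => a b; apply: eq_tlift => x m1.
    by rewrite lfunE_lin // tq !mulrA.
  over.
rewrite (sw_antil_op S2 (G := fun z => act h1 (Σ[a, b <- r] Σ[x, m1 <- delta m]
    (q (z * (a * x)) : K) *: act b m1))) //.
congr (_ *: act _ _); apply: eq_tlift => a b; apply: eq_tlift => x m1.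
by rewrite mul1r.
Qed.

(** By theta_comm the second operator may be moved inside the first.  The two
    copies of R are then those in the expansion of Δ ⊗ id on R, and the two
    coactions come from one coproduct. *)
Lemma theta_conv p q m : tracelike p ->
  theta p (theta q m) = theta (conv q p) m.
Proof.
move=> tp; have lp := theta_lin p.
transitivity (Σ[a, b <- r] Σ[c, d <- r] Σ[x, m1 <- delta m] Σ[y, m2 <- delta m1]
    (q (a * x) : K) *: ((p (c * y) : K) *: act (b * d) m2)).
  rewrite {2}/theta tlift_out //; apply: eq_tlift => a b.
  rewrite tlift_out // [RHS]tlift_exchange; apply: eq_tlift => x m1.
  rewrite linZ // theta_comm // /theta (tlift_out (g := act b)) // scale_tlift.
  apply: eq_tlift => c d; rewrite (tlift_out (g := act b)) // scale_tlift.
  by apply: eq_tlift => y m2; rewrite linZ // actM.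
rewrite -(sw_R_l hr (F := fun a c bd => Σ[x, m1 <- delta m] Σ[y, m2 <- delta m1]
   (q (a * x) : K) *: ((p (c * y) : K) *: act bd m2))) //.
rewrite /theta; apply: eq_tlift => a b.
under eq_tlift => a1 a2 do rewrite -deltaA //.
rewrite tlift_exchange; apply: eq_tlift => z m1.
rewrite conv_sw sw_mul // tlift_scale; apply: eq_tlift => a1 a2.
by rewrite tlift_scale; apply: eq_tlift => x y; rewrite scalerA.
Qed.

End YetterDrinfeld.

(** * The adjoint module *)

Section Adjoint.
Variables (K : fieldType) (H : hopfType K) (r : H ⊗ H).
Hypothesis hr : universal_R_matrix r.
Hypothesis S2 : forall h : H, S (S h) = h.
Implicit Types (p q e : 'Hom(H, (K^o)%type)) (x h : H) (V : vectType K).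

(** The adjoint action, for which the coproduct is a compatible coaction
    (adj_delta). *)
Definition adj x h : H := Σ[a, b <- Δ x] (a * h * S b).

Lemma adj_bilin : bilin adj.
Proof. by rewrite /adj; lin. Qed.
#[local] Hint Resolve adj_bilin : sweedler.

Lemma adjM x y h : adj (x * y) h = adj x (adj y h).
Proof.
rewrite /adj sw_mul //; apply: eq_tlift => a b.
rewrite mul_tlift tlift_mul; apply: eq_tlift => c d.
by rewrite antiM !mulrA.
Qed.

Lemma adj1 h : adj 1 h = h.
Proof. by rewrite /adj sw_one // anti1 mul1r mulr1. Qed.

Lemma adj_delta V (F : H -> H -> V) h m : bilin F ->
  tlift F (Δ (adj h m)) = Σ[h1, t <- Δ h] Σ[h2, h3 <- Δ t]
    Σ[x, m1 <- Δ m] F (h1 * x * S h3) (adj h2 m1).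
Proof.
move=> bF.
transitivity (Σ[a1, t <- Δ h] Σ[a2, b <- Δ t] Σ[b1, b2 <- Δ b]
    Σ[x, m1 <- Δ m] F (a1 * x * S b2) (a2 * m1 * S b1)).
  rewrite -sw_assoc; last by lin.
  rewrite /adj !lfun_tlift tlift_tlift; apply: eq_tlift => a b.
  rewrite !sw_mul //; apply: eq_tlift => a1 a2.
  by rewrite tlift_exchange sw_anti.
apply: eq_tlift => a1 t; rewrite -sw_assoc; last by lin.
apply: eq_tlift => h2 h3; rewrite tlift_exchange; apply: eq_tlift => x m1.
by rewrite /adj tlift_out.
Qed.

Lemma trace_adj e x h : tracelike e ->
  e (adj x h) = ε x * e h.
Proof.
move=> te; rewrite /adj lfun_tlift.
under eq_tlift => a b do rewrite te mulrA.
by rewrite (sw_antil_op S2 (G := fun z => e (z * h))) // mul1r.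
Qed.

Lemma rop_adj e x h : tracelike e ->
  rop e (adj x h) = adj x (rop e h).
Proof.
move=> te; rewrite /rop adj_delta // (tlift_out (g := adj x)) //.
under eq_tlift => x1 t.
  under eq_tlift => x2 x3.
    under eq_tlift => h1 h2 do rewrite trace_adj // -scalerA.
    rewrite -scale_tlift; over.
  rewrite (sw_counitl (G := fun z => Σ[h1, h2 <- Δ h] (e h2 : K) *: (x1 * h1 * S z))) //.
  over.
rewrite tlift_exchange; apply: eq_tlift => h1 h2.
rewrite (linZ (f := adj x)) //.
by rewrite -(tlift_out (fun a b => a * h1 * S b) (g := fun z : H => (e h2 : K) *: z)).
Qed.

Local Notation Th q := (theta r adj Δ q).

(** Split the adjoint action of R^2 into left and right factors, commute one
    past the coproduct of h, and use that q is tracelike: the two copies of R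
    collapse by the antipode. *)
Lemma theta_adj_rop q h : tracelike q ->
  Th q h = rop q h.
Proof.
move=> tq.
pose G y z := Σ[x, h' <- Δ h] (q (h' * y) : K) *: (x * z).
have bG : bilin G by rewrite /G; lin.
transitivity (Σ[a, b <- r] Σ[c, d <- r] G (a * c) (b * S d)).
  rewrite /theta; transitivity (Σ[a, b <- r] Σ[b1, b2 <- Δ b] Σ[x, h' <- Δ h]
      (q (a * x) : K) *: (b1 * h' * S b2)).
    apply: eq_tlift => a b; rewrite tlift_exchange; apply: eq_tlift => x h'.
    by rewrite /adj scale_tlift.
  rewrite (sw_R_r hr (F := fun a b1 b2 => Σ[x, h' <- Δ h]
      (q (a * x) : K) *: (b1 * h' * S b2))) //.
  rewrite [RHS]tlift_exchange; apply: eq_tlift => a b.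
  under eq_tlift => c d do under eq_tlift => x h' do rewrite -!mulrA.
  transitivity (Σ[c, d <- r] Σ[x, h' <- Δ h]
      (q (a * (c * x)) : K) *: (d * h' * S b)).
    apply: eq_tlift => c d; apply: eq_tlift => x h'; by rewrite !mulrA.
  rewrite (sw_R_comm hr _ (F := fun y z => (q (a * y) : K) *: (z * S b))) //.
  apply: eq_tlift => c d; rewrite /G; apply: eq_tlift => x h'.
  by rewrite tq !mulrA.
rewrite -(sw_R_r hr (F := fun y d b => G y (b * S d))); last by lin.
under eq_tlift => a b do rewrite (sw_antir_op S2 (G := G a)) //.
rewrite (eq_tlift (G := fun a b => G ((ε b : K) *: a) 1)) => [|a b]; last first.
  by rewrite (linZ (f := fun z => G z 1)).
rewrite -(tlift_out (fun a b => (ε b : K) *: a) (g := fun z => G z 1)) //.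
rewrite (sw_R_counit hr) /G /rop; apply: eq_tlift => x h'.
by rewrite !mulr1.
Qed.

Definition cidx i : 'Hom(H, (K^o)%type) := linfun (fun x : H => (v2r x 0 i : K^o)).

Lemma cidxE i x : cidx i x = v2r x 0 i.
Proof. by rewrite lfunE_lin // => a u v; rewrite linearP !mxE. Qed.

(** The element representing q ↦ Tr(theta q ∘ rop e), see part_trE. *)
Definition part_tr e : H :=
  \sum_i tr (fun m => Th (cidx i) (rop e m)) *: tbase i.

Lemma part_trE e q : q (part_tr e) = tr (fun m => Th q (rop e m)).
Proof.
rewrite linear_sum.
transitivity (\sum_i tr (fun m => (q (tbase i) : K) *: Th (cidx i) (rop e m)) : K^o).
  by apply: eq_bigr => i _; rewrite linearZ trZ [LHS]mulrC.
rewrite -tr_sum; apply: eq_tr => m; rewrite /theta.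
under eq_bigr => i _ do rewrite scale_tlift.
rewrite -tlift_sum; apply: eq_tlift => a b.
under eq_bigr => i _ do rewrite scale_tlift.
rewrite -tlift_sum; apply: eq_tlift => x m1.
under eq_bigr => i _ do rewrite scalerA.
rewrite -scaler_suml; congr (_ *: _).
rewrite {2}[a * x]tbaseE linear_sum; apply: eq_bigr => i _.
by rewrite linearZ cidxE [LHS]mulrC.
Qed.

(** The operator theta q ∘ rop e is conjugated by the adjoint action when q is
    (theta_act), and traces are invariant under this; so part_tr e is
    ad-invariant, that is central. *)
Lemma part_tr_central e h : tracelike e ->
  part_tr e * h = h * part_tr e.
Proof.
move=> te.
have lqq q h1 h2 : linear (fun y => q (h1 * y * S h2)) by lin.
have ad_inv x : adj x (part_tr e) = (ε x : K) *: part_tr e.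
  apply: dual_ext => q; rewrite /adj lfun_tlift linearZ /=.
  transitivity (Σ[a, b <- Δ x]
      (tr (fun m => Th (linfun (fun y => q (a * y * S b))) (rop e m)) : K^o)).
    by apply: eq_tlift => a b; rewrite -part_trE lfunE_lin.
  rewrite part_trE -tr_tlift.
  have lT : linear (Th q) by apply: theta_lin.
  have le := rop_lin e.
  transitivity (tr (fun m => Σ[x0, x1 <- Δ x] adj (S x0) (Th q (adj x1 (rop e m))))).
    apply: eq_tr => m.
    under [RHS]eq_tlift => x0 x1.
      rewrite (theta_act hr adj_bilin adjM adj_delta) (tlift_out (g := adj (S x0))) //.
      under eq_tlift => h1 t.
        rewrite (tlift_out (g := adj (S x0))) //.
        under eq_tlift => h2 h3 do rewrite -adjM.
        over.
      over.
    rewrite -sw_assoc //; under [RHS]eq_tlift => v t do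
      rewrite (sw_antil (G := fun z => Σ[h2, h3 <- Δ t]
        adj z (Th (linfun (fun y => q (h2 * y * S h3))) (rop e m)))) //.
    rewrite (sw_counitl (G := fun t => Σ[h2, h3 <- Δ t]
        adj 1 (Th (linfun (fun y => q (h2 * y * S h3))) (rop e m)))) //.
    by apply: eq_tlift => a b; rewrite adj1.
  rewrite tr_tlift.
  have cyc x0 x1 : tr (fun m => adj (S x0) (Th q (adj x1 (rop e m))))
      = tr (fun m => adj (x1 * S x0) (Th q (rop e m))).
    rewrite (eq_tr (g := fun m => adj (S x0) (Th q (rop e (adj x1 m))))); last first.
      by move=> m; rewrite rop_adj.
    rewrite (trC (f := adj x1) (g := fun m => adj (S x0) (Th q (rop e m)))) //.
    by apply: eq_tr => m; rewrite adjM.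
  under eq_tlift => x0 x1 do rewrite cyc.
  rewrite -tr_tlift; transitivity (tr (fun m => (ε x : K) *: Th q (rop e m)));
    last exact: trZ.
  apply: eq_tr => m.
  by rewrite (sw_antir_op S2 (G := fun z => adj z (Th q (rop e m)))) // adj1.
transitivity (Σ[a, b <- Δ h] ((ε a : K) *: (part_tr e * b))).
  by rewrite (sw_counitl (G := fun b => part_tr e * b)).
transitivity (Σ[a, b <- Δ h] (adj a (part_tr e) * b)).
  by apply: eq_tlift => a b; rewrite ad_inv -scalerAl.
rewrite /adj; under eq_tlift => a b do rewrite tlift_mul.
rewrite sw_assoc //; under eq_tlift => a t.
  under eq_tlift => b c do rewrite -mulrA.
  rewrite (sw_antil (G := fun z => a * part_tr e * z)) // mulr1; over.
by rewrite (sw_counitr (G := fun a => a * part_tr e)).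
Qed.

End Adjoint.

(** * The tensor square of the adjoint module *)

Section TensorSquare.
Variables (K : fieldType) (H : hopfType K) (r : H ⊗ H).
Hypothesis hr : universal_R_matrix r.
Hypothesis S2 : forall h : H, S (S h) = h.
Implicit Types (p q e f : 'Hom(H, (K^o)%type)) (x h : H) (V : vectType K).

#[local] Hint Resolve adj_bilin : sweedler.

(** The diagonal adjoint action on H ⊗ H. *)
Definition act2 x (m : H ⊗ H) : H ⊗ H :=
  Σ[a, b <- m] Σ[x1, x2 <- Δ x] (adj x1 a ⊗ adj x2 b).

(** The codiagonal coaction on H ⊗ H. *)
Definition delta2 (m : H ⊗ H) : H ⊗ (H ⊗ H)%type :=
  Σ[a, b <- m] Σ[a1, a2 <- Δ a] Σ[b1, b2 <- Δ b] ((a1 * b1) ⊗ (a2 ⊗ b2)).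

Lemma act2_bilin : bilin act2.
Proof. by rewrite /act2; lin. Qed.

Lemma delta2_lin : linear delta2.
Proof. by rewrite /delta2; lin. Qed.

#[local] Hint Resolve act2_bilin delta2_lin : sweedler.

Lemma act2_tens x a b :
  act2 x (a ⊗ b) = Σ[x1, x2 <- Δ x] (adj x1 a ⊗ adj x2 b).
Proof. by rewrite /act2 tlift_tens. Qed.

Lemma delta2_tens V (F : H -> H ⊗ H -> V) a b : bilin F ->
  tlift F (delta2 (a ⊗ b))
  = Σ[a1, a2 <- Δ a] Σ[b1, b2 <- Δ b] F (a1 * b1) (a2 ⊗ b2).
Proof.
move=> bF; rewrite /delta2 tlift_tens // tlift_tlift; apply: eq_tlift => a1 a2.
rewrite tlift_tlift; apply: eq_tlift => b1 b2.
by rewrite tlift_tens.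
Qed.

Lemma act2M x y m : act2 (x * y) m = act2 x (act2 y m).
Proof.
apply: (tens_ext (f := act2 (x * y)) (g := fun m => act2 x (act2 y m))) m => // a b.
rewrite !act2_tens sw_mul // (tlift_out (g := act2 x)) // tlift_exchange.
apply: eq_tlift => y1 y2; rewrite act2_tens; apply: eq_tlift => x1 x2.
by rewrite !adjM.
Qed.

Lemma delta2A V (F : H -> H -> H ⊗ H -> V) m : trilin F ->
  (Σ[x, m1 <- delta2 m] Σ[a, b <- Δ x] F a b m1)
  = Σ[a, m1 <- delta2 m] Σ[b, m2 <- delta2 m1] F a b m2.
Proof.
move=> tF; apply: (tens_ext
  (f := fun m => Σ[x, m1 <- delta2 m] Σ[a, b <- Δ x] F a b m1)
  (g := fun m => Σ[a, m1 <- delta2 m] Σ[b, m2 <- delta2 m1] F a b m2)) m => // a b.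
rewrite !delta2_tens //.
transitivity (Σ[t, a3 <- Δ a] Σ[a1, a2 <- Δ t] Σ[s, b3 <- Δ b] Σ[b1, b2 <- Δ s]
    F (a1 * b1) (a2 * b2) (a3 ⊗ b3)).
  apply: eq_tlift => t a3; rewrite [RHS]tlift_exchange.
  by apply: eq_tlift => s b3; rewrite sw_mul.
rewrite sw_assoc //; apply: eq_tlift => a1 t.
rewrite [RHS](_ : _ = Σ[a2, a3 <- Δ t] Σ[b1, s <- Δ b] Σ[b2, b3 <- Δ s]
    F (a1 * b1) (a2 * b2) (a3 ⊗ b3)).
  by apply: eq_tlift => a2 a3; rewrite sw_assoc.
rewrite [RHS]tlift_exchange; apply: eq_tlift => b1 s.
by rewrite delta2_tens.
Qed.

(** In the coproducts of the two factors the inner components of h meet as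
    S(p_3) q_1 and cancel. *)
Lemma delta2_act V (F : H -> H ⊗ H -> V) h m : bilin F ->
  tlift F (delta2 (act2 h m)) = Σ[h1, t <- Δ h] Σ[h2, h3 <- Δ t]
    Σ[x, m1 <- delta2 m] F (h1 * x * S h3) (act2 h2 m1).
Proof.
move=> bF; apply: (tens_ext (f := fun m => tlift F (delta2 (act2 h m)))
  (g := fun m => Σ[h1, t <- Δ h] Σ[h2, h3 <- Δ t]
    Σ[x, m1 <- delta2 m] F (h1 * x * S h3) (act2 h2 m1))) m => // a b.
rewrite act2_tens (tlift_out (g := fun m => tlift F (delta2 m))) //.
pose G (p1 p2 z q2 q3 : H) := Σ[x, a' <- Δ a] Σ[y, b' <- Δ b]
  F (p1 * x * (z * y) * S q3) (adj p2 a' ⊗ adj q2 b').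
transitivity (Σ[h1, h2 <- Δ h] Σ[p1, t <- Δ h1] Σ[p2, p3 <- Δ t]
    Σ[q1, s <- Δ h2] Σ[q2, q3 <- Δ s] G p1 p2 (S p3 * q1) q2 q3).
  apply: eq_tlift => h1 h2; rewrite delta2_tens //.
  rewrite (adj_delta h1 a (F := fun y1 y2 => Σ[z1, z2 <- Δ (adj h2 b)]
    F (y1 * z1) (y2 ⊗ z2))) //.
  apply: eq_tlift => p1 t; apply: eq_tlift => p2 p3.
  under eq_tlift => x a' do rewrite (adj_delta h2 b
    (F := fun z1 z2 => F (p1 * x * S p3 * z1) (adj p2 a' ⊗ z2))) //.
  rewrite tlift_exchange; apply: eq_tlift => q1 s.
  rewrite tlift_exchange; apply: eq_tlift => q2 q3.
  by apply: eq_tlift => x a'; apply: eq_tlift => y b'; rewrite !mulrA.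
transitivity (Σ[h1, t <- Δ h] Σ[h2, h3 <- Δ t] Σ[c, d <- Δ h2] G h1 c 1 d h3).
  have G1 (p2 z q2 q3 : H) : linear (fun p1 : H => G p1 p2 z q2 q3) by rewrite /G; lin.
  have G2 (p1 z q2 q3 : H) : linear (fun p2 : H => G p1 p2 z q2 q3) by rewrite /G; lin.
  have G3 (p1 p2 q2 q3 : H) : linear (fun z : H => G p1 p2 z q2 q3) by rewrite /G; lin.
  have G4 (p1 p2 z q3 : H) : linear (fun q2 : H => G p1 p2 z q2 q3) by rewrite /G; lin.
  have G5 (p1 p2 z q2 : H) : linear (fun q3 : H => G p1 p2 z q2 q3) by rewrite /G; lin.
  clearbody G; rewrite sw_assoc; last by lin.
  apply: eq_tlift => p1 v; rewrite sw_assoc; last by lin.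
  rewrite [RHS]sw_assoc; last by lin.
  apply: eq_tlift => p2 w; rewrite -sw_assoc; last by lin.
  under eq_tlift => z s do rewrite (sw_antil
    (G := fun z => Σ[q2, q3 <- Δ s] G p1 p2 z q2 q3)) //.
  by rewrite (sw_counitl (G := fun s => Σ[q2, q3 <- Δ s] G p1 p2 1 q2 q3)).
apply: eq_tlift => h1 t; apply: eq_tlift => h2 h3; rewrite delta2_tens // /G.
rewrite tlift_exchange; apply: eq_tlift => x a'.
rewrite tlift_exchange; apply: eq_tlift => y b'.
rewrite act2_tens (tlift_out (g := F _)) //; apply: eq_tlift => c d.
by rewrite mul1r !mulrA.
Qed.

Local Notation T2 p := (theta r act2 delta2 p).

Lemma theta2_conv p q m : tracelike p ->
  T2 p (T2 q m) = T2 (conv q p) m.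
Proof.
by move=> tp; apply: theta_conv => //; [apply: act2M | apply: delta2A | apply: delta2_act].
Qed.

Lemma delta2_rop V (F : H -> H ⊗ H -> V) e f m : bilin F ->
  tlift F (delta2 (tmap (rop e) (rop f) m))
  = Σ[x, m1 <- delta2 m] F x (tmap (rop e) (rop f) m1).
Proof.
move=> bF; have le := rop_lin e; have lf := rop_lin f.
have lt : linear (tmap (rop e) (rop f)) by rewrite /tmap; lin.
apply: (tens_ext (f := fun m => tlift F (delta2 (tmap (rop e) (rop f) m)))
  (g := fun m => Σ[x, m1 <- delta2 m] F x (tmap (rop e) (rop f) m1))) m => // a b.
rewrite {1}/tmap tlift_tens // !delta2_tens //.
have sw_rop (q : 'Hom(H, (K^o)%type)) (X : vectType K) (G : H -> H -> X) y :
    bilin G -> tlift G (Δ (rop q y)) = Σ[y1, y2 <- Δ y] G y1 (rop q y2).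
  move=> bG; rewrite /rop lfun_tlift tlift_tlift.
  under eq_tlift => c d do rewrite linearZ /= linZ // scale_tlift.
  rewrite (sw_assoc (F := fun y1 y2 d => (q d : K) *: G y1 y2)) //.
  apply: eq_tlift => y1 t; rewrite (tlift_out (g := G y1)) //.
  by apply: eq_tlift => y2 d; rewrite (linZ (f := G y1)).
rewrite sw_rop //; apply: eq_tlift => a1 a2; rewrite sw_rop //.
apply: eq_tlift => b1 b2; rewrite /tmap tlift_tens //.
Qed.

Lemma act2_rop e f x m : tracelike e ->
  tracelike f ->
  act2 x (tmap (rop e) (rop f) m) = tmap (rop e) (rop f) (act2 x m).
Proof.
move=> te tf; have le := rop_lin e; have lf := rop_lin f.
have lt : linear (tmap (rop e) (rop f)) by rewrite /tmap; lin.
apply: (tens_ext (f := fun m => act2 x (tmap (rop e) (rop f) m))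
  (g := fun m => tmap (rop e) (rop f) (act2 x m))) m => // a b.
rewrite {1}/tmap tlift_tens // !act2_tens (tlift_out (g := tmap _ _)) //.
apply: eq_tlift => c d; rewrite /tmap tlift_tens //.
by rewrite !(rop_adj S2).
Qed.

Lemma theta2_rop p e f m : tracelike e ->
  tracelike f ->
  T2 p (tmap (rop e) (rop f) m) = tmap (rop e) (rop f) (T2 p m).
Proof.
move=> te tf; have le := rop_lin e; have lf := rop_lin f.
have lt : linear (tmap (rop e) (rop f)) by rewrite /tmap; lin.
rewrite /theta (tlift_out (g := tmap _ _)) //; apply: eq_tlift => a b.
rewrite delta2_rop // (tlift_out (g := tmap _ _)) //; apply: eq_tlift => x m1.
by rewrite act2_rop // (linZ (f := tmap _ _)).
Qed.

(** Splitting R^1 ⊗ Δ(R^2) as R^1 R'^1 ⊗ R'^2 ⊗ R^2, the operator acts on the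
    first factor through R' and on the second through R, and they communicate
    only by R'^1 a_1.  Expanding this in a basis makes the operator a sum of
    tensor products.  The traces on the first factor assemble into the central
    element part_tr r e, which may be moved next to the argument of p; then
    the operator on the second factor is a translation by theta_adj_rop. *)
Lemma tr_theta2 p e f : tracelike p ->
  tracelike e ->
  tr (fun m => T2 p (tmap (rop e) (rop f) m))
  = tr (rop (conv (linfun (fun y => p (part_tr r e * y))) f)).
Proof.
move=> tp te; have le := rop_lin e; have lf := rop_lin f.
have lr : linear (tmap (rop e) (rop f)) by rewrite /tmap; lin.
(* The operator left on the second factor when z enters from the first. *)
pose B (z w : H) := Σ[a, b <- r] Σ[v1, v2 <- Δ w] (p (a * z * v1) : K) *: adj b v2.
have bB : bilin B by rewrite /B; lin.
have lA i : linear (theta r (@adj K H) Δ (@cidx K H i)) by apply: theta_lin.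
have lT : linear (T2 p) by apply: theta_lin.
transitivity (\sum_i tr (fun m => theta r (@adj K H) Δ (@cidx K H i) (rop e m))
    * tr (fun m => B (tbase i) (rop f m))).
  transitivity (tr (fun m => \sum_i tmap
      (fun m => theta r (@adj K H) Δ (@cidx K H i) (rop e m))
      (fun m => B (tbase i) (rop f m)) m)); last first.
    by rewrite tr_sum; apply: eq_bigr => i _; rewrite tr_tmap.
  apply: eq_tr => m.
  apply: (tens_ext (f := fun m => T2 p (tmap (rop e) (rop f) m))
    (g := fun m => \sum_i tmap
      (fun m => theta r (@adj K H) Δ (@cidx K H i) (rop e m))
      (fun m => B (tbase i) (rop f m)) m)) m => // [|u v].
    by rewrite /tmap; lin.
  rewrite {1}/tmap tlift_tens //.
  under [RHS]eq_bigr => i _ do rewrite /tmap tlift_tens //.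
  move: (rop e u) (rop f v) => {}u {}v.
  transitivity (Σ[a, b <- r] Σ[c, d <- r] Σ[u1, u2 <- Δ u] Σ[v1, v2 <- Δ v]
      (p (a * c * (u1 * v1)) : K) *: (adj d u2 ⊗ adj b v2)).
    rewrite -(sw_R_r hr (F := fun a d b => Σ[u1, u2 <- Δ u] Σ[v1, v2 <- Δ v]
      (p (a * (u1 * v1)) : K) *: (adj d u2 ⊗ adj b v2))) //.
    rewrite /theta; apply: eq_tlift => a b.
    rewrite delta2_tens // [RHS]tlift_exchange; apply: eq_tlift => u1 u2.
    rewrite [RHS]tlift_exchange; apply: eq_tlift => v1 v2.
    by rewrite act2_tens scale_tlift.
  transitivity (Σ[c, d <- r] Σ[u1, u2 <- Δ u] (adj d u2 ⊗ B (c * u1) v)).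
    rewrite tlift_exchange; apply: eq_tlift => c d.
    rewrite tlift_exchange; apply: eq_tlift => u1 u2.
    rewrite /B (tlift_out (g := tens (adj d u2))) //; apply: eq_tlift => a b.
    rewrite (tlift_out (g := tens (adj d u2))) //; apply: eq_tlift => v1 v2.
    by rewrite (linZ (f := tens (adj d u2))) // !mulrA.
  rewrite /theta.
  under [RHS]eq_bigr => i _ do
    rewrite (tlift_out (g := fun z => z ⊗ B (tbase i) v)) //.
  rewrite -tlift_sum; apply: eq_tlift => c d.
  under [RHS]eq_bigr => i _ do
    rewrite (tlift_out (g := fun z => z ⊗ B (tbase i) v)) //.
  rewrite -tlift_sum; apply: eq_tlift => u1 u2.
  rewrite {1}[c * u1]tbaseE (linS (f := fun z => adj d u2 ⊗ B z v)) //.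
  apply: eq_bigr => i _; rewrite cidxE.
  rewrite (linZ (f := fun z => adj d u2 ⊗ B z v)) //.
  by rewrite (linZ (f := fun z => z ⊗ B (tbase i) v)).
transitivity (tr (fun m => B (part_tr r e) (rop f m))).
  transitivity (tr (fun m => \sum_i
      tr (fun m => theta r (@adj K H) Δ (@cidx K H i) (rop e m)) *: B (tbase i) (rop f m))).
    by rewrite tr_sum; apply: eq_bigr => i _; rewrite trZ.
  apply: eq_tr => m; rewrite /part_tr (linS (f := fun z => B z (rop f m))) //.
  by apply: eq_bigr => i _; rewrite (linZ (f := fun z => B z (rop f m))).
apply: eq_tr => m; rewrite -rop_rop.
have lq : linear (fun y => p (part_tr r e * y)) by lin.
have ce := part_tr_central hr S2 _ te.
rewrite -[RHS](theta_adj_rop hr S2) => [|x y]; last first.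
  by rewrite !lfunE_lin // !mulrA ce -mulrA tp -mulrA.
rewrite /theta /B; apply: eq_tlift => a b; apply: eq_tlift => x y.
by rewrite lfunE_lin // mulrA ce.
Qed.

End TensorSquare.

(** * Integrality of the structure constants *)

Section Positivity.
Variables (K : fieldType) (H : hopfType K) (L : H) (r : H ⊗ H).
Hypothesis ch0 : [pchar K] =i pred0.
Hypothesis hL : idempotent_integral L.
Hypothesis hr : universal_R_matrix r.
Hypothesis S2 : forall h : H, S (S h) = h.
Implicit Types (p q e f : 'Hom(H, (K^o)%type)) (V : vectType K).

(** The projection onto the centre, see centre_avg_central, and
    centre_avg_trace for its effect on tracelike functionals. *)
Definition centre_avg (x : H) : H := Σ[a, b <- Δ L] (a * x * S b).

Lemma centre_avg_central x h : centre_avg x * h = h * centre_avg x.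
Proof.
rewrite /centre_avg mul_tlift tlift_mul -[h in LHS]S2.
under eq_tlift => a b do rewrite -mulrA -antiM.
rewrite (sw_int_shift hL _ (F := fun a b => a * x * S b)) //.
by apply: eq_tlift => a b; rewrite S2 !mulrA.
Qed.

Lemma centre_avg_trace q x : tracelike q ->
  q (centre_avg x) = q x.
Proof.
move=> tq; rewrite /centre_avg lfun_tlift.
under eq_tlift => a b do rewrite tq mulrA.
rewrite (sw_antil_op S2 (G := fun z => q (z * x))) // mul1r.
by rewrite (coun_int hL) scale1r.
Qed.

Lemma centre_avg_mul (z x : H) : (forall h : H, z * h = h * z) ->
  centre_avg (z * x) = z * centre_avg x.
Proof.
move=> cz; rewrite /centre_avg mul_tlift; apply: eq_tlift => a b.
by rewrite !mulrA cz.
Qed.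

(** For central z, lam(z x) does not change when x is projected onto the centre,
    and then it is the value at z of a tracelike functional.  As lam is
    non-degenerate, z vanishes. *)
Lemma central_sep (z : H) : (forall h : H, z * h = h * z) ->
  (forall q, tracelike q -> q z = 0) -> z = 0.
Proof.
move=> cz z0; apply: (lam_nondeg hL) => x.
have tl : tracelike (lam H) by apply: (lamC hL S2).
rewrite -(centre_avg_trace _ tl) centre_avg_mul //.
have lq : linear (fun y => lam H (y * centre_avg x)) by lin.
rewrite -(lfunE_lin lq); apply: z0 => a b; rewrite !(lfunE_lin lq).
by rewrite -mulrA -centre_avg_central mulrA tl mulrA.
Qed.

Lemma conv_int p q : conv p q L = p (hit L q).
Proof.
rewrite (hitE' ch0 hL S2) conv_sw lfun_tlift; apply: eq_tlift => a b.
by rewrite linearZ [LHS]mulrC.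
Qed.

(** Both sides are central, and a tracelike q takes the same value on them:
    there theta q is a translation, and tr_rop applies. *)
Lemma part_tr_hit e : tracelike e ->
  part_tr r e = (\dim {:H})%:R *: hit L e.
Proof.
move=> te; apply/eqP; rewrite -subr_eq0; apply/eqP; apply: central_sep => [h|q tq].
  rewrite mulrBl mulrBr -scalerAl -scalerAr (part_tr_central hr S2) //.
  by rewrite (hit_central hL S2).
rewrite linearB linearZ /= part_trE.
rewrite (eq_tr (g := rop (conv q e))) => [|m]; last first.
  by rewrite (theta_adj_rop hr S2) // rop_rop.
by rewrite (tr_rop hL S2) conv_int subrr.
Qed.

(** The translations by e and f in the two factors commute with the operator of
    p, so their composite is idempotent; the left side is its trace, a rank. *)
Lemma class_product_integral p e f : tracelike p ->
  tracelike e ->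
  tracelike f ->
  conv p p = p -> conv e e = e -> conv f f = f ->
  exists N : nat, (\dim {:H})%:R ^+ 2 * p (hit L e * hit L f) = N%:R :> K.
Proof.
move=> tp te tf pp ee ff; have le := rop_lin e; have lf := rop_lin f.
pose T m := theta r (@act2 K H) (@delta2 K H) p (tmap (rop e) (rop f) m).
have lT : linear T.
  have lt : linear (theta r (@act2 K H) (@delta2 K H) p).
    apply: theta_lin; solve [apply: act2_bilin | apply: delta2_lin].
  by rewrite /T /tmap; lin.
exists (\dim (limg (linfun T))); rewrite -(tr_idem lT) => [|m]; last first.
  rewrite /T (theta2_rop r S2) // (theta2_conv hr S2) // pp.
  rewrite -(theta2_rop r S2) //; congr (theta _ _ _ _ _).
  apply: (tens_ext (f := fun m => tmap (rop e) (rop f) (tmap (rop e) (rop f) m))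
    (g := tmap (rop e) (rop f))) m => [||a b].
  - by rewrite /tmap; lin.
  - by rewrite /tmap; lin.
  by rewrite /tmap !tlift_tens // !rop_rop ee ff.
rewrite /T (tr_theta2 hr S2) // (tr_rop hL S2) conv_int lfunE_lin; last by lin.
rewrite part_tr_hit //.
have -> : p ((\dim {:H})%:R *: hit L e * hit L f)
    = (\dim {:H})%:R * p (hit L e * hit L f) by rewrite -scalerAl linearZ.
by rewrite mulrA expr2.
Qed.

End Positivity.

(** * Class sums *)

Section ClassSums.
Variables (K : fieldType) (H : hopfType K) (L : H) (r : H ⊗ H).
Hypothesis ch0 : [pchar K] =i pred0.
Hypothesis hL : idempotent_integral L.
Hypothesis hr : universal_R_matrix r.
Hypothesis S2 : forall h : H, S (S h) = h.
Implicit Types (p q e f : 'Hom(H, (K^o)%type)) (V : vectType K).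
Variables (n : nat) (F : 'I_n.+1 -> 'Hom(H, (K^o)%type)).
Hypothesis F_tr : forall i, tracelike (F i).
Hypothesis F_neq0 : forall i, F i != 0.
Hypothesis F_conv : forall i j, conv (F i) (F j) = if i == j then F i else 0.
Hypothesis F_span : forall q, tracelike q ->
  exists c : 'I_n.+1 -> K, q = \sum_i c i *: F i.
Hypothesis F0 : lam H = (\dim {:H})%:R *: F ord0.

Local Notation d := (\dim {:H}).
Local Notation D l := (\dim (conjugacy_class L (F l))).
Local Notation eta l := (normalized_class_sum L (F l)).

Lemma class_dimE l : (D l)%:R = d%:R * F l L :> K.
Proof. by apply: dim_conjugacy_class => //; rewrite F_conv eqxx. Qed.

(** The class contains L ↼ F_l, which is non-zero by int_sep. *)
Lemma class_dim_gt0 l : (0 < D l)%N.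
Proof.
rewrite lt0n dimv_eq0; apply: contraNneq (F_neq0 l) => C0.
have : hit L (F l) \in conjugacy_class L (F l).
  by apply/conjugacy_classP; exists (F l); rewrite F_conv eqxx.
by rewrite C0 memv0 => /eqP h0; apply/eqP/(int_sep hL).
Qed.

Lemma class_dim_le l : (D l <= d)%N.
Proof. exact: dimvS (subvf _). Qed.

Lemma class_dim0 : D ord0 = 1%N.
Proof.
apply/eqP; rewrite -eqz_nat -subr_eq0 -(intr0_eq0 ch0) rmorphB subr_eq0 /=.
have := congr1 (fun q : 'Hom(H, (K^o)%type) => q L : K) F0.
by rewrite /= (lam_L hL) scale_lfunE => E;
  rewrite -[X in X == _]/((D ord0)%:R) class_dimE; apply/eqP/(esym E).
Qed.

Lemma classK_neq0 l : (D l)%:R != 0 :> K.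
Proof. by rewrite natr0_eq0 // -lt0n class_dim_gt0. Qed.

Lemma etaE l : eta l = (d%:R / (D l)%:R) *: hit L (F l).
Proof.
rewrite /normalized_class_sum /class_sum !hitE mulrC -scalerA; congr (_ *: _).
by rewrite scale_tlift; apply: eq_tlift => a b; rewrite scale_lfunE scalerA.
Qed.

Lemma eta_central l h : eta l * h = h * eta l.
Proof. by rewrite etaE -scalerAl -scalerAr (hit_central hL S2). Qed.

Lemma eta_dual i l : F i (eta l) = (i == l)%:R.
Proof.
rewrite etaE linearZ /= -(conv_int ch0 hL S2) F_conv.
case: eqP => [->|_]; last by rewrite zero_lfunE scaler0.
rewrite /GRing.scale /= mulrAC -class_dimE divff //; exact: classK_neq0.
Qed.

Lemma conv_F q l : tracelike q ->
  conv q (F l) = (q (eta l) : K) *: F l.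
Proof.
case/F_span => c ->.
have -> : (\sum_i c i *: F i) (eta l) = c l :> K.
  rewrite sum_lfunE (bigD1 l) //= big1 => [|i nil].
    by rewrite scale_lfunE eta_dual eqxx addr0 [LHS]mulr1.
  by rewrite scale_lfunE eta_dual (negPf nil) scaler0.
apply/lfunP => x; rewrite conv_sw scale_lfunE.
transitivity (\sum_i c i *: conv (F i) (F l) x).
  under [RHS]eq_bigr => i _ do rewrite conv_sw scale_tlift.
  rewrite -tlift_sum; apply: eq_tlift => a b.
  rewrite sum_lfunE mulr_suml; apply: eq_bigr => i _.
  by rewrite scale_lfunE [RHS]mulrA.
rewrite (bigD1 l) //= F_conv eqxx big1 ?addr0 // => i nil.
by rewrite F_conv (negPf nil) zero_lfunE scaler0.
Qed.

Lemma hit_scale c q : hit L (c *: q) = c *: hit L q.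
Proof.
by rewrite !hitE scale_tlift; apply: eq_tlift => a b; rewrite scale_lfunE scalerA.
Qed.

Lemma rop_eta q l : tracelike q ->
  rop q (eta l) = (q (eta l) : K) *: eta l.
Proof.
move=> tq; rewrite {1}etaE (linZ _ _ (rop_lin q)) (rop_hit ch0 hL S2) conv_F //.
by rewrite hit_scale [X in _ = _ *: X]etaE !scalerA mulrC.
Qed.

Lemma coun_eta l : ε (eta l) = 1.
Proof.
rewrite etaE linearZ /= hitE lfun_tlift.
rewrite (eq_tlift (G := fun a b => (ε b : K) *: F l a)) => [|a b]; last first.
  by rewrite linearZ [LHS]mulrC.
rewrite (sw_counitr (G := fun a => F l a)) // /GRing.scale /= mulrAC -class_dimE.
rewrite divff //; exact: classK_neq0.
Qed.

Lemma tracelike_expand q x : tracelike q ->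
  q x = \sum_i (q (eta i) : K) *: F i x.
Proof.
move=> tq; have [c Ec] := F_span tq.
rewrite [in LHS]Ec sum_lfunE; apply: eq_bigr => i _; rewrite scale_lfunE.
congr (_ *: _); rewrite Ec sum_lfunE (bigD1 i) //= big1 => [|j nji].
  by rewrite scale_lfunE eta_dual eqxx addr0 [RHS]mulr1.
by rewrite scale_lfunE eta_dual (negPf nji) scaler0.
Qed.

(** Both sides have the same coordinates, and tracelike functionals separate
    central elements. *)
Lemma central_expand (z : H) : (forall h : H, z * h = h * z) ->
  z = \sum_i (F i z : K) *: eta i.
Proof.
move=> cz; apply/eqP; rewrite -subr_eq0; apply/eqP.
apply: (central_sep hL S2) => [h|q tq].
  rewrite mulrBl mulrBr cz mulr_suml mulr_sumr; congr (_ - _).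
  by apply: eq_bigr => i _; rewrite -scalerAl -scalerAr eta_central.
rewrite linearB linear_sum /= (tracelike_expand z tq); apply/eqP.
rewrite subr_eq0; apply/eqP; apply: eq_bigr => i _.
by rewrite [RHS]linearZ [LHS]mulrC.
Qed.

Lemma coun_expand x : ε x = \sum_i F i x.
Proof.
rewrite (@tracelike_expand ε) => [|y z]; last by rewrite !counM [LHS]mulrC.
by apply: eq_bigr => i _; rewrite coun_eta scale1r.
Qed.

Lemma anti_central (z : H) : (forall h : H, z * h = h * z) ->
  forall h : H, S z * h = h * S z.
Proof. by move=> cz h; rewrite -[h]S2 -!antiM cz. Qed.

Let FS l := linfun (fun x => F l (S x)) : 'Hom(H, (K^o)%type).

Let FSE l x : FS l x = F l (S x).
Proof. by rewrite lfunE_lin. Qed.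

Let FS_tr l (x y : H) : FS l (x * y) = FS l (y * x).
Proof. by rewrite !FSE !antiM F_tr. Qed.

(** The bracket is Σ a E(S b) over the coproduct of η_l, where E projects onto
    the centre.  Expanding E in class sums turns each coordinate into a
    translation of η_l, of which η_l is an eigenvector. *)
Lemma brace_eta l : brace (eta l) L = eta l * S (eta l).
Proof.
transitivity (Σ[a, b <- Δ (eta l)] (a * centre_avg L (S b))).
  apply: eq_tlift => a b; rewrite /centre_avg mul_tlift; apply: eq_tlift => c e.
  by rewrite !mulrA.
transitivity (Σ[a, b <- Δ (eta l)] \sum_i ((F i (S b) : K) *: a) * eta i).
  apply: eq_tlift => a b.
  rewrite [centre_avg L (S b)]central_expand; last first.
    exact: (centre_avg_central hL S2).
  rewrite mulr_sumr; apply: eq_bigr => i _.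
  by rewrite (centre_avg_trace hL S2) // -scalerAr -scalerAl.
rewrite tlift_sum [S (eta l)]central_expand; last first.
  by apply: anti_central; apply: eta_central.
rewrite mulr_sumr; apply: eq_bigr => i _.
have mulZ c (x y : H) : (c *: x) * y = x * (c *: y).
  by rewrite -scalerAl -scalerAr.
rewrite -tlift_mul -[RHS]mulZ; congr (_ * _).
transitivity (rop (FS i) (eta l)).
  by apply: eq_tlift => a b; rewrite FSE.
by rewrite rop_eta // FSE.
Qed.

(** Pairing with lam inverts q ↦ L ↼ q, up to the antipode. *)
Lemma lam_hit q x : lam H (hit L q * S x) = q x.
Proof.
rewrite (lamC hL S2) (hitE' ch0 hL S2) -[in RHS](lam_recl hL x).
rewrite mul_tlift !lfun_tlift; apply: eq_tlift => a b.
by rewrite -scalerAr !linearZ [LHS]mulrC.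
Qed.

(** F_0 is lam / d, and lam(η_l S(η_l)) is the value of a multiple of F_l at η_l. *)
Lemma brace_eta0 l : F ord0 (eta l * S (eta l)) = (D l)%:R^-1.
Proof.
have d0 : d%:R != 0 :> K by apply: dim_neq0.
have -> : F ord0 = d%:R^-1 *: lam H by rewrite F0 scalerA mulVf // scale1r.
have E : lam H ((d%:R / (D l)%:R *: hit L (F l)) * S (eta l)) = d%:R / (D l)%:R.
  by rewrite -scalerAl [LHS]linearZ /= lam_hit eta_dual eqxx [LHS]mulr1.
by rewrite scale_lfunE {1}etaE E /GRing.scale /= mulrA mulVf // mul1r.
Qed.

(** S(η_l) comes from the functional F_l ∘ S, again a tracelike idempotent, so
    class_product_integral bounds the denominator. *)
Lemma brace_eta_rat i l : exists N : nat,
  F i (eta l * S (eta l)) = N%:R / (D l)%:R ^+ 2.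
Proof.
have idFS : conv (FS l) (FS l) = FS l.
  apply/lfunP => x; rewrite conv_sw FSE -[in RHS](_ : conv (F l) (F l) = F l).
    rewrite conv_sw sw_anti; last by lin.
    by apply: eq_tlift => a b; rewrite !FSE [LHS]mulrC.
  by rewrite F_conv eqxx.
have idF j : conv (F j) (F j) = F j by rewrite F_conv eqxx.
have [N EN] := class_product_integral ch0 hL hr S2 (@F_tr i) (@F_tr l) (@FS_tr l)
  (idF i) (idF l) idFS.
pose c : K := d%:R / (D l)%:R.
have E : F i ((c *: hit L (F l)) * S (c *: hit L (F l)))
    = c ^+ 2 * F i (hit L (F l) * hit L (FS l)).
  by rewrite linearZ /= (anti_hit ch0 hL S2) -scalerAl -scalerAr scalerA linearZ expr2.
by exists N; rewrite -EN etaE E expr_div_n mulrAC.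
Qed.

End ClassSums.

(** * Absorbing walks *)

(** The mass outside the absorbing state is multiplied at each step by at most
    c, a bound for the probability of not being absorbed. *)
Lemma absorbing_walk_converges (R : realType) n (P : 'I_n.+1 -> 'I_n.+1 -> rat)
    (alpha : nat -> 'I_n.+1 -> rat) (c : rat) :
  0 <= c < 1 -> P ord0 ord0 = 1 -> (forall l, 1 - c <= P l ord0) ->
  (forall m i, 0 <= alpha m i) -> (forall m, \sum_i alpha m i = 1) ->
  (forall m i, alpha m.+1 i = \sum_l alpha m l * P l i) ->
  (ratr (alpha m ord0) @[m --> \oo] --> (1 : R))%classic.
Proof.
move=> /andP[c0 c1] P00 Pl0 a0 a1 aS.
have le1 m : alpha m ord0 <= 1.
  by rewrite -(a1 m) (bigD1 ord0) //= lerDl sumr_ge0.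
have bound m : 1 - alpha m ord0 <= c ^+ m.
  elim: m => [|m IHm]; first by rewrite expr0 gerBl.
  apply: le_trans (_ : c * (1 - alpha m ord0) <= _); last first.
    by rewrite exprS ler_wpM2l.
  have -> : 1 - alpha m.+1 ord0 = \sum_(l | l != ord0) alpha m l * (1 - P l ord0).
    rewrite aS -{1}(a1 m) -sumrB (bigD1 ord0) //= P00 mulr1 subrr add0r.
    by apply: eq_bigr => l _; rewrite mulrBr mulr1.
  have -> : 1 - alpha m ord0 = \sum_(l | l != ord0) alpha m l.
    by rewrite -{1}(a1 m) (bigD1 ord0) //= addrAC subrr add0r.
  rewrite mulr_sumr; apply: ler_sum => l _.
  by rewrite [leRHS]mulrC ler_wpM2l // lerBlDr addrC -lerBlDr.
apply: (@squeeze_cvgr _ _ _ _ (fun m => 1 - (ratr c) ^+ m : R) (fun=> 1)).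
- apply: nearW => m; rewrite -(rmorph1 (@ratr R)) -rmorphXn -rmorphB !ler_rat.
  by rewrite le1 lerBlDr addrC -lerBlDr bound.
- suff: (1 - ratr c ^+ m @[m --> \oo] --> (1 - 0 : R))%classic by rewrite subr0.
  apply: cvgB; first exact: cvg_cst.
  by apply: cvg_expr; rewrite ger0_norm ?ler0q // -(rmorph1 (@ratr R)) ltr_rat.
- exact: cvg_cst.
Qed.

(** * The commutator walk *)

Section CommutatorWalk.
Variables (K : fieldType) (H : hopfType K) (L : H) (r : H ⊗ H).
Hypothesis ch0 : [pchar K] =i pred0.
Hypothesis hL : idempotent_integral L.
Hypothesis hr : universal_R_matrix r.
Hypothesis S2 : forall h : H, S (S h) = h.
Variables (n : nat) (F : 'I_n.+1 -> 'Hom(H, (K^o)%type)).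
Hypothesis F_tr : forall i, tracelike (F i).
Hypothesis F_neq0 : forall i, F i != 0.
Hypothesis F_conv : forall i j, conv (F i) (F j) = if i == j then F i else 0.
Hypothesis F_span : forall q : 'Hom(H, (K^o)%type),
  tracelike q ->
  exists c : 'I_n.+1 -> K, q = \sum_i c i *: F i.
Hypothesis F0 : lam H = (\dim {:H})%:R *: F ord0.

Local Notation d := (\dim {:H}).
Local Notation D l := (\dim (conjugacy_class L (F l))).
Local Notation eta := (fun l => normalized_class_sum L (F l)).
Local Notation toK := (ratK ch0).

Lemma eta_coord (a : 'I_n.+1 -> K) i : F i (\sum_j a j *: eta j) = a i.
Proof.
rewrite linear_sum (bigD1 i) //= big1 => [|j nji].
  by rewrite linearZ /= eta_dual // eqxx addr0 [LHS]mulr1.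
by rewrite linearZ /= eta_dual // eq_sym (negPf nji) scaler0.
Qed.

Lemma brace_lin : linear (fun x : H => brace x L).
Proof.
by rewrite (_ : (fun x => _) = fun x => Σ[a, b <- Δ x] Σ[a', b' <- Δ L]
  (a * a' * S b * S b')).
Qed.

Lemma transition_matrix : exists P : 'I_n.+1 -> 'I_n.+1 -> rat,
  [/\ forall l i, 0 <= P l i, forall l, \sum_i P l i = 1,
      forall l, P l ord0 = (D l)%:R^-1
    & forall l, brace (eta l) L = \sum_i toK (P l i) *: eta i].
Proof.
have /choice[N EN] (li : 'I_n.+1 * 'I_n.+1) : exists N : nat,
    F li.2 (eta li.1 * S (eta li.1)) = N%:R / (D li.1)%:R ^+ 2.
  by apply: (brace_eta_rat ch0 hL hr S2).
pose P l i : rat := (N (l, i))%:R / (D l)%:R ^+ 2.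
have PE l i : toK (P l i) = F i (eta l * S (eta l)).
  by rewrite (EN (l, i)) fmorph_div rmorphXn !rmorph_nat.
have cE l (h : H) : eta l * S (eta l) * h = h * (eta l * S (eta l)).
  have c1 := eta_central hL S2 F_tr l.
  by rewrite -mulrA (anti_central S2 c1) mulrA c1 -mulrA.
exists P; split=> [l i|l|l|l].
- by rewrite divr_ge0 ?exprn_ge0 ?ler0n.
- apply: (fmorph_inj toK); rewrite rmorph_sum rmorph1.
  under eq_bigr => i _ do rewrite PE.
  rewrite -(coun_expand ch0 hL S2 F_neq0 F_conv F_span) counM coun_anti coun_eta //.
  exact: mulr1.
- apply: (fmorph_inj toK); rewrite PE brace_eta0 //.
  by rewrite fmorphV rmorph_nat.
rewrite brace_eta // [LHS](central_expand ch0 hL S2 F_tr F_neq0 F_conv F_span);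
  last exact: cE.
by apply: eq_bigr => i _; rewrite PE.
Qed.

Lemma commutator_walk (R : realType) : probabilistically_nilpotent R L F.
Proof.
have [P [P0 P1 Pord0 PE]] := transition_matrix.
have gammaS m (a : 'I_n.+1 -> rat) : gamma L m = \sum_i toK (a i) *: eta i ->
    gamma L m.+1 = \sum_i toK (\sum_l a l * P l i) *: eta i.
  move=> E; rewrite [LHS]/= E (linS (f := fun x : H => brace x L)); last exact: brace_lin.
  under eq_bigr => l _.
    rewrite (linZ (f := fun x : H => brace x L)); last exact: brace_lin.
    rewrite PE scaler_sumr; over.
  rewrite exchange_big; apply: eq_bigr => i _.
  rewrite rmorph_sum scaler_suml; apply: eq_bigr => l _.
  by rewrite rmorphM scalerA.
have inj (a b : 'I_n.+1 -> rat) :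
    \sum_i toK (a i) *: eta i = \sum_i toK (b i) *: eta i -> forall i, a i = b i.
  move=> E i; apply: (fmorph_inj toK).
  rewrite -[LHS](eta_coord (fun j => toK (a j))) E.
  exact: (eta_coord (fun j => toK (b j))).
split=> [m|alpha alphaP].
  have [a [a0 a1 aE]] : exists a : 'I_n.+1 -> rat,
      [/\ forall i, 0 <= a i, \sum_i a i = 1 & gamma L m = \sum_i toK (a i) *: eta i].
    elim: m => [|m [a [a0 a1 aE]]].
      have LE i : toK ((D i)%:R / d%:R) = F i L.
        by rewrite fmorph_div !rmorph_nat class_dimE // mulrAC divff ?mul1r ?dim_neq0.
      exists (fun i => (D i)%:R / d%:R); split=> [i||].
      + by rewrite divr_ge0 ?ler0n.
      + apply: (fmorph_inj toK); rewrite rmorph_sum rmorph1.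
        under eq_bigr => i _ do rewrite LE.
        by rewrite -(coun_expand ch0 hL S2 F_neq0 F_conv F_span) (coun_int hL).
      rewrite [LHS](central_expand ch0 hL S2 F_tr F_neq0 F_conv F_span).
        by apply: eq_bigr => i _; rewrite LE.
      by move=> h; rewrite (intL hL) (intR hL).
    exists (fun i => \sum_l a l * P l i); split; last exact: gammaS.
      by move=> i; apply: sumr_ge0 => l _; rewrite mulr_ge0.
    rewrite exchange_big -[RHS]a1; apply: eq_bigr => l _.
    by rewrite -mulr_sumr P1 mulr1.
  exists a; split=> //; rewrite memv_cap memvf; apply/centvP => h _.
  rewrite aE mulr_suml mulr_sumr; apply: eq_bigr => i _.
  by rewrite -scalerAl -scalerAr eta_central.
have d0 : 0 < d%:R :> rat.
  by rewrite ltr0n lt0n -(natr0_eq0 ch0) dim_neq0.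
apply: (absorbing_walk_converges (P := P) (c := 1 - d%:R^-1)).
- rewrite subr_ge0 invf_le1 // ler1n gtrBl invr_gt0 d0 andbT.
  by rewrite -(ltr0n rat).
- by rewrite Pord0 (class_dim0 ch0 hL S2 F_conv F0) invr1.
- move=> l; rewrite subKr Pord0 lef_pV2 ?posrE ?ler_nat ?class_dim_le //.
  by rewrite ltr0n; apply: class_dim_gt0.
- by move=> m; have [] := alphaP m.
- by move=> m; have [] := alphaP m.
move=> m; apply: inj; have [_ _ _ <-] := alphaP m.+1.
by apply: gammaS; have [_ _ _ ->] := alphaP m.
Qed.

End CommutatorWalk.

(** * The character algebra *)

Section CharacterAlgebra.
Variables (K : fieldType) (H : hopfType K).
Implicit Types (p q f g : 'Hom(H, (K^o)%type)).

Lemma conv_linl q : linear (fun p => conv p q).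
Proof.
move=> c p p'; apply/lfunP => x; rewrite add_lfunE scale_lfunE !conv_sw.
rewrite scale_tlift.
rewrite (tlift_lin (f := fun a b => ((c *: p + p') a : K) * q b : K^o)
  (g := fun a b => (p a * q b : K^o)) (h := fun a b => (p' a * q b : K^o)) (a := c)).
  by rewrite scale_tlift.
by move=> a b; rewrite add_lfunE scale_lfunE mulrDl -mulrA.
Qed.

Lemma convA p q f : conv p (conv q f) = conv (conv p q) f.
Proof.
apply/lfunP => x; rewrite -!(coun_rop (conv _ _)).
by rewrite -!rop_rop.
Qed.

(** p ⊗ q is tracelike on H ⊗ H, so it does not see the conjugation by R that
    flips the coproduct. *)
Lemma convC (r : H ⊗ H) p q : universal_R_matrix r ->
  tracelike p ->
  tracelike q -> conv p q = conv q p.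
Proof.
case=> ru rD _ _ tp tq; apply/lfunP => h; rewrite !conv_sw.
pose phi (t : H ⊗ H) : K^o := Σ[a, b <- t] (p a * q b : K^o).
have phiC s t : phi (s * t) = phi (t * s).
  rewrite /phi !tlift_mulE // tlift_exchange; apply: eq_tlift => a b.
  by apply: eq_tlift => c d; rewrite tp tq.
transitivity (phi (tswap (Δ h))); last first.
  rewrite /phi tlift_tswap //; apply: eq_tlift => a b; exact: mulrC.
by rewrite (rD h : tswap (Δ h) = r * Δ h * r^-1) phiC mulrA mulVr // mul1r.
Qed.

(** The product e = f g is an idempotent with e f = e, so f = e + (f - e) is an
    orthogonal decomposition; primitivity gives e = 0 or e = f, and likewise
    for g. *)
Lemma primitive_orth (r : H ⊗ H) (A : {vspace 'Hom(H, (K^o)%type)}) f g :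
  universal_R_matrix r ->
  (forall q, (q \in A) <-> tracelike q) ->
  primitive_idempotent A f -> primitive_idempotent A g -> f != g -> conv f g = 0.
Proof.
move=> hr Atr [Af _ ff fP] [Ag _ gg gP] fg.
have comm p q : p \in A -> q \in A -> conv p q = conv q p.
  by move=> /Atr tp /Atr tq; apply: convC hr tp tq.
have Aconv : conv f g \in A.
  apply/Atr => x y; have [/Atr tf /Atr tg] := (Af, Ag).
  rewrite !conv_sw !sw_mul // tlift_exchange; apply: eq_tlift => a b.
  by apply: eq_tlift => c d; rewrite tf tg.
pose e := conv f g.
have ee : conv e e = e.
  by rewrite /e -convA [conv g _]comm // -convA gg convA ff.
have split_prim h : h \in A -> conv h h = h -> conv e h = e ->
    (forall f g, f \in A -> g \in A -> conv f f = f -> conv g g = g ->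
        conv f g = 0 -> conv g f = 0 -> h = f + g -> f = 0 \/ g = 0) ->
    e = 0 \/ h = e.
  move=> Ah hh eh hP.
  have convB p q k : conv (p - q) k = conv p k - conv q k.
    by rewrite -scaleN1r addrC conv_linl scaleN1r addrC.
  have Ahe : h - e \in A by rewrite rpredB.
  have he : conv (h - e) e = 0 by rewrite convB ee comm // eh subrr.
  have eh0 : conv e (h - e) = 0 by rewrite comm.
  have hehe : conv (h - e) (h - e) = h - e.
    by rewrite convB eh0 subr0 comm // convB hh eh.
  have hE : h = e + (h - e) by rewrite addrC subrK.
  have [|/eqP] := hP _ _ Aconv Ahe ee hehe eh0 he hE; first by left.
  by rewrite subr_eq0 => /eqP; right.
have ef : conv e f = e by rewrite /e comm // convA ff.
have eg : conv e g = e by rewrite /e -convA gg.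
have [//|fe] := split_prim f Af ff ef fP.
have [//|ge] := split_prim g Ag gg eg gP.
by case/eqP: fg; rewrite fe -ge.
Qed.

End CharacterAlgebra.

Theorem theorem3p9 (R : realType) (k : closedFieldType) (H : hopfType k)
    (chark : [pchar k] =i pred0)
    (ssH : semisimple H) (qtH : quasitriangular H)
    (L : H) (hL : idempotent_integral L)
    (n : nat) (chi F : 'I_n.+1 -> 'Hom(H, (k^o)%type))
    (hchi : irr_enum chi) (hF : primitive_idempotent_enum chi F) :
  probabilistically_nilpotent R L F.
Proof.
have [r hr] := qtH; have [chi_inj chiP chi0] := hchi; have [F_inj FP FE] := hF.
have uU := drinfeld_unit hL hr; have S2u := anti2 hL hr.
have /choice[rep repP] i : exists x : {m : nat & 'AHom(H, 'M[k]_m.+1)},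
    irreducible (projT2 x) /\ forall a, chi i a = \tr (projT2 x a).
  have /chiP[m [s sP]] : exists j, chi i = chi j by exists i.
  by exists (existT _ m s).
pose dm i := projT1 (rep i).
pose rho i : 'AHom(H, 'M[k]_((dm i).+1)) := projT2 (rep i).
have irho i : irreducible (rho i) by have [] := repP i.
have chiE i a : chi i a = \tr (rho i a) by have [_ ->] := repP i.
have rho_neq i j : i != j -> ~ (forall h, \tr (rho i h) = \tr (rho j h)).
  by move/eqP=> nij E; apply: nij; apply: chi_inj; apply/lfunP => h; rewrite !chiE.
have rho_all m (s : 'AHom(H, 'M[k]_m.+1)) : irreducible s ->
    exists i, forall h, \tr (s h) = \tr (rho i h).
  move=> irs; have lt : linear (fun h => \tr (s h) : k^o) by lin.
  have [|i E] := (chiP (linfun (fun h => \tr (s h) : k^o))).1.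
    by exists m, s; split=> // a; rewrite lfunE_lin.
  by exists i => h; rewrite -chiE -E lfunE_lin.
have rho0 h : \tr (rho ord0 h) = ε h by rewrite -chiE chi0.
have chi_tr i (x y : H) : chi i (x * y) = chi i (y * x).
  by rewrite !chiE rep_tracelike.
have trP q : q \in character_algebra chi <-> tracelike q.
  split=> [qA x y|tq].
    rewrite (coord_span (X := in_tuple (codom chi)) qA) !sum_lfunE.
    apply: eq_bigr => i _; rewrite !scale_lfunE; congr (_ *: _).
    by have /codomP[j ->] := mem_nth 0 (ltn_ord i : (i < size (codom chi))%N).
  rewrite (_ : q = \sum_i (q (munit L (drinfeld r) rho (ord0 : 'I_(dm i).+1) ord0) : k) *: chi i).
    by apply: memv_suml => i _; rewrite memvZ // memv_span // codom_f.
  apply/lfunP => x; rewrite sum_lfunE.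
  rewrite (tracelike_span hL uU S2u ssH irho rho_neq rho_all tq).
  by apply: eq_bigr => i _; rewrite scale_lfunE chiE.
have F_prim i : primitive_idempotent (character_algebra chi) (F i).
  by apply/FP; exists i.
have F_tr i : tracelike (F i).
  by apply/trP; have [] := F_prim i.
have F_neq0 i : F i != 0 by have [] := F_prim i.
have F_conv i j : conv (F i) (F j) = if i == j then F i else 0.
  case: (eqVneq i j) => [->|nij]; first by have [] := F_prim j.
  apply: (primitive_orth hr trP (F_prim i) (F_prim j)).
  by rewrite (inj_eq F_inj).
have chiL i : chi i L = (i == ord0)%:R.
  case: (eqVneq i ord0) => [->|ni0]; first by rewrite chi0 [LHS](coun_int hL).
  have := char_orth hL (irho i) (irho ord0) (rho_neq i ord0 ni0).
  rewrite (eq_tlift (G := fun a b => (ε b : k) *: chi i a)) => [|a b].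
    by rewrite (sw_counitr (G := fun a => chi i a)).
  by rewrite rho0 coun_anti -chiE [LHS]mulrC.
have d0 := dim_neq0 H chark.
have F0L : F ord0 L = (\dim {:H})%:R^-1.
  rewrite FE scale_lfunE /dual_integral sum_lfunE (bigD1 ord0) //= big1 => [|i ni0].
    by rewrite scale_lfunE chiL chi0 [counit 1]coun1 addr0 scale1r /GRing.scale /= mulr1.
  by rewrite scale_lfunE chiL (negPf ni0) scaler0.
have S2 : forall h : H, S (S h) = h.
  apply: (anti2_id chark hL hr ssH irho rho_neq rho_all rho0 (F_tr ord0)).
    by rewrite F_conv eqxx.
  by rewrite F0L mulVf.
(* The F_i are independent, being orthogonal idempotents, and there are as many
   of them as characters spanning R(H). *)
have F_span (q : 'Hom(H, (k^o)%type)) : tracelike q ->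
    exists c : 'I_n.+1 -> k, q = \sum_i c i *: F i.
  move=> tq; have qA := (trP q).2 tq; pose X := [tuple F i | i < n.+1].
  have XE (i : 'I_n.+1) : X`_i = F i by rewrite -tnth_nth tnth_mktuple.
  have fX : free X.
    apply/freeP => c c0 i; move/(congr1 (fun q => conv q (F i))): c0.
    rewrite (linS (f := fun q => conv q (F i))); last exact: conv_linl.
    rewrite (bigD1 i) //= big1 => [|j nji].
      rewrite XE (linZ (f := fun q => conv q (F i))); last exact: conv_linl.
      rewrite F_conv eqxx addr0 (lin0 (f := fun q => conv q (F i))); last exact: conv_linl.
      by move/eqP; rewrite scaler_eq0 (negPf (F_neq0 i)) orbF => /eqP.
    rewrite XE (linZ (f := fun q => conv q (F i))); last exact: conv_linl.
    by rewrite F_conv (negPf nji) scaler0.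
  have XA : <<X>>%VS = character_algebra chi.
    apply/eqP; rewrite eqEdim; apply/andP; split.
      apply/span_subvP => q' /mapP[i _ ->]; by have [] := F_prim i.
    rewrite (eqnP fX) size_tuple (leq_trans (dim_span _)) //.
    by rewrite size_codom card_ord.
  exists (fun i => coord X i q); rewrite {1}(coord_span (X := X) (v := q)) ?XA //.
  by apply: eq_bigr => i _; rewrite XE.
(* Up to the factor 1/d this is the sum of the squared character degrees. *)
have F01 : F ord0 1 != 0.
  rewrite FE scale_lfunE /dual_integral sum_lfunE scaler_eq0 invr_eq0 (negPf d0) /=.
  rewrite (_ : \sum_i _ = (\sum_i (dm i).+1 ^ 2)%N%:R); last first.
    rewrite natr_sum; apply: eq_bigr => i _.
    by rewrite scale_lfunE chiE rep1 mxtrace1 natrX expr2.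
  by rewrite natr0_eq0 // (bigD1 ord0) //= addn_eq0 expn_eq0.
(* In R(H), lam * F_0 is a multiple of F_0 by orthogonality and a multiple of
   lam because lam is an integral; the values at L fix the ratio. *)
have F0E : lam H = (\dim {:H})%:R *: F ord0.
  have conv_lam q : conv (lam H) q = (q 1 : k) *: lam H.
    apply/lfunP => h; rewrite conv_sw scale_lfunE.
    have /(congr1 q) := lam_int h; rewrite lfun_tlift linearZ /= => E.
    rewrite [RHS]mulrC -[RHS]E; apply: eq_tlift => a b.
    by rewrite linearZ.
  have [c Ec] := F_span (lam H) (lamC hL S2).
  have E : (F ord0 1 : k) *: lam H = c ord0 *: F ord0.
    rewrite -conv_lam {1}Ec (linS (f := fun q => conv q (F ord0))); last exact: conv_linl.
    rewrite (bigD1 ord0) //= big1 => [|j nj0];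
      rewrite (linZ (f := fun q => conv q (F ord0))); try exact: conv_linl.
      by rewrite F_conv eqxx addr0.
    by rewrite F_conv (negPf nj0) scaler0.
  have cE : c ord0 = F ord0 1 * (\dim {:H})%:R.
    have := congr1 (fun q : 'Hom(H, (k^o)%type) => q L : k) E.
    rewrite /= !scale_lfunE (lam_L hL) F0L => /(congr1 (fun x : k => x * (\dim {:H})%:R)).
    by rewrite /GRing.scale /= mulr1 -mulrA mulVf // mulr1 => ->.
  by apply: (scalerI F01); rewrite E cE scalerA.
exact: (commutator_walk chark hL hr S2 F_tr F_neq0 F_conv F_span F0E).
Qed.
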